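(* The ring $\mathscr{H}^\infty$ of bounded Dirichlet series is not a coherent ring.
   Context: Let $\mathbb{N}=\{1,2,3,\dots\}$ and $\mathbb{C}_{>0}=\{s\in\mathbb{C}:\operatorname{Re}(s)>0\}$. $\mathscr{H}^\infty$ denotes the set of Dirichlet series $f(s)=\sum_{n=1}^\infty \frac{a_n}{n^s}$, where $(a_n)_{n\in\mathbb{N}}$ is a sequence of complex numbers, such that $f$ is holomorphic and bounded in $\mathbb{C}_{>0}$ (i.e. the bounded holomorphic functions $f$ on $\mathbb{C}_{>0}$ that are represented by a Dirichlet series converging in some half-plane $\operatorname{Re}(s)>\sigma_0$; by a theorem of Bohr the series then converges in all of $\mathbb{C}_{>0}$). With pointwise operations and the norm $\|f\|_\infty=\sup_{s\in\mathbb{C}_{>0}}|f(s)|$, $\mathscr{H}^\infty$ is a unital commutative complex Banach algebra. Coherence: Let $R$ be a unital commutative ring. For $n\in\mathbb{N}$ and $\mathbf{f}=(f_1,\dots,f_n)\in R^n$, a relation on $\mathbf{f}$ is an $n$-tuple $\mathbf{g}=(g_1,\dots,g_n)\in R^n$ such that $g_1f_1+\cdots+g_nf_n=0$; the set of all relations on $\mathbf{f}$ is denoted $\mathbf{f}^\perp$, an $R$-submodule of $R^n$. The ring $R$ is coherent if for each $n\in\mathbb{N}$ and each $\mathbf{f}\in R^n$, the $R$-module $\mathbf{f}^\perp$ is finitely generated. *)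

(* Defs.v *)
From HB Require Import structures.
From mathcomp Require Import all_boot all_order all_algebra.
From mathcomp Require Import complex.
From mathcomp Require Import all_classical all_reals all_analysis.
From mathcomp Require Import ring lra.
Set Implicit Arguments.
Unset Strict Implicit.
Unset Printing Implicit Defensive.
Import Order.TTheory GRing.Theory Num.Theory numFieldNormedType.Exports.
Local Open Scope classical_set_scope.
Local Open Scope ring_scope.
Local Open Scope complex_scope.

Definition generates (A : pzRingType) (V : lmodType A) (k : nat)
    (v : 'I_k -> V) (N : set V) : Prop :=
  N = [set x | exists c : 'I_k -> A, x = \sum_(j < k) c j *: v j].

Definition finitely_generated (A : pzRingType) (V : lmodType A)
    (N : set V) : Prop :=
  exists (k : nat) (v : 'I_k -> V), generates v N.

Definition relations (A : comPzRingType) (n : nat) (f : 'rV[A]_n) :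
    set 'rV[A]_n :=
  [set g | \sum_(i < n) g 0 i * f 0 i = 0].

Definition coherent (A : comPzRingType) : Prop :=
  forall (n : nat), (0 < n)%N ->
  forall f : 'rV[A]_n, finitely_generated (relations f).

(* MathComp-Analysis attaches the metric topology to abstract [numFieldType]s
   only; this transfers it to the concrete complex numbers [R[i]]. *)
HB.instance Definition _ (R : rcfType) := NormedModule.copy R[i] R[i]^o.

Section BoundedDirichletSeries.
Variable R : realType.
Local Notation C := R[i].

(* Unqualified, [Re] would be the [C]-valued real part of [Num.Theory]. *)
Definition half_plane : Type := {s : C | 0 < complex.Re s}.

Lemma half_plane_point_subproof : 0 < complex.Re (1%:C : C).
Proof. exact: ltr01. Qed.

HB.instance Definition _ := Choice.on half_plane.
HB.instance Definition _ := SubType.on half_plane.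
HB.instance Definition _ :=
  isPointed.Build half_plane (exist _ (1%:C : C) half_plane_point_subproof).

(* [n ^ s = exp (s * ln n)], by Euler's formula; meant for [n > 0]. *)
Definition natpow (n : nat) (s : C) : C :=
  (expR (complex.Re s * ln n%:R) * cos (complex.Im s * ln n%:R))
    +i* (expR (complex.Re s * ln n%:R) * sin (complex.Im s * ln n%:R)).

(* Outside the half-plane [insubd s z] is the junk value [s]; as the half-plane
   is open this does not affect the derivative at [s]. *)
Definition holomorphic (f : half_plane -> C) : Prop :=
  forall s : half_plane, derivable (fun z : C => f (insubd s z)) (val s) 1.

Definition bounded_on_half_plane (f : half_plane -> C) : Prop :=
  exists M : R, forall s : half_plane, `|f s| <= M%:C.

Definition dirichlet_representable (f : half_plane -> C) : Prop :=
  exists (a : nat -> C) (sigma0 : R), forall s : half_plane,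
    sigma0 < complex.Re (val s) ->
    (fun N => \sum_(1 <= n < N) a n / natpow n (val s)) @ \oo --> f s.

Definition Hinf_pred : {pred half_plane -> C} :=
  mem [set f | [/\ holomorphic f, bounded_on_half_plane f
                 & dirichlet_representable f]].

Lemma holomorphic1 : holomorphic (1 : half_plane -> C).
Proof. by move=> s; exact: derivable_cst. Qed.

Lemma holomorphicB f g :
  holomorphic f -> holomorphic g -> holomorphic (f - g).
Proof. by move=> hf hg s; exact: (derivableB (hf s) (hg s)). Qed.

Lemma holomorphicM f g :
  holomorphic f -> holomorphic g -> holomorphic (f * g).
Proof. by move=> hf hg s; exact: (derivableM (hf s) (hg s)). Qed.

Lemma bounded_on_half_plane1 : bounded_on_half_plane (1 : half_plane -> C).
Proof. by exists 1 => s; rewrite normr1 lecR. Qed.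

Lemma bounded_on_half_planeB f g :
  bounded_on_half_plane f -> bounded_on_half_plane g ->
  bounded_on_half_plane (f - g).
Proof.
move=> [M hM] [M' hM']; exists (M + M') => s.
by rewrite rmorphD/= (le_trans (ler_normB _ _))// lerD.
Qed.

Lemma bounded_on_half_planeM f g :
  bounded_on_half_plane f -> bounded_on_half_plane g ->
  bounded_on_half_plane (f * g).
Proof.
move=> [M hM] [M' hM']; exists (M * M') => s.
by rewrite rmorphM/= normrM ler_pM.
Qed.

Lemma norm_natpow n (s : C) :
  `|natpow n s| = (expR (complex.Re s * ln n%:R))%:C.
Proof.
rewrite /natpow normc_def /=; congr (_ %:C).
by rewrite !exprMn -mulrDr cos2Dsin2 mulr1 sqrtr_sqr ger0_norm// expR_ge0.
Qed.

Lemma natpow_neq0 n (s : C) : natpow n s != 0.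
Proof. by rewrite -normr_eq0 norm_natpow (inj_eq (@complexI _)) gt_eqF ?expR_gt0. Qed.

Lemma natpowM m n (s : C) : (0 < m)%N -> (0 < n)%N ->
  natpow (m * n) s = natpow m s * natpow n s.
Proof.
move=> m0 n0; rewrite /natpow natrM lnM ?posrE ?ltr0n// !mulrDr expRD.
rewrite cosD sinD; apply/eqP; rewrite eq_complex /=; apply/andP; split.
  by apply/eqP; ring.
by apply/eqP; ring.
Qed.

Lemma natpow1 (s : C) : natpow 1 s = 1.
Proof. by rewrite /natpow ln1 !mulr0 expR0 cos0 sin0 mulr1 mulr0. Qed.

Lemma dirichlet_representable1 : dirichlet_representable (1 : half_plane -> C).
Proof.
exists (fun n => (n == 1%N)%:R), 0 => s _.
apply: (@cvg_near_cst _ _ (1 : C)); exists 2%N => // N /= N2.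
rewrite big_ltn// natpow1 divr1 /= big_nat_cond big1 ?addr0// => i.
by rewrite andbT => /andP[i2 _]; rewrite gtn_eqF// mul0r.
Qed.

Lemma dirichlet_representableB f g :
  dirichlet_representable f -> dirichlet_representable g ->
  dirichlet_representable (f - g).
Proof.
move=> [a [sa ha]] [b [sb hb]]; exists (fun n => a n - b n), (Num.max sa sb) => s.
rewrite gt_max => /andP[hsa hsb].
rewrite (_ : (fun N => _) =
  (fun N => \sum_(1 <= n < N) a n / natpow n (val s)) -
  (fun N => \sum_(1 <= n < N) b n / natpow n (val s))).
  exact: cvgB (ha _ hsa) (hb _ hsb).
apply/funext => N; rewrite /GRing.add /GRing.opp /= -sumrB.
by apply: eq_bigr => i _; rewrite mulrBl.
Qed.

Lemma convergent_series_bounded (u : nat -> C) (l : C) :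
  (fun N => \sum_(1 <= n < N) u n) @ \oo --> l ->
  exists2 B : R, 0 <= B & forall n, (0 < n)%N -> `|u n| <= B%:C.
Proof.
move=> /cvgrPdist_lt /(_ 1 ltr01)[N0 _ hN].
pose nrm (z : C) := complex.Re `|z|.
have normE z : `|z| = (nrm z)%:C by rewrite RRe_real ?normr_real.
have nrm0 z : 0 <= nrm z by rewrite -ler0c -normE.
exists (2 + \sum_(0 <= n < N0) nrm (u n)).
  by rewrite addr_ge0// sumr_ge0.
move=> n n0.
have [lenN|ltNn] := leqP N0 n; last first.
  rewrite normE lecR (@bigD1_seq _ _ _ _ _ n)//= ?mem_index_iota ?iota_uniq//.
  rewrite addrCA lerDl addr_ge0// sumr_ge0// => i _.
apply: (@le_trans _ _ 2%:C); last by rewrite lecR lerDl sumr_ge0.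
have -> : u n = (l - \sum_(1 <= n < n) u n) - (l - \sum_(1 <= n < n.+1) u n).
  by rewrite big_nat_recr//=; ring.
rewrite (le_trans (ler_normB _ _))// (_ : 2%:C = 1 + 1); last first.
  by rewrite -[2]/(1 + 1) rmorphD.
by rewrite lerD// ltW// hN//=; exact: leqW.
Qed.

Definition convolution (a b : nat -> C) (n : nat) : C :=
  \sum_(1 <= i < n.+1) \sum_(1 <= j < n.+1 | (i * j == n)%N) a i * b j.

Lemma convolution_widen (a b : nat -> C) (n N : nat) : (0 < n < N)%N ->
  convolution a b n =
  \sum_(1 <= i < N) \sum_(1 <= j < N | (i * j == n)%N) a i * b j.
Proof.
move=> /andP[n0 nN]; rewrite /convolution.
rewrite (@big_cat_nat _ _ _ n.+1 1%N N)//= [X in _ = _ + X]big_nat_cond.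
rewrite [X in _ = _ + X]big1 ?addr0 => [|i]; last first.
  rewrite andbT => /andP[ni _]; rewrite big_nat_cond big1// => j.
  move=> /andP[/andP[j0 _] /eqP ijn]; exfalso.
  by move: ni; rewrite ltnNge -ijn leq_pmulr.
rewrite [LHS]big_nat_cond [RHS]big_nat_cond.
apply: eq_bigr => i /andP[/andP[i0 _] _].
rewrite (@big_cat_nat _ _ _ n.+1 1%N N)//= [X in _ = _ + X]big_nat_cond.
rewrite [X in _ = _ + X]big1 ?addr0// => j /andP[/andP[nj _] /eqP ijn].
by exfalso; move: nj; rewrite ltnNge -ijn leq_pmull.
Qed.

Lemma sum_convolution (a b : nat -> C) (N : nat) :
  \sum_(1 <= n < N) convolution a b n =
  \sum_(1 <= i < N) \sum_(1 <= j < N | (i * j < N)%N) a i * b j.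
Proof.
rewrite big_nat_cond (eq_bigr (fun n =>
  \sum_(1 <= i < N) \sum_(1 <= j < N | (i * j == n)%N) a i * b j)); last first.
  by move=> n; rewrite andbT => /convolution_widen ->.
rewrite -big_nat_cond exchange_big/= [LHS]big_nat_cond [RHS]big_nat_cond.
apply: eq_bigr => i /andP[/andP[i0 _] _].
under eq_bigr do rewrite big_mkcond.
rewrite exchange_big/= [RHS]big_mkcond [LHS]big_nat_cond [RHS]big_nat_cond.
apply: eq_bigr => j /andP[/andP[j0 _] _].
have ij0 : (0 < i * j)%N by rewrite muln_gt0 i0.
case: ifPn => [ijN|ijN].
  rewrite (bigD1_seq (i * j)%N)/= ?mem_index_iota ?iota_uniq ?ij0// eqxx.
  by rewrite big1 ?addr0// => n /negPf nij; rewrite eq_sym nij.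
rewrite big_nat_cond big1// => n /andP[/andP[_ nN] _].
by case: eqP => // ijn; move: ijN; rewrite ijn nN.
Qed.

Lemma cvg_convolution (a b : nat -> C) (la lb : C) (A B : R) :
  0 <= A -> 0 <= B ->
  (forall n, (0 < n)%N -> `|a n| <= (A / n%:R ^+ 3)%:C) ->
  (forall n, (0 < n)%N -> `|b n| <= (B / n%:R ^+ 3)%:C) ->
  (fun N => \sum_(1 <= n < N) a n) @ \oo --> la ->
  (fun N => \sum_(1 <= n < N) b n) @ \oo --> lb ->
  (fun N => \sum_(1 <= n < N) convolution a b n) @ \oo --> la * lb.
Proof.
move=> A0 B0 hA hB ha hb.
pose r N : C := \sum_(1 <= i < N) \sum_(1 <= j < N | ~~ (i * j < N)%N) a i * b j.
rewrite (_ : (fun N => _) = (fun N => \sum_(1 <= n < N) a n) *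
  (fun N => \sum_(1 <= n < N) b n) - r); last first.
  apply/funext => N; rewrite sum_convolution.
  rewrite [RHS](_ : _ = (\sum_(1 <= n < N) a n) * (\sum_(1 <= n < N) b n) - r N)//.
  apply/eqP; rewrite -subr_eq opprK -big_split/= big_distrl/=; apply/eqP.
  apply: eq_bigr => i _; rewrite big_distrr/=.
  by rewrite [RHS](bigID (fun j => (i * j < N)%N)).
rewrite -[la * lb]subr0; apply: cvgB; first exact: (cvgM ha hb).
apply/cvgrPdist_lt => e e0.
have [eE ee0] : e = (complex.Re e)%:C /\ 0 < complex.Re e.
  by move: e0; rewrite ltcE /= => /andP[/eqP ie re]; case: e ie re => ? ? /= ->.
have [k hk] : exists k : nat, A * B / complex.Re e < k%:R.
  by exists (Num.truncn (A * B / complex.Re e)).+1; exact: truncnS_gt.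
exists k.+1 => // N /= kN; have N0 : (0 < N)%N by exact: leq_trans kN.
rewrite sub0r normrN eE.
apply: (@le_lt_trans _ _ (A * B / N%:R)%:C); last first.
  have : A * B / complex.Re e < N%:R by apply: lt_trans hk _; rewrite ltr_nat.
  by rewrite ltcR !ltr_pdivrMr ?ltr0n// [N%:R * _]mulrC.
have Npos : 0 < N%:R :> R by rewrite ltr0n.
have -> : A * B / N%:R = \sum_(0 <= i < N) \sum_(0 <= j < N) (A * B / N%:R ^+ 3).
  rewrite !sumr_const_nat subn0 -mulrnA -[LHS]mulr1 -[RHS]mulr_natr natrM; field.
  by rewrite gt_eqF.
have AB0 : 0 <= A * B / N%:R ^+ 3 by rewrite divr_ge0 ?mulr_ge0 ?exprn_ge0// ltW.
have bound (i j : nat) : (0 < i)%N -> (0 < j)%N -> (N <= i * j)%N ->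
    `|a i * b j| <= (A * B / N%:R ^+ 3)%:C.
  move=> i0 j0 Nij; rewrite normrM.
  apply: (@le_trans _ _ ((A / i%:R ^+ 3)%:C * (B / j%:R ^+ 3)%:C)).
    by rewrite ler_pM// ?hA ?hB.
  rewrite -rmorphM lecR mulf_div -exprMn -natrM ler_wpM2l ?mulr_ge0//.
  rewrite lef_pV2 ?posrE ?exprn_gt0 ?ltr0n ?muln_gt0 ?i0//.
  by rewrite lerXn2r ?nnegrE ?ler0n// ler_nat.
rewrite /r (le_trans (ler_norm_sum _ _ _))//.
rewrite rmorph_sum/= [leRHS]big_ltn// -[leLHS]add0r lerD//.
  by rewrite lecR sumr_ge0.
rewrite big_nat_cond [leRHS]big_nat_cond; apply: ler_sum => i /andP[/andP[i0 iN] _].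
rewrite (le_trans (ler_norm_sum _ _ _))//.
rewrite rmorph_sum/= [leRHS]big_ltn// -[leLHS]add0r lerD//.
  by rewrite lecR.
rewrite big_mkcond big_nat_cond [leRHS]big_nat_cond.
apply: ler_sum => j /andP[/andP[j0 jN] _].
by case: ifPn => [|_]; [rewrite -leqNgt; exact: bound | rewrite lecR].
Qed.

Lemma dirichlet_decay (a : nat -> C) (t : R) (s : C) (B : R) :
  t + 3 <= complex.Re s ->
  (forall n, (0 < n)%N -> `|a n / natpow n t%:C| <= B%:C) ->
  forall n, (0 < n)%N -> `|a n / natpow n s| <= (B / n%:R ^+ 3)%:C.
Proof.
move=> ts hB n n0; have npos : 0 < n%:R :> R by rewrite ltr0n.
have -> : a n / natpow n s = a n / natpow n t%:C * (natpow n t%:C / natpow n s).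
  by field; rewrite !natpow_neq0.
rewrite normrM (_ : (B / _)%:C = B%:C * (n%:R ^- 3)%:C); last by rewrite -rmorphM.
apply: ler_pM => //; first exact: hB.
have L0 : 0 <= ln n%:R :> R by rewrite ln_ge0// ler1n.
have -> : n%:R ^- 3 = expR (- (3 * ln n%:R)) :> R.
  by rewrite expRN -(lnK (x := n%:R ^+ 3)) ?posrE ?exprn_gt0// lnXn// mulr_natl.
rewrite normrM normfV !norm_natpow -fmorphV -rmorphM lecR /= -expRN -expRD.
rewrite ler_expR; nra.
Qed.

Lemma dirichlet_representableM f g :
  dirichlet_representable f -> dirichlet_representable g ->
  dirichlet_representable (f * g).
Proof.
move=> [a [sa ha]] [b [sb hb]].
pose t := Num.max 0 (Num.max sa sb) + 1.
have [t0 tsa tsb] : [/\ 0 < t, sa < t & sb < t].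
  have : Num.max 0 (Num.max sa sb) < t by rewrite /t ltrDl.
  by rewrite !gt_max => /and3P[].
pose ht : half_plane := exist (fun s : C => 0 < complex.Re s) t%:C t0.
have [A A0 hA] := convergent_series_bounded (ha ht tsa).
have [B B0 hB] := convergent_series_bounded (hb ht tsb).
exists (convolution a b), (t + 3) => s ts.
have -> : (fun N => \sum_(1 <= n < N) convolution a b n / natpow n (val s)) =
  (fun N => \sum_(1 <= n < N) convolution (fun n => a n / natpow n (val s))
     (fun n => b n / natpow n (val s)) n).
  apply/funext => N; apply: eq_bigr => n _; rewrite /convolution mulr_suml.
  rewrite [LHS]big_nat_cond [RHS]big_nat_cond.
  apply: eq_bigr => i /andP[/andP[i0 _] _]; rewrite mulr_suml.
  rewrite [LHS]big_nat_cond [RHS]big_nat_cond.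
  apply: eq_bigr => j /andP[/andP[j0 _] /eqP <-].
  by rewrite natpowM//; field; rewrite !natpow_neq0.
apply: (cvg_convolution A0 B0).
- exact: dirichlet_decay (ltW ts) hA.
- exact: dirichlet_decay (ltW ts) hB.
- by apply: ha; lra.
- by apply: hb; lra.
Qed.

Lemma Hinf_predP (f : half_plane -> C) :
  reflect [/\ holomorphic f, bounded_on_half_plane f
            & dirichlet_representable f]
          (f \in Hinf_pred).
Proof. by apply: (iffP idP) => [/set_mem|hf]; [|exact/mem_set]. Qed.

Lemma Hinf_subring_closed : GRing.subring_closed Hinf_pred.
Proof.
split=> [|f g /Hinf_predP[hf bf df] /Hinf_predP[hg bg dg]
         |f g /Hinf_predP[hf bf df] /Hinf_predP[hg bg dg]];
  apply/Hinf_predP; split.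
- exact: holomorphic1.
- exact: bounded_on_half_plane1.
- exact: dirichlet_representable1.
- exact: (holomorphicB hf hg).
- exact: (bounded_on_half_planeB bf bg).
- exact: (dirichlet_representableB df dg).
- exact: (holomorphicM hf hg).
- exact: (bounded_on_half_planeM bf bg).
- exact: (dirichlet_representableM df dg).
Qed.

HB.instance Definition _ :=
  GRing.isSubringClosed.Build _ Hinf_pred Hinf_subring_closed.

Record Hinf : Type := MkHinf {
  Hinf_fun :> half_plane -> C;
  _ : Hinf_fun \in Hinf_pred }.

HB.instance Definition _ := [isSub for Hinf_fun].
HB.instance Definition _ := [Choice of Hinf by <:].
HB.instance Definition _ := [SubChoice_isSubComNzRing of Hinf by <:].

End BoundedDirichletSeries.

(* Main.v *)
(* Write x, z, w for the Dirichlet polynomials 2^-s, 3^-s, 5^-s.  The relations of the pair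
   (z - w, 1 - x) that matter are (h, -h') with h = (1 - x) H, h' = (z - w) H, where H is a
   sum over a set of indices j of the terms
     z^N ((1 - x^N) / (1 - x))^2 ((z^N - w^N) / (z - w))^2 / N^3,   N = 64^(j+1).
   Each H is unbounded, but h and h' are bounded since min(y, 1/y) is summable along a
   geometric progression.

   Completely multiplicative characters chi that are absolutely summable extend to
   evaluations with |ev chi f| <= sup |f|; this rests on |a_n| <= sup |f| (contour shift of
   the mean value of f(s) n^s, using Goursat's theorem) and on the power trick.  So an
   element of the ring may be evaluated at every point (x, z, w) of the open unit polydisc.

   Suppose the relations are generated by r of them.  Distribute the indices j over r + 1
   classes modulo r + 1, and write the resulting h_k as combinations of the first components
   g_i with coefficients c_ki.  Evaluate at x = 1 - e, z = w = rho_j zeta, where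
   1 - rho_j = 1 / (4 * 64^(j+1)): the j-th term dominates there and
   |g_i| <= O(e) / (1 - rho_j), so the scaled matrix of the h_k along r + 1
   consecutive j is nearly diagonal.  By Parseval and the pigeonhole principle, zeta and the
   block of r + 1 consecutive j can be chosen such that the bounded functions c_ki are nearly
   constant on the block.  Then this nearly diagonal matrix of rank r + 1 would be close to
   a matrix of rank at most r, a contradiction. *)
Require Import Defs.
From HB Require Import structures.
From mathcomp Require Import all_boot all_order all_algebra.
From mathcomp Require Import complex.
From mathcomp Require Import all_classical all_reals all_analysis.
From mathcomp Require Import ring lra.
Set Implicit Arguments.
Unset Strict Implicit.
Unset Printing Implicit Defensive.
Import Order.TTheory GRing.Theory Num.Theory numFieldNormedType.Exports.
Local Open Scope classical_set_scope.
Local Open Scope ring_scope.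
Local Open Scope complex_scope.

(** * Complex derivatives and Goursat's theorem *)

(** The coefficients [c_ki] are unknown bounded elements, and at the evaluation points a single
    [h_k] is of the order [e * lac j] that the generators may reach too; one [h_k] alone gives no
    contradiction, only the rank of [r + 1] of them does. For this the [c_ki] must nearly agree at
    several radii. They do so somewhere because the squared increments of a bounded series along
    increasing radii, averaged over the circle, have a total bounded independently of the number of
    radii: among sufficiently many blocks of radii, one has negligible increments.

    The order of the choices matters. The number [Q] of blocks depends on the [c_ki] and on the
    precision but not on [x = 1 - e], so [e] can be chosen afterwards, below the scale of all radii
    involved. Upper and lower bound are then both proportional to [e * lac j], and only absolute
    constants are compared.

    In a block, the cube balances the squares and leaves the size [N], and [z^N] makes the sum
    converge in the open polydisc. The ratio [64] leaves at least [3/16] for the diagonal block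
    against at most [1/16] for all others. *)

Section ComplexModulus.
Variable R : realType.
Local Notation C := R[i].
Implicit Types (z w : C) (x y : R).

(** The norm of [R[i]] is valued in [R[i]]; a real modulus keeps estimates within reach of [lra] and
    [nra]. *)
Definition cabs (z : C) : R := complex.Re `|z|.

Lemma normcE z : `|z| = (cabs z)%:C.
Proof. by rewrite /cabs RRe_real ?normr_real. Qed.

Lemma cabs_ge0 z : 0 <= cabs z.
Proof. by rewrite -ler0c -normcE. Qed.

Lemma cabsD z w : cabs (z + w) <= cabs z + cabs w.
Proof. by rewrite -lecR rmorphD/= -!normcE ler_normD. Qed.

Lemma cabsM z w : cabs (z * w) = cabs z * cabs w.
Proof. by apply: (@complexI R); rewrite rmorphM/= -!normcE normrM. Qed.

Lemma cabsN z : cabs (- z) = cabs z.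
Proof. by rewrite /cabs normrN. Qed.

Lemma cabsB z w : cabs (z - w) <= cabs z + cabs w.
Proof. by rewrite -(cabsN w) cabsD. Qed.

Lemma cabsBC z w : cabs (z - w) = cabs (w - z).
Proof. by rewrite -cabsN opprB. Qed.

Lemma cabs0 : cabs 0 = 0.
Proof. by rewrite /cabs normr0. Qed.

Lemma cabs1 : cabs 1 = 1.
Proof. by rewrite /cabs normr1. Qed.

Lemma cabsX z n : cabs (z ^+ n) = cabs z ^+ n.
Proof. by elim: n => [|n ih]; rewrite ?expr0 ?cabs1// !exprS cabsM ih. Qed.

Lemma cabs_real x : cabs x%:C = `|x|.
Proof. by rewrite /cabs normc_def /= expr0n addr0 sqrtr_sqr. Qed.

Lemma cabs_eq0 z : (cabs z == 0) = (z == 0).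
Proof. by rewrite -[RHS]normr_eq0 normcE (inj_eq (@complexI R)). Qed.

Lemma cabs_gt0 z : (0 < cabs z) = (z != 0).
Proof. by rewrite lt_def cabs_eq0 cabs_ge0 andbT. Qed.

Lemma cabsV z : cabs z^-1 = (cabs z)^-1.
Proof.
have [->|z0] := eqVneq z 0; first by rewrite !(invr0, cabs0).
have zn0 : cabs z != 0 by rewrite cabs_eq0.
by apply: (mulfI zn0); rewrite -cabsM !divff// cabs1.
Qed.

Lemma cabs_nat n : cabs n%:R = n%:R.
Proof. by rewrite -[n%:R](rmorph_nat (real_complex R)) cabs_real ger0_norm. Qed.

Lemma cabs_sum (I : Type) (r : seq I) (P : pred I) (F : I -> C) :
  cabs (\sum_(i <- r | P i) F i) <= \sum_(i <- r | P i) cabs (F i).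
Proof.
elim/big_rec2: _ => [|i x z _ ih]; first by rewrite cabs0.
by rewrite (le_trans (cabsD _ _))// lerD2l.
Qed.

Lemma cabs_sqr z : cabs z ^+ 2 = complex.Re z ^+ 2 + complex.Im z ^+ 2.
Proof. by rewrite /cabs normc_def /= sqr_sqrtr// addr_ge0 ?sqr_ge0. Qed.

Lemma cabs_sqrC z : (cabs z ^+ 2)%:C = z * z^*.
Proof. by rewrite rmorphXn/= -normcE normCK. Qed.

Lemma cabs_conj z : cabs z^* = cabs z.
Proof. by rewrite /cabs norm_conjC. Qed.

Lemma ler_normRe z : `|complex.Re z| <= cabs z.
Proof.
rewrite -(@ler_pXn2r _ 2)// ?nnegrE ?cabs_ge0// cabs_sqr real_normK ?num_real//.
by rewrite lerDl sqr_ge0.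
Qed.

Lemma ler_normIm z : `|complex.Im z| <= cabs z.
Proof.
rewrite -(@ler_pXn2r _ 2)// ?nnegrE ?cabs_ge0// cabs_sqr [X in X <= _]real_normK ?num_real//.
by rewrite lerDr sqr_ge0.
Qed.

Lemma cabs_le_ReIm z : cabs z <= `|complex.Re z| + `|complex.Im z|.
Proof.
rewrite -(@ler_pXn2r _ 2)// ?nnegrE ?cabs_ge0 ?addr_ge0// cabs_sqr.
have := normr_ge0 (complex.Re z); have := normr_ge0 (complex.Im z).
rewrite -[_ ^+ 2]real_normK ?num_real// -[X in _ + X]real_normK ?num_real//.
nra.
Qed.

Lemma cabs_ge_sub z w : cabs z - cabs w <= cabs (z - w).
Proof. by rewrite lerBlDr -{1}(subrK w z) cabsD. Qed.

End ComplexModulus.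

(** * Derivatives as first-order error estimates, and the mean value inequality *)

Section ComplexDerivative.
Variable R : realType.
Local Notation C := R[i].
Implicit Types (z w l p c : C) (x y t a b e : R).

(** The difference quotient is multiplied out, so that [h = 0] is harmless and composing real and
    complex increments reduces to inequalities between moduli. *)
Definition cdiff (g : C -> C) (z l : C) : Prop :=
  forall e : R, 0 < e -> exists2 d : R, 0 < d &
  forall h : C, cabs h < d -> cabs (g (z + h) - g z - l * h) <= e * cabs h.

Definition rdiff (u : R -> C) (t : R) (l : C) : Prop :=
  forall e : R, 0 < e -> exists2 d : R, 0 < d &
  forall h : R, `|h| < d -> cabs (u (t + h) - u t - l * h%:C) <= e * `|h|.

Lemma rdiffB u v t l k : rdiff u t l -> rdiff v t k ->
  rdiff (fun t => u t - v t) t (l - k).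
Proof.
move=> hu hv e e0; have e20 : 0 < e / 2 by rewrite divr_gt0.
have [d d0 hd] := hu _ e20; have [d' d'0 hd'] := hv _ e20.
exists (Num.min d d'); first by rewrite lt_min d0.
move=> h; rewrite lt_min => /andP[/hd h1 /hd' h2].
rewrite (_ : _ - _ = (u (t + h) - u t - l * h%:C) - (v (t + h) - v t - k * h%:C)).
  by rewrite (le_trans (cabsB _ _))//; lra.
by ring.
Qed.

(** The [+ 1] in [e / (k + 1)] admits a Lipschitz factor [k = 0] without a case distinction. *)
Lemma shrink_le (e k x : R) : 0 <= e -> 0 <= k -> 0 <= x ->
  e / (k + 1) * (x * k) <= e * x.
Proof.
move=> e0 k0 x0; have k1 : 0 < k + 1 by rewrite ltr_wpDl.
rewrite -mulrA ler_wpM2l// mulrC ler_pdivrMr//.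
by rewrite ler_wpM2l// lerDl.
Qed.

Lemma rdiff_comp g p c t l : cdiff g (p + t%:C * c) l ->
  rdiff (fun t => g (p + t%:C * c)) t (l * c).
Proof.
move=> hg e e0; have c1 : 0 < cabs c + 1 by rewrite ltr_wpDl ?cabs_ge0.
have [d d0 hd] := hg (e / (cabs c + 1)) (divr_gt0 e0 c1).
exists (d / (cabs c + 1)); first by rewrite divr_gt0.
move=> h hh; have hc : cabs (h%:C * c) < d.
  rewrite cabsM cabs_real; move: hh; rewrite ltr_pdivlMr//; apply: le_lt_trans.
  by rewrite ler_wpM2l// lerDl.
have := hd _ hc.
rewrite (_ : p + (t + h)%:C * c = p + t%:C * c + h%:C * c); last first.
  by rewrite rmorphD/=; ring.
rewrite (_ : l * c * h%:C = l * (h%:C * c)); last by ring.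
move/le_trans; apply; rewrite cabsM cabs_real.
by rewrite shrink_le ?cabs_ge0// ltW.
Qed.

Lemma rdiff_aff u t l a b : rdiff u (a + t * b) l ->
  rdiff (fun t => u (a + t * b)) t (l * b%:C).
Proof.
move=> hu e e0; have c1 : 0 < `|b| + 1 by rewrite ltr_wpDl.
have [d d0 hd] := hu (e / (`|b| + 1)) (divr_gt0 e0 c1).
exists (d / (`|b| + 1)); first by rewrite divr_gt0.
move=> h hh; have hc : `|h * b| < d.
  rewrite normrM; move: hh; rewrite ltr_pdivlMr//; apply: le_lt_trans.
  by rewrite ler_wpM2l// lerDl.
have := hd _ hc.
rewrite (_ : a + (t + h) * b = a + t * b + h * b); last by ring.
rewrite (_ : l * b%:C * h%:C = l * (h * b)%:C); last by rewrite rmorphM/=; ring.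
move/le_trans; apply; rewrite normrM.
by rewrite shrink_le// ltW.
Qed.

Lemma is_derive_eps (f : R -> R) t df :
  (forall e, 0 < e -> exists2 d : R, 0 < d &
    forall h, `|h| < d -> `|f (t + h) - f t - df * h| <= e * `|h|) ->
  is_derive t 1 f df.
Proof.
move=> hf.
have cv : h^-1 *: ((f \o shift t) (h *: 1) - f t) @[h --> 0^'] --> df.
  apply/cvgrPdist_le => e e0; have [d d0 hd] := hf e e0.
  rewrite near_withinE; apply/nbhs_ballP; exists d => // h.
  rewrite /ball/= sub0r normrN => hlt h0.
  have := hd _ hlt; rewrite /= /GRing.scale/= mulr1 [h + t]addrC => hle.
  rewrite (_ : _ - _ = - (h^-1 * (f (t + h) - f t - df * h))); last first.
    by field.
  by rewrite normrN normrM normfV ler_pdivrMl ?normr_gt0// (mulrC _ e).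
have dv : derivable f t 1 by apply/cvg_ex; exists df.
apply: DeriveDef => //; exact: cvg_lim cv.
Qed.

Lemma eps_is_derive (f : R -> R) t df : is_derive t 1 f df ->
  forall e, 0 < e -> exists2 d : R, 0 < d &
    forall h, `|h| < d -> `|f (t + h) - f t - df * h| <= e * `|h|.
Proof.
move=> [dv <-] e e0.
have /cvgrPdist_le /(_ e e0) := dv; rewrite near_withinE => /nbhs_ballP[d d0 hd].
exists d => // h hh; have [->|h0] := eqVneq h 0.
  by rewrite addr0 mulr0 subrr subr0 !normr0 mulr0.
have := hd h; rewrite /ball/= sub0r normrN => /(_ hh h0).
rewrite /GRing.scale/= mulr1 [h + t]addrC => hle.
rewrite (_ : _ - _ = - (h * ('D_1 f t - h^-1 * (f (t + h) - f t)))); last first.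
  by field.
by rewrite normrN normrM mulrC ler_wpM2r.
Qed.

Lemma Re_increment (v w l : C) (h : R) :
  complex.Re (v - w - l * h%:C) = complex.Re v - complex.Re w - complex.Re l * h.
Proof. by case: v w l => ? ? [? ?] [? ?] /=; ring. Qed.

Lemma Im_increment (v w l : C) (h : R) :
  complex.Im (v - w - l * h%:C) = complex.Im v - complex.Im w - complex.Im l * h.
Proof. by case: v w l => ? ? [? ?] [? ?] /=; ring. Qed.

Lemma rdiff_ReIm (u : R -> C) t l :
  is_derive t 1 (fun t => complex.Re (u t)) (complex.Re l) ->
  is_derive t 1 (fun t => complex.Im (u t)) (complex.Im l) -> rdiff u t l.
Proof.
move=> /eps_is_derive hr /eps_is_derive hi e e0.
have e20 : 0 < e / 2 by rewrite divr_gt0.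
have [d d0 hd] := hr _ e20; have [d' d'0 hd'] := hi _ e20.
exists (Num.min d d'); first by rewrite lt_min d0.
move=> h; rewrite lt_min => /andP[/hd h1 /hd' h2].
apply: (le_trans (cabs_le_ReIm _)).
rewrite Re_increment Im_increment; lra.
Qed.

Lemma rdiff_Re (u : R -> C) t l w : rdiff u t l ->
  is_derive t 1 (fun t => complex.Re (w * u t)) (complex.Re (w * l)).
Proof.
move=> hu; apply: is_derive_eps => e e0.
have c1 : 0 < cabs w + 1 by rewrite ltr_wpDl ?cabs_ge0.
have [d d0 hd] := hu (e / (cabs w + 1)) (divr_gt0 e0 c1).
exists d => // h /hd hh.
rewrite -Re_increment -mulrA -!mulrBr.
apply: (le_trans (ler_normRe _)); rewrite cabsM.
apply: (le_trans (ler_wpM2l (cabs_ge0 _) hh)).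
rewrite mulrA ler_wpM2r// mulrCA ler_piMr ?ltW//.
by rewrite ltr_pdivrMr// mul1r ltrDl.
Qed.

(** The mean value theorem fails as an equality for complex curves. It is applied to the real
    function [Re (w^* * u)] with [w = u b - u a], whose increment is exactly [|w|^2]; one factor
    [|w|] is then cancelled. *)
Lemma rdiff_mvt (u du : R -> C) a b M : a <= b ->
  (forall t, a <= t <= b -> rdiff u t (du t)) ->
  (forall t, a <= t <= b -> cabs (du t) <= M) ->
  cabs (u b - u a) <= M * (b - a).
Proof.
rewrite le_eqVlt => /orP[/eqP->|ab] hu hM; first by rewrite !subrr cabs0 mulr0.
pose w := u b - u a.
have [w0|w0] := eqVneq w 0.
  rewrite -/w w0 cabs0; apply: mulr_ge0; last by rewrite subr_ge0 ltW.
  by apply: le_trans (cabs_ge0 _) (hM a _); rewrite lexx ltW.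
pose phi t := complex.Re (w^* * u t).
have dphi t : a <= t <= b -> is_derive t 1 phi (complex.Re (w^* * du t)).
  by move=> /hu hd; exact: (rdiff_Re w^* hd).
have [||c /[!in_itv]/= /andP[ac cb] hc] := @MVT R phi (fun t => complex.Re (w^* * du t)) a b ab.
- by move=> x; rewrite in_itv/= => /andP[ax xb]; apply: dphi; rewrite !ltW.
- apply: derivable_within_continuous => x; rewrite in_itv/= => /dphi dx.
  exact: ex_derive.
have : phi b - phi a = cabs w ^+ 2.
  rewrite /phi cabs_sqr -[LHS]/(complex.Re _ - complex.Re _) -raddfB/= -mulrBr -/w.
  by case: (w) => ? ? /=; ring.
rewrite hc => {}hc; rewrite -/w -(ler_pM2l (_ : 0 < cabs w)) ?cabs_gt0//.
rewrite -expr2 -hc mulrA; apply: ler_wpM2r; first by rewrite subr_ge0 ltW.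
apply: (le_trans (ler_norm _)); apply: (le_trans (ler_normRe _)).
by rewrite cabsM cabs_conj ler_wpM2l ?cabs_ge0// hM// !ltW.
Qed.

End ComplexDerivative.

(** * Integrals along segments *)

Section Goursat.
Variable R : realType.
Local Notation C := R[i].
Implicit Types (z w l p q m c : C) (x y t a b e : R).

Lemma continuous_antiderivative (f : R -> R) : continuous f ->
  exists F : R -> R, forall t, 0 <= t <= 1 -> is_derive t 1 F (f t).
Proof.
move=> cf.
(* With lower limit [-1] and integrability up to [2], every [t] in [[0, 1]] is interior, so the
   derivative is two-sided even at the endpoints. *)
exists (fun x => \int[lebesgue_measure]_(t in `[-1, x]) f t)%R => t /andP[t0 t1].
have [] := @continuous_FTC1 R f (BLeft (-1)) t 2 _ _ _ (cf t).
- by lra.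
- apply: continuous_compact_integrable; first exact: segment_compact.
  exact: continuous_subspaceT.
- by rewrite lte_fin; lra.
- by move=> dF <-; rewrite derive1E; exact: (derivableP dF).
Qed.

Lemma rdiff_antiderivative (u : R -> C) :
  (forall t e, 0 < e -> exists2 d, 0 < d &
    forall s, `|s - t| < d -> cabs (u s - u t) <= e) ->
  exists U : R -> C, forall t, 0 <= t <= 1 -> rdiff U t (u t).
Proof.
move=> cu.
have [F hF] : exists F : R -> R,
    forall t, 0 <= t <= 1 -> is_derive t 1 F (complex.Re (u t)).
  apply: continuous_antiderivative => t; apply/cvgrPdist_le => e e0.
  have [d d0 hd] := cu t e e0; apply/nbhs_ballP; exists d => // s /=.
  rewrite /ball/= distrC => /hd; apply: le_trans.
  by rewrite distrC (le_trans _ (ler_normRe _))// raddfB.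
have [G hG] : exists F : R -> R,
    forall t, 0 <= t <= 1 -> is_derive t 1 F (complex.Im (u t)).
  apply: continuous_antiderivative => t; apply/cvgrPdist_le => e e0.
  have [d d0 hd] := cu t e e0; apply/nbhs_ballP; exists d => // s /=.
  rewrite /ball/= distrC => /hd; apply: le_trans.
  by rewrite distrC (le_trans _ (ler_normIm _))// raddfB.
by exists (fun t => F t +i* G t) => t ht; apply: rdiff_ReIm => /=; [exact: hF|exact: hG].
Qed.

Definition segment_point p q t : C := p + t%:C * (q - p).

(** The integral along a segment is encoded by a primitive of the pulled-back integrand; its
    properties then follow from [rdiff_mvt] instead of from integration theory. *)
Definition segment_primitive (g : C -> C) p q (U : R -> C) : Prop :=
  forall t, 0 <= t <= 1 -> rdiff U t (g (segment_point p q t) * (q - p)).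

Lemma segment_primitive_unique g p q U V :
  segment_primitive g p q U -> segment_primitive g p q V -> U 1 - U 0 = V 1 - V 0.
Proof.
move=> hU hV; apply/eqP; rewrite -subr_eq0 -cabs_eq0 eq_le cabs_ge0 andbT.
have := @rdiff_mvt R (fun t => U t - V t) (fun=> 0) 0 1 0 ler01.
rewrite mul0r (_ : _ - _ - _ = U 1 - U 0 - (V 1 - V 0)); last by ring.
apply => t ht; last by rewrite cabs0.
by have := rdiffB (hU t ht) (hV t ht); rewrite subrr.
Qed.

Definition segment_int (g : C -> C) p q : C :=
  let U := xget (fun=> 0) (segment_primitive g p q) in U 1 - U 0.

Lemma segment_intE g p q U : segment_primitive g p q U ->
  segment_int g p q = U 1 - U 0.
Proof.
move=> hU; exact: (segment_primitive_unique (xgetPex (fun=> 0) (ex_intro _ U hU)) hU).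
Qed.

Lemma segment_point_sub p q a b t :
  segment_point (segment_point p q a) (segment_point p q b) t =
  segment_point p q (a + t * (b - a)).
Proof.
rewrite /segment_point !(rmorphD, rmorphM, rmorphB, rmorphN)/=; ring.
Qed.

Lemma segment_primitive_sub g p q U a b : 0 <= a <= 1 -> 0 <= b <= 1 ->
  segment_primitive g p q U ->
  segment_primitive g (segment_point p q a) (segment_point p q b)
    (fun t => U (a + t * (b - a))).
Proof.
move=> a01 b01 hU t t01; rewrite segment_point_sub.
rewrite (_ : _ * _ = g (segment_point p q (a + t * (b - a))) * (q - p) * (b - a)%:C).
  by apply: rdiff_aff; apply: hU; nra.
by rewrite /segment_point rmorphB/=; ring.
Qed.

Lemma segment_int_sub g p q U a b : 0 <= a <= 1 -> 0 <= b <= 1 ->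
  segment_primitive g p q U ->
  segment_int g (segment_point p q a) (segment_point p q b) = U b - U a.
Proof.
move=> a01 b01 hU; rewrite (segment_intE (segment_primitive_sub a01 b01 hU)).
by congr (U _ - U _); ring.
Qed.

Definition rhp_holomorphic (g : C -> C) : Prop :=
  forall z, 0 < complex.Re z -> exists l, cdiff g z l.

Lemma Re_segment_point p q t (mu : R) : 0 <= t <= 1 ->
  mu <= complex.Re p -> mu <= complex.Re q -> mu <= complex.Re (segment_point p q t).
Proof.
rewrite /segment_point; case: p q => [a b] [a' b'] /=; nra.
Qed.

Lemma Re_segment_point_gt0 p q t : 0 <= t <= 1 ->
  0 < complex.Re p -> 0 < complex.Re q -> 0 < complex.Re (segment_point p q t).
Proof.
move=> t01 hp hq; apply: (@lt_le_trans _ _ (Num.min (complex.Re p) (complex.Re q))).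
  by rewrite lt_min hp.
by apply: Re_segment_point => //; rewrite ge_min lexx ?orbT.
Qed.

Lemma cdiff_continuous g z l : cdiff g z l ->
  forall e, 0 < e -> exists2 d, 0 < d &
    forall w, cabs (w - z) < d -> cabs (g w - g z) <= e.
Proof.
move=> hg e e0; have [d d0 hd] := hg 1 ltr01.
have c1 : 0 < cabs l + 1 by rewrite ltr_wpDl ?cabs_ge0.
exists (Num.min d (e / (cabs l + 1))); first by rewrite lt_min d0 divr_gt0.
move=> w; rewrite lt_min => /andP[/hd h1 h2].
move: h1; rewrite mul1r [z + _]addrC subrK => h1.
move: h2; rewrite ltr_pdivlMr// => h2.
have -> : g w - g z = (g w - g z - l * (w - z)) + l * (w - z) by ring.
rewrite (le_trans (cabsD _ _))// cabsM; have := cabs_ge0 (w - z); nra.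
Qed.

Lemma segment_primitive_exists g p q : rhp_holomorphic g ->
  0 < complex.Re p -> 0 < complex.Re q -> exists U, segment_primitive g p q U.
Proof.
(* The antiderivative is available for integrands continuous on the whole line, so the parameter is
   clamped to [[0, 1]], which keeps the point in the half-plane. *)
move=> hg hp hq; pose cl t : R := if t < 0 then 0 else if 1 < t then 1 else t.
have cl01 t : 0 <= cl t <= 1.
  by rewrite /cl; case: (ltP t 0) => ?; [|case: (ltP 1 t) => ?]; lra.
have clid t : 0 <= t <= 1 -> cl t = t.
  by rewrite /cl; case: (ltP t 0) => ?; [|case: (ltP 1 t) => ?]; lra.
have cldist s t : `|cl s - cl t| <= `|s - t|.
  have h1 := ler_norm (s - t); have h2 := ler_norm (t - s).
  rewrite distrC in h2; rewrite ler_norml /cl.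
  case: (ltP t 0) => ?; [|case: (ltP 1 t) => ?];
  (case: (ltP s 0) => ?; [|case: (ltP 1 s) => ?]); lra.
have [|U hU] := @rdiff_antiderivative (fun t => g (segment_point p q (cl t)) * (q - p)).
  move=> t e e0; have c1 : 0 < cabs (q - p) + 1 by rewrite ltr_wpDl ?cabs_ge0.
  have [l hl] := hg _ (Re_segment_point_gt0 (cl01 t) hp hq).
  have [d d0 hd] := cdiff_continuous hl (divr_gt0 e0 c1).
  exists (d / (cabs (q - p) + 1)); first by rewrite divr_gt0.
  move=> s hs; rewrite -mulrBl cabsM.
  have : cabs (segment_point p q (cl s) - segment_point p q (cl t)) < d.
    rewrite (_ : _ - _ = (cl s - cl t)%:C * (q - p)); last first.
      by rewrite /segment_point rmorphB/=; ring.
    rewrite cabsM cabs_real; move: hs; rewrite ltr_pdivlMr//.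
    have := cldist s t; have := cabs_ge0 (q - p); have := normr_ge0 (s - t); nra.
  move=> /hd; rewrite ler_pdivlMr// => /(le_trans _); apply.
  by rewrite ler_wpM2l ?cabs_ge0// lerDl.
by exists U => t t01; have := hU t t01; rewrite clid.
Qed.

(** Along the segment, the difference between the primitive of [g] and [P] has derivative at most
    [M |q - p|]. It is used with [P'] the tangent of [g] in Goursat's theorem, and with [P']
    constant to differentiate the primitive. *)
Lemma segment_int_approx g (P P' : C -> C) p q (M : R) : rhp_holomorphic g ->
  0 < complex.Re p -> 0 < complex.Re q ->
  (forall t, 0 <= t <= 1 -> cdiff P (segment_point p q t) (P' (segment_point p q t))) ->
  (forall t, 0 <= t <= 1 ->
     cabs (g (segment_point p q t) - P' (segment_point p q t)) <= M) ->
  cabs (segment_int g p q - (P q - P p)) <= M * cabs (q - p).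
Proof.
move=> hg hp hq hP hM; have [U hU] := segment_primitive_exists hg hp hq.
have := @rdiff_mvt R (fun t => U t - P (segment_point p q t))
  (fun t => (g (segment_point p q t) - P' (segment_point p q t)) * (q - p))
  0 1 (M * cabs (q - p)) ler01.
rewrite subr0 mulr1 (segment_intE hU).
have -> : segment_point p q 0 = p by rewrite /segment_point mul0r addr0.
have -> : segment_point p q 1 = q by rewrite /segment_point mul1r addrC subrK.
rewrite (_ : _ - _ - _ = U 1 - U 0 - (P q - P p)); last by ring.
apply => t t01.
  rewrite mulrBl; apply: rdiffB; first exact: hU.
  by apply: rdiff_comp; exact: hP.
by rewrite cabsM ler_wpM2r ?cabs_ge0 ?hM.
Qed.

Lemma segment_intC g p q : rhp_holomorphic g ->
  0 < complex.Re p -> 0 < complex.Re q -> segment_int g q p = - segment_int g p q.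
Proof.
move=> hg hp hq; have [U hU] := segment_primitive_exists hg hp hq.
have e0 : segment_point p q 0 = p by rewrite /segment_point mul0r addr0.
have e1 : segment_point p q 1 = q by rewrite /segment_point mul1r addrC subrK.
have i0 : 0 <= (0 : R) <= 1 by lra.
have i1 : 0 <= (1 : R) <= 1 by lra.
have := segment_int_sub i1 i0 hU; have := segment_int_sub i0 i1 hU.
by rewrite e0 e1 => -> ->; rewrite opprB.
Qed.

Definition midpoint p q : C := (p + q) / 2.

Lemma segment_int_midpoint g p q : rhp_holomorphic g ->
  0 < complex.Re p -> 0 < complex.Re q ->
  segment_int g p (midpoint p q) + segment_int g (midpoint p q) q = segment_int g p q.
Proof.
move=> hg hp hq; have [U hU] := segment_primitive_exists hg hp hq.
have e0 : segment_point p q 0 = p by rewrite /segment_point mul0r addr0.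
have e1 : segment_point p q 1 = q by rewrite /segment_point mul1r addrC subrK.
have em : segment_point p q (1 / 2) = midpoint p q.
  rewrite /segment_point /midpoint rmorphM fmorphV rmorph1 (rmorph_nat (real_complex R) 2).
  by field.
have i0 : 0 <= (0 : R) <= 1 by lra.
have i1 : 0 <= (1 : R) <= 1 by lra.
have im : 0 <= (1 / 2 : R) <= 1 by lra.
have := segment_int_sub i0 im hU; have := segment_int_sub im i1 hU.
have := segment_int_sub i0 i1 hU.
by rewrite e0 e1 em => -> -> ->; ring.
Qed.

End Goursat.

(** * Goursat's theorem for triangles and global primitives *)

Section Primitive.
Variable R : realType.
Local Notation C := R[i].
Implicit Types (z w l p q m c : C) (x y t a b e : R).

(** The intervals of radius [2 L / 2^n] around [x n] are nested; the limit is the supremum of their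
    left ends. *)
Lemma geometric_limit (x : nat -> R) L : 0 <= L ->
  (forall n, `|x n.+1 - x n| <= L / 2 ^+ n) ->
  exists y, forall n, `|x n - y| <= 2 * L / 2 ^+ n.
Proof.
move=> L0 hx; pose lo n := x n - 2 * L / 2 ^+ n; pose hi n := x n + 2 * L / 2 ^+ n.
have half n : 2 * L / 2 ^+ n.+1 = L / 2 ^+ n :> R by rewrite exprS; field; exact/expf_neq0.
have dbl n : 2 * L / 2 ^+ n = 2 * (L / 2 ^+ n) :> R by rewrite mulrA.
have loS n : lo n <= lo n.+1.
  rewrite /lo half dbl; have := hx n; rewrite ler_norml => /andP[]; lra.
have hiS n : hi n.+1 <= hi n.
  rewrite /hi half dbl; have := hx n; rewrite ler_norml => /andP[]; lra.
have lohi n : lo n <= hi n.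
  rewrite /lo /hi dbl; have : 0 <= L / 2 ^+ n by rewrite divr_ge0 ?exprn_ge0.
  lra.
have lo_le n k : lo n <= lo (n + k)%N.
  by elim: k => [|k ih]; rewrite ?addn0// addnS (le_trans ih).
have hi_le n k : hi (n + k)%N <= hi n.
  by elim: k => [|k ih]; rewrite ?addn0// addnS (le_trans _ ih).
have hub n : ubound (range lo) (hi n).
  move=> _ [m _ <-]; rewrite (le_trans (lo_le m n))// (le_trans (lohi _))//.
  by rewrite addnC hi_le.
exists (sup (range lo)) => n.
have h1 : lo n <= sup (range lo).
  apply: ub_le_sup; last by exists n.
  by exists (hi 0%N).
have h2 : sup (range lo) <= hi n.
  by apply: ge_sup => //; exists (lo 0%N); exists 0%N.
by move: h1 h2; rewrite /lo /hi ler_distl; lra.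
Qed.

Lemma complex_geometric_limit (p : nat -> C) L : 0 <= L ->
  (forall n, cabs (p n.+1 - p n) <= L / 2 ^+ n) ->
  exists z, forall n, cabs (p n - z) <= 4 * L / 2 ^+ n.
Proof.
move=> L0 hp.
have [x hx] : exists x, forall n, `|complex.Re (p n) - x| <= 2 * L / 2 ^+ n.
  apply: geometric_limit => // n; apply: le_trans (hp n).
  by apply: le_trans (ler_normRe _); rewrite raddfB.
have [y hy] : exists y, forall n, `|complex.Im (p n) - y| <= 2 * L / 2 ^+ n.
  apply: geometric_limit => // n; apply: le_trans (hp n).
  by apply: le_trans (ler_normIm _); rewrite raddfB.
exists (x +i* y) => n; apply: (le_trans (cabs_le_ReIm _)).
move: (hx n) (hy n); case: (p n) => a b /=.
have -> : 4 * L / 2 ^+ n = 2 * L / 2 ^+ n + 2 * L / 2 ^+ n :> R.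
  by field; exact/expf_neq0.
exact: lerD.
Qed.

Lemma half_pow_small (x y : R) : 0 < y -> exists n, x / 2 ^+ n < y.
Proof.
move=> y0; exists (Num.truncn `|x / y|).+1; rewrite ltr_pdivrMr ?exprn_gt0//.
have : `|x / y| < (Num.truncn `|x / y|).+1%:R by exact: truncnS_gt.
set k := _.+1; have : k%:R <= 2 ^+ k :> R by rewrite -natrX ler_nat ltnW// ltn_expl.
move=> h1 h2; have h3 := lt_le_trans h2 h1.
by have := le_lt_trans (ler_norm _) h3; rewrite ltr_pdivrMr// mulrC.
Qed.

Definition triangle : Type := (C * C * C)%type.

Definition triangle_int (g : C -> C) (T : triangle) : C :=
  segment_int g T.1.1 T.1.2 + segment_int g T.1.2 T.2 + segment_int g T.2 T.1.1.

Definition perimeter (T : triangle) : R :=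
  cabs (T.1.2 - T.1.1) + cabs (T.2 - T.1.2) + cabs (T.1.1 - T.2).

(** The margin [mu > 0] is what keeps the limit point of the nested triangles inside the open
    half-plane. *)
Definition right_of (mu : R) (T : triangle) : Prop :=
  [/\ mu <= complex.Re T.1.1, mu <= complex.Re T.1.2 & mu <= complex.Re T.2].

Lemma Re_midpoint mu p q : mu <= complex.Re p -> mu <= complex.Re q ->
  mu <= complex.Re (midpoint p q).
Proof.
move=> hp hq; have -> : midpoint p q = segment_point p q (1 / 2).
  rewrite /segment_point /midpoint rmorphM fmorphV rmorph1 (rmorph_nat (real_complex R) 2).
  by field.
by apply: Re_segment_point => //; lra.
Qed.

Lemma cabs_half z : cabs (z / 2) = cabs z / 2.
Proof. by rewrite cabsM cabsV cabs_nat. Qed.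

(** The midpoints cut the triangle into four; the inner sides cancel in the sum of the integrals, so
    one part carries a quarter of the modulus. The control of the first vertex makes iterated
    triangles shrink to a point. *)
Lemma triangle_bisection g mu (T : triangle) : rhp_holomorphic g -> 0 < mu ->
  right_of mu T -> exists T' : triangle, [/\ right_of mu T',
    perimeter T' = perimeter T / 2, cabs (T'.1.1 - T.1.1) <= perimeter T
    & cabs (triangle_int g T) / 4 <= cabs (triangle_int g T')].
Proof.
case: T => [[p q] r] hg mu0 [/= hp hq hr].
have p0 := lt_le_trans mu0 hp; have q0 := lt_le_trans mu0 hq.
have r0 := lt_le_trans mu0 hr.
set a := midpoint p q; set b := midpoint q r; set c := midpoint r p.
have ha : mu <= complex.Re a by exact: Re_midpoint.
have hb : mu <= complex.Re b by exact: Re_midpoint.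
have hc : mu <= complex.Re c by exact: Re_midpoint.
have a0 := lt_le_trans mu0 ha; have b0 := lt_le_trans mu0 hb.
have c0 := lt_le_trans mu0 hc.
have eT : triangle_int g (p, q, r) = triangle_int g (p, a, c) +
    triangle_int g (a, q, b) + triangle_int g (c, b, r) + triangle_int g (b, c, a).
  rewrite /triangle_int /= -(segment_int_midpoint hg p0 q0).
  rewrite -(segment_int_midpoint hg q0 r0) -(segment_int_midpoint hg r0 p0).
  rewrite -/a -/b -/c (segment_intC hg c0 a0) (segment_intC hg a0 b0).
  rewrite (segment_intC hg b0 c0); ring.
have dpa : cabs (a - p) = cabs (q - p) / 2.
  by rewrite -cabs_half; congr cabs; rewrite /a /midpoint; field.
have daq : cabs (q - a) = cabs (q - p) / 2.
  by rewrite -cabs_half; congr cabs; rewrite /a /midpoint; field.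
have dqb : cabs (b - q) = cabs (r - q) / 2.
  by rewrite -cabs_half; congr cabs; rewrite /b /midpoint; field.
have dbr : cabs (r - b) = cabs (r - q) / 2.
  by rewrite -cabs_half; congr cabs; rewrite /b /midpoint; field.
have drc : cabs (c - r) = cabs (p - r) / 2.
  by rewrite -cabs_half; congr cabs; rewrite /c /midpoint; field.
have dcp : cabs (p - c) = cabs (p - r) / 2.
  by rewrite -cabs_half; congr cabs; rewrite /c /midpoint; field.
have dac : cabs (c - a) = cabs (r - q) / 2.
  by rewrite -cabs_half; congr cabs; rewrite /a /c /midpoint; field.
have dba : cabs (a - b) = cabs (p - r) / 2.
  by rewrite -cabs_half; congr cabs; rewrite /a /b /midpoint; field.
have dcb : cabs (b - c) = cabs (q - p) / 2.
  by rewrite -cabs_half; congr cabs; rewrite /b /c /midpoint; field.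
have g1 := cabs_ge0 (q - p); have g2 := cabs_ge0 (r - q); have g3 := cabs_ge0 (p - r).
have dpb : cabs (b - p) <= cabs (q - p) / 2 + cabs (p - r) / 2.
  by rewrite -dcb -dcp [in X in _ <= X + _](cabsBC b c) [in X in _ <= _ + X]cabsBC cabsBC;
     rewrite (_ : p - b = (c - b) - (c - p)) ?cabsB//; ring.
have tri : cabs (triangle_int g (p, q, r)) <= cabs (triangle_int g (p, a, c)) +
    cabs (triangle_int g (a, q, b)) + cabs (triangle_int g (c, b, r))
    + cabs (triangle_int g (b, c, a)).
  rewrite eT (le_trans (cabsD _ _))// lerD2r (le_trans (cabsD _ _))// lerD2r.
  exact: cabsD.
set N := cabs (triangle_int g (p, q, r)) in tri *.
have [h1|h1] := leP (N / 4) (cabs (triangle_int g (p, a, c))).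
  exists (p, a, c); split => //.
    by rewrite /perimeter /= dpa dac dcp; field.
  by rewrite subrr cabs0 /perimeter/=; lra.
have [h2|h2] := leP (N / 4) (cabs (triangle_int g (a, q, b))).
  exists (a, q, b); split => //.
    by rewrite /perimeter /= daq dqb dba; field.
  by rewrite /= dpa /perimeter/=; lra.
have [h3|h3] := leP (N / 4) (cabs (triangle_int g (c, b, r))).
  exists (c, b, r); split => //.
    by rewrite /perimeter /= dcb dbr drc; field.
  by rewrite /= cabsBC dcp /perimeter/=; lra.
exists (b, c, a); split => //.
- by rewrite /perimeter /= (cabsBC c b) dcb (cabsBC a c) dac (cabsBC b a) dba; field.
- by apply: (le_trans dpb); rewrite /perimeter/=; lra.
- by move: tri h1 h2 h3; rewrite /=; lra.
Qed.

Lemma segment_point_near p q t : 0 <= t <= 1 ->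
  cabs (segment_point p q t - p) <= cabs (q - p).
Proof.
move=> t01; rewrite /segment_point addrC addKr cabsM cabs_real.
by rewrite ler_piMl ?cabs_ge0// ler_norml; lra.
Qed.

Lemma cdiff_quadratic (A B z : C) w : cdiff (fun w => A * w + B * (w - z) ^+ 2) w
  (A + B * (w - z) *+ 2).
Proof.
move=> e e0; have c1 : 0 < cabs B + 1 by rewrite ltr_wpDl ?cabs_ge0.
exists (e / (cabs B + 1)); first by rewrite divr_gt0.
move=> h; rewrite ltr_pdivlMr// => hh.
rewrite (_ : _ - _ - _ = B * h * h); last by ring.
rewrite !cabsM ler_wpM2r ?cabs_ge0//; have := cabs_ge0 h; have := cabs_ge0 B; nra.
Qed.

Lemma goursat_triangle g mu (T : triangle) : rhp_holomorphic g -> 0 < mu ->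
  right_of mu T -> triangle_int g T = 0.
Proof.
move=> hg mu0 hT.
pose next T' := xget T' [set T'' : triangle | [/\ right_of mu T'',
    perimeter T'' = perimeter T' / 2, cabs (T''.1.1 - T'.1.1) <= perimeter T'
    & cabs (triangle_int g T') / 4 <= cabs (triangle_int g T'')]].
have nextP T' : right_of mu T' -> [/\ right_of mu (next T'),
    perimeter (next T') = perimeter T' / 2,
    cabs ((next T').1.1 - T'.1.1) <= perimeter T'
    & cabs (triangle_int g T') / 4 <= cabs (triangle_int g (next T'))].
  by move=> hT'; exact: (xgetPex T' (triangle_bisection hg mu0 hT')).
pose S n := iter n next T.
set L := perimeter T; set K := cabs (triangle_int g T).
have L0 : 0 <= L by rewrite !addr_ge0 ?cabs_ge0.
have hS n : [/\ right_of mu (S n), perimeter (S n) = L / 2 ^+ n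
    & K / 4 ^+ n <= cabs (triangle_int g (S n))].
  elim: n => [|n [h1 h2 h3]]; first by rewrite !expr0 !divr1.
  have [k1 k2 k3 k4] := nextP _ h1; split => //=.
    by rewrite k2 h2 exprSr; field; exact/expf_neq0.
  apply: le_trans k4; rewrite exprSr invfM mulrA ler_pdivrMr//.
  by rewrite -mulrA mulVf ?mulr1.
have [z hz] : exists z, forall n, cabs ((S n).1.1 - z) <= 4 * L / 2 ^+ n.
  apply: complex_geometric_limit => // n; have [h1 h2 h3] := hS n.
  by have [k1 k2 k3 k4] := nextP _ h1; rewrite -h2.
have z0 : 0 < complex.Re z.
  apply: (lt_le_trans mu0); rewrite leNgt; apply/negP => hlt.
  have [n hn] := @half_pow_small (4 * L) (mu - complex.Re z) ltac:(by rewrite subr_gt0).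
  have [[h1 _ _] _ _] := hS n.
  have := le_trans (ler_normRe _) (hz n); rewrite raddfB/= => h2.
  by have := ler_norm (complex.Re (S n).1.1 - complex.Re z); lra.
have [l hl] := hg z z0.
(* Both sides scale like [4^-n]. The integral over the [n]-th triangle is at least [K / 4^n].
   Replacing [g] by its tangent at [z], with primitive [g z * w + l / 2 * (w - z)^2], costs at most
   [e * 6 D] per unit length on the perimeter [D = L / 2^n]: the first vertex is within [4 D] of
   [z], the others within [5 D], all boundary points within [6 D]. *)
have key e : 0 < e -> K <= e * (6 * L * L).
  move=> e0; have [d d0 hd] := hl e e0.
  have [n hn] := @half_pow_small (6 * L) d d0.
  have [[hp hq hr] h2 h3] := hS n.
  move: (hz n) hp hq hr h2 h3; case: (S n) => [[p q] r] /= hpz hp hq hr h2 h3.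
  have p0 := lt_le_trans mu0 hp; have q0 := lt_le_trans mu0 hq.
  have r0 := lt_le_trans mu0 hr.
  have g1 := cabs_ge0 (q - p); have g2 := cabs_ge0 (r - q); have g3 := cabs_ge0 (p - r).
  have pow2 : 0 < 2 ^+ n :> R by rewrite exprn_gt0.
  set D := L / 2 ^+ n in h2.
  have e4 : 4 * L / 2 ^+ n = 4 * D by rewrite /D mulrA.
  have e6 : 6 * L / 2 ^+ n = 6 * D by rewrite /D mulrA.
  rewrite e4 in hpz; rewrite e6 in hn; rewrite /perimeter/= in h2.
  have D0 : 0 <= D by lra.
  have seg (a b : C) : 0 < complex.Re a -> 0 < complex.Re b ->
      cabs (a - z) <= 5 * D -> cabs (b - a) <= D ->
      cabs (segment_int g a b - (g z * b + (l / 2) * (b - z) ^+ 2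
            - (g z * a + (l / 2) * (a - z) ^+ 2))) <= e * (6 * D) * cabs (b - a).
    move=> a0 b0 haz hab; apply: (@segment_int_approx R g (fun w => g z * w + l / 2 * (w - z) ^+ 2)
      (fun w => g z + l / 2 * (w - z) *+ 2) _ _ _ hg a0 b0) => t t01.
      exact: cdiff_quadratic.
    set w := segment_point a b t.
    have hw : cabs (w - z) <= 6 * D.
      rewrite (_ : w - z = (w - a) + (a - z)); last by ring.
      have := segment_point_near a b t01; rewrite -/w => hwa.
      by apply: (le_trans (cabsD _ _)); lra.
    have := hd (w - z) (le_lt_trans hw hn); rewrite [z + _]addrC subrK.
    rewrite (_ : g w - g z - l * (w - z) = g w - (g z + l / 2 * (w - z) *+ 2)).
      by move=> h; apply: (le_trans h); rewrite ler_pM2l.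
    by rewrite mulr2n; field.
  have dz : cabs (q - z) <= 5 * D.
    by rewrite (_ : q - z = (q - p) + (p - z)) ?(le_trans (cabsD _ _))//; [lra|ring].
  have dr : cabs (r - z) <= 5 * D.
    rewrite (_ : r - z = (p - z) - (p - r)); last by ring.
    by apply: (le_trans (cabsB _ _)); lra.
  have s1 := seg p q p0 q0 ltac:(lra) ltac:(lra).
  have s2 := seg q r q0 r0 dz ltac:(lra).
  have s3 := seg r p r0 p0 dr ltac:(lra).
  have : cabs (triangle_int g (p, q, r)) <= e * (6 * D) * D.
    rewrite -[in X in _ <= _ * X]h2 !mulrDr.
    apply: le_trans (lerD (lerD s1 s2) s3).
    apply: le_trans (lerD (cabsD _ _) (lexx _)).
    apply: le_trans (cabsD _ _).
    by rewrite le_eqVlt; apply/orP; left; apply/eqP; congr cabs; rewrite /triangle_int/=; ring.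
  move/(le_trans h3); rewrite ler_pdivrMr ?exprn_gt0// /D.
  rewrite (_ : 4 ^+ n = 2 ^+ n * 2 ^+ n :> R); last by rewrite -exprMn -natrM.
  rewrite (_ : e * _ * _ * (_ * _) = e * (6 * L * L)) //.
  by field; rewrite gt_eqF.
apply/eqP; rewrite -cabs_eq0 -/K eq_le cabs_ge0 andbT.
apply/ler_addgt0Pr => e e0; rewrite add0r.
have LL : 0 < 6 * L * L + 1 by rewrite ltr_wpDl// !mulr_ge0.
apply: (le_trans (key _ (divr_gt0 e0 LL))).
by rewrite mulrAC ler_pdivrMr// ler_pM2l// lerDl.
Qed.

(** The half-plane is convex, so the triangle [1], [z], [z + h] has integral zero; the increment of
    the integral from [1] is therefore the integral over the short segment from [z] to [z + h]. *)
Theorem rhp_primitive g : rhp_holomorphic g ->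
  exists G, forall z, 0 < complex.Re z -> cdiff G z (g z).
Proof.
move=> hg; exists (segment_int g 1) => z z0 e e0.
have [l hl] := hg z z0; have [d d0 hd] := cdiff_continuous hl e0.
exists (Num.min d (complex.Re z)); first by rewrite lt_min d0.
move=> h; rewrite lt_min => /andP[hh1 hh2].
have zh0 : 0 < complex.Re (z + h).
  rewrite raddfD/=; have := le_lt_trans (ler_normRe h) hh2.
  by rewrite ltr_norml => /andP[]; lra.
have one0 : 0 < complex.Re (1 : C) by [].
pose mu := Num.min 1 (Num.min (complex.Re z) (complex.Re (z + h))).
have mu0 : 0 < mu by rewrite !lt_min ltr01 z0.
have := @goursat_triangle g mu (1, z, z + h) hg mu0.
rewrite /triangle_int/= [segment_int g (z + h) 1]segment_intC// => /(_ _)/eqP.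
rewrite subr_eq0 => /(_ _)/eqP <-; last first.
  by split; rewrite /mu/= !ge_min lexx ?orbT.
rewrite [_ + _ - segment_int g 1 z]addrC addKr.
have := @segment_int_approx R g (fun w => g z * w + 0 * (w - z) ^+ 2)
  (fun w => g z + 0 * (w - z) *+ 2) z (z + h) e hg z0 zh0.
rewrite (_ : g z * (z + h) + _ - (g z * z + _) = g z * h); last by ring.
rewrite [z + h - z]addrC addKr; apply => t t01; first exact: cdiff_quadratic.
rewrite mul0r mul0rn addr0; apply: hd.
apply: le_lt_trans (segment_point_near _ _ t01) _.
by rewrite addrC addKr.
Qed.

End Primitive.

(** * The coefficient bound *)

Section ComplexExponential.
Variable R : realType.
Local Notation C := R[i].
Implicit Types (z w l p q s : C) (x y t e : R).

Lemma cdiffB f g z l k : cdiff f z l -> cdiff g z k ->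
  cdiff (fun z => f z - g z) z (l - k).
Proof.
move=> hf hg e e0; have e20 : 0 < e / 2 by rewrite divr_gt0.
have [d d0 hd] := hf _ e20; have [d' d'0 hd'] := hg _ e20.
exists (Num.min d d'); first by rewrite lt_min d0.
move=> h; rewrite lt_min => /andP[/hd h1 /hd' h2].
rewrite (_ : _ - _ = (f (z + h) - f z - l * h) - (g (z + h) - g z - k * h)).
  by rewrite (le_trans (cabsB _ _))//; lra.
by ring.
Qed.

Lemma cdiff0 z : cdiff (fun=> 0) z 0.
Proof.
move=> e e0; exists 1 => // h _.
by rewrite mul0r !subr0 cabs0 mulr_ge0 ?cabs_ge0// ltW.
Qed.

Lemma cdiffD f g z l k : cdiff f z l -> cdiff g z k ->
  cdiff (fun z => f z + g z) z (l + k).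
Proof.
move=> hf hg; have := cdiffB hf (cdiffB (cdiff0 z) hg).
rewrite sub0r opprK (_ : (fun z => _) = fun z => f z + g z)//.
by apply/funext => w; rewrite sub0r opprK.
Qed.

Lemma cdiffZ c f z l : cdiff f z l -> cdiff (fun z => c * f z) z (c * l).
Proof.
move=> hf e e0; have c1 : 0 < cabs c + 1 by rewrite ltr_wpDl ?cabs_ge0.
have [d d0 hd] := hf _ (divr_gt0 e0 c1).
exists d => // h /hd; rewrite -mulrA -!mulrBr cabsM => hh.
apply: (le_trans (ler_wpM2l (cabs_ge0 c) hh)).
by rewrite mulrCA [cabs c * _]mulrC shrink_le ?cabs_ge0// ltW.
Qed.

Lemma cdiff_sum (I : Type) (r : seq I) (P : pred I) (F : I -> C -> C) (L : I -> C) z :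
  (forall i, cdiff (F i) z (L i)) ->
  cdiff (fun z => \sum_(i <- r | P i) F i z) z (\sum_(i <- r | P i) L i).
Proof.
move=> hF; elim: r => [|i r ih].
  rewrite big_nil (_ : (fun _ => _) = fun=> 0); first exact: cdiff0.
  by apply/funext => w; rewrite big_nil.
rewrite big_cons (_ : (fun z => _) =
    fun z => if P i then F i z + \sum_(j <- r | P j) F j z else \sum_(j <- r | P j) F j z).
  by case: ifP => // _; exact: cdiffD.
by apply/funext => w; rewrite big_cons.
Qed.

Lemma primitive_increment (G g : C -> C) p q (M : R) :
  0 < complex.Re p -> 0 < complex.Re q ->
  (forall z, 0 < complex.Re z -> cdiff G z (g z)) ->
  (forall t, 0 <= t <= 1 -> cabs (g (segment_point p q t)) <= M) ->
  cabs (G q - G p) <= M * cabs (q - p).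
Proof.
move=> hp hq hG hM.
have := @rdiff_mvt R (fun t => G (segment_point p q t))
  (fun t => g (segment_point p q t) * (q - p)) 0 1 (M * cabs (q - p)) ler01.
rewrite subr0 mulr1 (_ : segment_point p q 0 = p); last first.
  by rewrite /segment_point mul0r addr0.
rewrite (_ : segment_point p q 1 = q); last by rewrite /segment_point mul1r addrC subrK.
apply => t t01; last by rewrite cabsM ler_wpM2r ?cabs_ge0 ?hM.
by apply: rdiff_comp; apply: hG; exact: Re_segment_point_gt0.
Qed.

Definition cexp (w : C) : C :=
  (expR (complex.Re w) * cos (complex.Im w))
    +i* (expR (complex.Re w) * sin (complex.Im w)).

Lemma cexpD z w : cexp (z + w) = cexp z * cexp w.
Proof.
rewrite /cexp !raddfD/= expRD cosD sinD; apply/eqP; rewrite eq_complex /=.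
by apply/andP; split; apply/eqP; ring.
Qed.

Lemma cexp0 : cexp 0 = 1.
Proof. by rewrite /cexp /= expR0 cos0 sin0 mulr1 mulr0. Qed.

Lemma cabs_cexp w : cabs (cexp w) = expR (complex.Re w).
Proof.
apply/eqP; rewrite -(@eqrXn2 _ 2)// ?cabs_ge0 ?expR_ge0// cabs_sqr /cexp/=.
by rewrite !exprMn -mulrDr cos2Dsin2 mulr1.
Qed.

Lemma cexp_neq0 w : cexp w != 0.
Proof. by rewrite -cabs_gt0 cabs_cexp expR_gt0. Qed.

Lemma cexpN w : cexp (- w) = (cexp w)^-1.
Proof.
by apply: (mulfI (cexp_neq0 w)); rewrite -cexpD subrr cexp0 divff ?cexp_neq0.
Qed.

Lemma natpowE n s : natpow n s = cexp ((ln n%:R)%:C * s).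
Proof.
by case: s => x y; rewrite /natpow /cexp /= !mul0r subr0 addr0 ![_ * ln _]mulrC.
Qed.

Lemma rdiff_cexp w t : rdiff (fun t => cexp (t%:C * w)) t (cexp (t%:C * w) * w).
Proof.
case: w => a b; apply: rdiff_ReIm; rewrite /cexp /=.
- have -> : (fun x => expR (x * a - 0 * b) * cos (x * b + 0 * a)) =
    (fun x => expR (x * a) * cos (x * b)).
    by apply/funext => x; rewrite !mul0r subr0 addr0.
  apply: is_derive_eq.
  rewrite /GRing.scale/= !mul0r subr0 addr0; ring.
- have -> : (fun x => expR (x * a - 0 * b) * sin (x * b + 0 * a)) =
    (fun x => expR (x * a) * sin (x * b)).
    by apply/funext => x; rewrite !mul0r subr0 addr0.
  apply: is_derive_eq.
  rewrite /GRing.scale/= !mul0r subr0 addr0; ring.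
Qed.

Lemma cexp_lip w t : 0 <= t <= 1 -> cabs (cexp (t%:C * w) - 1) <= cabs w * expR (cabs w).
Proof.
move=> /andP[t0 t1].
have hx x : 0 <= x <= t -> expR (complex.Re (x%:C * w)) <= expR (cabs w).
  move=> hx; rewrite ler_expR (le_trans (ler_norm _))//.
  by rewrite (le_trans (ler_normRe _))// cabsM cabs_real ler_piMl ?cabs_ge0// ler_norml; lra.
have := @rdiff_mvt R _ _ 0 t (cabs w * expR (cabs w)) t0
  (fun x _ => @rdiff_cexp w x).
rewrite mul0r cexp0 subr0 => /(_ _)/le_trans; apply => [x /hx h|].
  by rewrite cabsM cabs_cexp mulrC ler_wpM2l ?cabs_ge0.
by rewrite ler_piMr// mulr_ge0 ?cabs_ge0 ?expR_ge0.
Qed.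

(** Mean value inequality for [cexp (t w) - t w], whose derivative [(cexp (t w) - 1) w] is
    controlled by [cexp_lip]. *)
Lemma cexp_taylor w : cabs (cexp w - 1 - w) <= cabs w ^+ 2 * expR (cabs w).
Proof.
have := @rdiff_mvt R (fun t => cexp (t%:C * w) - t%:C * w)
  (fun t => cexp (t%:C * w) * w - w) 0 1 (cabs w ^+ 2 * expR (cabs w)) ler01.
rewrite !mul0r !mul1r cexp0 !subr0 mulr1 -addrA -opprD [w + 1]addrC opprD addrA.
apply => t t01; last first.
  rewrite (_ : cexp _ * w - w = (cexp (t%:C * w) - 1) * w); last by ring.
  rewrite cabsM expr2 -mulrA mulrC ler_wpM2l ?cabs_ge0//.
  exact: cexp_lip.
apply: rdiffB; first exact: rdiff_cexp.
move=> e e0; exists 1 => // h _.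
rewrite (_ : _ - _ = 0) ?cabs0 ?mulr_ge0// ?ltW//.
by rewrite rmorphD/=; ring.
Qed.

Lemma cdiff_cexp l s : cdiff (fun s => cexp (l * s)) s (l * cexp (l * s)).
Proof.
move=> e e0; set k := cabs (cexp (l * s)) * cabs l ^+ 2 * expR (cabs l).
have k0 : 0 <= k by rewrite !mulr_ge0 ?cabs_ge0 ?expR_ge0.
have k1 : 0 < k + 1 by rewrite ltr_wpDl.
exists (Num.min 1 (e / (k + 1))); first by rewrite lt_min ltr01 divr_gt0.
move=> h; rewrite lt_min => /andP[h1 h2].
rewrite mulrDr cexpD.
rewrite (_ : _ - _ = cexp (l * s) * (cexp (l * h) - 1 - l * h)); last by ring.
rewrite cabsM.
have h3 : cabs (cexp (l * h) - 1 - l * h) <= cabs l ^+ 2 * expR (cabs l) * cabs h ^+ 2.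
  apply: (le_trans (cexp_taylor _)); rewrite cabsM exprMn mulrAC.
  rewrite ler_wpM2r ?sqr_ge0// ler_wpM2l ?sqr_ge0// ler_expR.
  by rewrite ler_piMr ?cabs_ge0// ltW.
apply: (le_trans (ler_wpM2l (cabs_ge0 _) h3)).
rewrite (_ : _ * (_ * _) = k * cabs h * cabs h); last by rewrite /k; ring.
rewrite ler_wpM2r ?cabs_ge0//.
have := shrink_le (ltW e0) k0 ler01; rewrite !mul1r mulr1; apply: le_trans.
by rewrite mulrC ler_wpM2r// ltW.
Qed.

(** Division by [T], then [T] to infinity; [c] collects all contributions to the integral over
    [[-T, T]] that stay bounded. *)
Lemma linear_bound x y (c : R) : (forall T, 0 < T -> T * x <= T * y + c) -> x <= y.
Proof.
move=> h; rewrite leNgt; apply/negP => yx.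
have d0 : 0 < x - y by rewrite subr_gt0.
have c1 : 0 < `|c| + 1 by rewrite ltr_wpDl.
have := h ((`|c| + 1) / (x - y)) (divr_gt0 c1 d0).
rewrite -lerBlDl -mulrBr divfK ?gt_eqF// => h1.
by have := ler_norm c; lra.
Qed.

(** Telescoping with [1 / (m + 1)^3 <= 1 / m - 1 / (m + 1)]. *)
Lemma sum_inv_cube (K N : nat) : (0 < K)%N ->
  \sum_(K.+1 <= i < N) (i%:R ^+ 3)^-1 <= K%:R^-1 :> R.
Proof.
move=> K0; have [NK|KN] := leqP N K.+1; first by rewrite big_geq// invr_ge0.
have tele m : (K <= m)%N -> \sum_(K.+1 <= i < m.+1) (i%:R ^+ 3)^-1 <= K%:R^-1 - m%:R^-1 :> R.
  elim: m => [|m ih]; first by rewrite leqn0 => /eqP k0; rewrite k0 in K0.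
  rewrite leq_eqVlt => /orP[/eqP <-|]; first by rewrite big_geq// subrr.
  rewrite ltnS => Km; rewrite big_nat_recr//= (le_trans (lerD (ih Km) (lexx _)))//.
  have mp : (0 < m)%N := leq_trans K0 Km.
  have m0 : 0 < m%:R :> R by rewrite ltr0n.
  have : (m.+1%:R ^+ 3)^-1 <= m%:R^-1 - m.+1%:R^-1 :> R.
    2: by move: (m.+1%:R ^- 3) (m%:R^-1) (m.+1%:R^-1) (K%:R^-1) => *; lra.
  have -> : m%:R^-1 - m.+1%:R^-1 = (m%:R * m.+1%:R)^-1 :> R.
    rewrite -natr1; field; apply/andP; split; first by rewrite gt_eqF.
    by rewrite gt_eqF// ltr_wpDl// ltW.
  rewrite lef_pV2 ?posrE ?mulr_gt0 ?exprn_gt0 ?ltr0n //.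
  rewrite -natr1 !exprS expr0 mulr1; nra.
case: N KN => // N; rewrite ltnS => KN.
by apply: (le_trans (tele N (ltnW KN))); rewrite gerBl.
Qed.

End ComplexExponential.

(** * Functions on the half-plane viewed on the plane *)

Section HalfPlaneFunctions.
Variable R : realType.
Local Notation C := R[i].
Local Notation H := (half_plane R).
Implicit Types (z w l p q : C) (s : H) (x y t e : R).

(** In [holomorphic] the default value outside the half-plane varies with the point of
    differentiation. One fixed default gives a single function, which agrees with all of those on
    the open half-plane and so has the same derivatives there. *)
Definition extend (f : H -> C) : C -> C := fun z => f (insubd (point : H) z).

Lemma Re_realM x z : complex.Re (x%:C * z) = x * complex.Re z.
Proof. by case: z => a b /=; rewrite mul0r subr0. Qed.

Lemma insubd_rhp s z : 0 < complex.Re z -> insubd s z = insubd (point : H) z.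
Proof. by move=> z0; apply: val_inj; rewrite !val_insubd z0. Qed.

Lemma extend_val f s : extend f (val s) = f s.
Proof. by rewrite /extend valKd. Qed.

Lemma gt0_complexE (e : C) : 0 < e -> e = (complex.Re e)%:C /\ 0 < complex.Re e.
Proof. by case: e => a b; rewrite ltcE /= => /andP[/eqP -> ->]. Qed.

Lemma derivable_cdiff (F : C -> C) z : derivable F z 1 <-> exists l, cdiff F z l.
Proof.
split=> [dF|[l hl]].
  exists ('D_1 F z) => e e0.
  have ec0 : 0 < e%:C :> C by rewrite ltcR.
  have /cvgrPdist_le /(_ _ ec0) := dF; rewrite near_withinE.
  move=> /nbhs_ballP[d0 /gt0_complexE [d0E d0'] hd].
  rewrite d0E in hd.
  exists (complex.Re d0) => // h hh; have [->|h0] := eqVneq h 0.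
    by rewrite addr0 mulr0 subrr subr0 !cabs0 mulr0.
  have := hd h; rewrite /ball/= sub0r normrN normcE ltcR => /(_ hh h0).
  rewrite /GRing.scale/= mulr1 [h + z]addrC normcE lecR => hle.
  rewrite (_ : _ - _ = - (h * ('D_1 F z - h^-1 * (F (z + h) - F z)))); last by field.
  by rewrite cabsN cabsM mulrC ler_wpM2r ?cabs_ge0.
apply/cvg_ex; exists l; apply/cvgrPdist_le => e' /gt0_complexE[-> e0].
have [d d0 hd] := hl _ e0; rewrite near_withinE; apply/nbhs_ballP.
exists d%:C => //=; first by rewrite ltcR.
move=> h; rewrite /ball/= sub0r normrN normcE ltcR => /hd hle h0.
rewrite /GRing.scale/= mulr1 [h + z]addrC normcE lecR.
rewrite (_ : _ - _ = - (h^-1 * (F (z + h) - F z - l * h))); last by field.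
by rewrite cabsN cabsM cabsV ler_pdivrMl ?cabs_gt0// [cabs h * _]mulrC.
Qed.

Lemma cdiff_local F G z l (d : R) : 0 < d ->
  (forall h, cabs h < d -> F (z + h) = G (z + h)) -> cdiff F z l -> cdiff G z l.
Proof.
move=> d0 hFG hF e e0; have [d' d'0 hd] := hF e e0.
exists (Num.min d d'); first by rewrite lt_min d0.
move=> h; rewrite lt_min => /andP[h1 /hd]; rewrite -hFG//.
by have := hFG 0; rewrite addr0 cabs0 => <-.
Qed.

Lemma rhp_near z h : 0 < complex.Re z -> cabs h < complex.Re z -> 0 < complex.Re (z + h).
Proof.
move=> z0 hh; rewrite raddfD/=; have := le_lt_trans (ler_normRe h) hh.
by rewrite ltr_norml => /andP[]; lra.
Qed.

Lemma holomorphic_extend f : holomorphic f <-> rhp_holomorphic (extend f).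
Proof.
split=> [hf z z0|hf s].
  have := hf (insubd (point : H) z); rewrite insubdK// => /derivable_cdiff[l hl].
  exists l; apply: (cdiff_local z0 _ hl) => h hh.
  by rewrite insubd_rhp// rhp_near.
apply/derivable_cdiff; have s0 : 0 < complex.Re (val s) := valP s.
have [l hl] := hf _ s0; exists l.
apply: (cdiff_local s0 _ hl) => h hh.
by rewrite [in RHS]insubd_rhp ?rhp_near.
Qed.

Lemma rhp_holomorphicM f g : rhp_holomorphic f -> rhp_holomorphic g ->
  rhp_holomorphic (fun z => f z * g z).
Proof.
move=> hf hg z z0; apply/derivable_cdiff; apply: derivableM; apply/derivable_cdiff.
  exact: hf.
exact: hg.
Qed.

End HalfPlaneFunctions.

Section CoefficientBound.
Variable R : realType.
Local Notation C := R[i].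
Local Notation H := (half_plane R).
Implicit Types (z w l p q : C) (s : H) (x y t e : R).

Definition represents (a : nat -> C) (sigma0 : R) (f : H -> C) : Prop :=
  forall s : H, sigma0 < complex.Re (val s) ->
    (fun N => \sum_(1 <= n < N) a n / natpow n (val s)) @ \oo --> f s.

Lemma cvgn_cabsP (u : nat -> C) l : u @ \oo --> l <->
  forall e : R, 0 < e -> exists N0, forall N, (N0 <= N)%N -> cabs (l - u N) < e.
Proof.
split=> [/cvgrPdist_lt hu e e0|hu].
  have ec0 : 0 < e%:C :> C by rewrite ltcR.
  have [N0 _ hN] := hu _ ec0; exists N0 => N /hN /=.
  by rewrite normcE ltcR.
apply/cvgrPdist_lt => e' /gt0_complexE[-> e0]; have [N0 hN] := hu _ e0.
by exists N0 => // N /hN; rewrite normcE ltcR.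
Qed.

Lemma cvgn_cabs_le (u : nat -> C) l w (M : R) N0 : u @ \oo --> l ->
  (forall N, (N0 <= N)%N -> cabs (u N - w) <= M) -> cabs (l - w) <= M.
Proof.
move=> /cvgn_cabsP hu hM; apply/ler_addgt0Pr => e /hu[N1 hN].
have := hN (maxn N0 N1) (leq_maxr _ _); have := hM (maxn N0 N1) (leq_maxl _ _).
move=> h1 h2; rewrite (_ : l - w = (l - u (maxn N0 N1)) + (u (maxn N0 N1) - w)).
  by apply: (le_trans (cabsD _ _)); lra.
by ring.
Qed.

(* Beyond its abscissa of convergence plus 3, a Dirichlet series converges
   absolutely, uniformly on vertical lines. *)
Lemma represents_tail a sigma0 f : represents a sigma0 f ->
  exists sigma A : R, [/\ 0 < sigma, 0 <= A &
   forall s (K : nat), sigma <= complex.Re (val s) -> (0 < K)%N ->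
    cabs (f s - \sum_(1 <= n < K.+1) a n / natpow n (val s)) <= A / K%:R
    /\ (forall n, (0 < n)%N -> cabs (a n / natpow n (val s)) <= A / n%:R ^+ 3)].
Proof.
move=> ha; pose t := Num.max 0 sigma0 + 1.
have [t0 st] : 0 < t /\ sigma0 < t.
  have : Num.max 0 sigma0 < t by rewrite /t ltrDl.
  by rewrite gt_max => /andP[].
pose ht : H := exist (fun s : C => 0 < complex.Re s) t%:C t0.
have [A A0 hA] := convergent_series_bounded (ha ht st).
exists (t + 3), A; split => //; first by rewrite addr_gt0.
move=> s K hs K0.
have hdec n : (0 < n)%N -> cabs (a n / natpow n (val s)) <= A / n%:R ^+ 3.
  by move=> n0; rewrite -lecR -normcE; exact: (dirichlet_decay hs hA n0).
split => //.
have hs0 : sigma0 < complex.Re (val s) by apply: lt_le_trans hs; lra.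
apply: (@cvgn_cabs_le _ _ _ _ K.+1 (ha s hs0)) => N KN.
rewrite (@big_cat_nat _ _ _ K.+1)//= [X in cabs X]addrC addKr.
rewrite (le_trans (cabs_sum _ _ _))//.
apply: (@le_trans _ _ (\sum_(K.+1 <= i < N) A * (i%:R ^+ 3)^-1)).
  rewrite big_nat_cond [X in _ <= X]big_nat_cond; apply: ler_sum => i /andP[/andP[i0 _] _].
  by apply: hdec; exact: leq_trans i0.
by rewrite -mulr_sumr ler_wpM2l// sum_inv_cube.
Qed.

Lemma ln_nat_inj (m n : nat) : (0 < m)%N -> (0 < n)%N ->
  ln m%:R = ln n%:R :> R -> m = n.
Proof.
move=> m0 n0 /ln_inj; rewrite !posrE !ltr0n => /(_ m0 n0)/eqP.
by rewrite eqr_nat => /eqP.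
Qed.

Lemma cdiff_id z : cdiff id z 1.
Proof.
move=> e e0; exists 1 => // h _.
by rewrite mul1r [z + h]addrC addrK subrr cabs0 mulr_ge0 ?cabs_ge0 ?ltW.
Qed.

Definition bounded_fun (u : R -> C) : Prop := exists c : R, forall T, cabs (u T) <= c.

Lemma bounded_funZ c u : bounded_fun u -> bounded_fun (fun T => c * u T).
Proof. by case=> b hb; exists (cabs c * b) => T; rewrite cabsM ler_wpM2l ?cabs_ge0. Qed.

Lemma bounded_fun_sum (r : seq nat) (u : nat -> R -> C) :
  (forall i, bounded_fun (u i)) -> bounded_fun (fun T => \sum_(i <- r) u i T).
Proof.
move=> hu; elim: r => [|i r [c hc]].
  by exists 0 => T; rewrite big_nil cabs0.
have [b hb] := hu i; exists (b + c) => T.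
by rewrite big_cons (le_trans (cabsD _ _))// lerD.
Qed.

(* [a n] is the limit of the mean of [f s * n^s] over the segments from [sigma - iT] to
   [sigma + iT]; a primitive of this function moves the mean to the abscissa [eps]. *)
Theorem coefficient_bound (f : H -> C) a sigma0 B n : holomorphic f ->
  (forall s, cabs (f s) <= B) -> represents a sigma0 f -> (0 < n)%N ->
  cabs (a n) <= B.
Proof.
move=> /holomorphic_extend hf hB ha n0.
have B0 : 0 <= B by exact: le_trans (cabs_ge0 _) (hB (point : H)).
pose L : R := ln n%:R.
have L0 : 0 <= L by rewrite ln_ge0// ler1n.
pose g z := extend f z * cexp (L%:C * z).
have hg : rhp_holomorphic g.
  by apply: rhp_holomorphicM => // z z0; exists (L%:C * cexp (L%:C * z)); exact: cdiff_cexp.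
have [G hG] := rhp_primitive hg.
have gB z (m : R) : complex.Re z <= m -> cabs (g z) <= B * expR (L * m).
  move=> zm; rewrite /g cabsM cabs_cexp; apply: ler_pM; rewrite ?cabs_ge0 ?expR_ge0//.
    exact: hB.
  rewrite ler_expR; case: z zm => x y /= xm; rewrite mul0r subr0.
  by rewrite ler_wpM2l.
have [sigma [A [sigma0' A0 htail]]] := represents_tail ha.
pose mu (i : nat) : R := L - ln i%:R.
(* A primitive of [(n / i)^z]. Along a vertical line it grows linearly for [i = n] and stays bounded
   for every other [i], so only [a n] survives division by [T]. *)
pose q (i : nat) z : C := if i == n then z else cexp ((mu i)%:C * z) / (mu i)%:C.
pose q' (i : nat) z : C := if i == n then 1 else cexp ((mu i)%:C * z).
have hq i z : (0 < i)%N -> cdiff (q i) z (q' i z).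
  move=> i0; rewrite /q /q'; case: eqP => [_|/eqP ni]; first exact: cdiff_id.
  have m0 : (mu i)%:C != 0 :> C.
    rewrite (inj_eq (@complexI R) _ 0) subr_eq0; apply/eqP => /(ln_nat_inj n0 i0) e.
    by rewrite e eqxx in ni.
  have := @cdiffZ R (mu i)%:C^-1 _ _ _ (cdiff_cexp (mu i)%:C z).
  rewrite mulrA mulVf// mul1r; rewrite (_ : (fun z => _) =
    (fun z => cexp ((mu i)%:C * z) / (mu i)%:C))//.
  by apply/funext => w; rewrite mulrC.
have q'E i z : (0 < i)%N -> q' i z = cexp (L%:C * z) / natpow i z.
  move=> i0; rewrite natpowE -cexpN -cexpD -mulrBl -rmorphB/= /q'.
  by case: eqP => // ->; rewrite subrr mul0r cexp0.
pose P K z := \sum_(1 <= i < K.+1) a i * q i z.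
pose P' K z := \sum_(1 <= i < K.+1) a i * q' i z.
have hP (K : nat) (z : C) : cdiff (P K) z (P' K z).
  rewrite /P /P'; rewrite (_ : (fun z => _) =
    fun z => \sum_(1 <= i < K.+1) (a i * (if (0 < i)%N then q i z else 0))).
    rewrite [X in cdiff _ _ X](_ : _ = \sum_(1 <= i < K.+1)
      (a i * (if (0 < i)%N then q' i z else 0))).
      apply: cdiff_sum => i; apply: cdiffZ; case: ltnP => // i0; last exact: cdiff0.
      exact: hq.
    by rewrite big_nat_cond [RHS]big_nat_cond; apply: eq_bigr => i /andP[/andP[-> _] _].
  apply/funext => w.
  by rewrite big_nat_cond [RHS]big_nat_cond; apply: eq_bigr => i /andP[/andP[-> _] _].
pose bd (x T : R) : C := x +i* T.
have qbd i : bounded_fun (fun T => q i (bd sigma T) - q i (bd sigma (- T))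
    - (if i == n then 2 * 'i * T%:C else 0)).
  rewrite /q; case: eqP => [_|_].
    exists 0 => T; rewrite le_eqVlt; apply/orP; left.
    rewrite cabs_eq0 /bd; apply/eqP.
    by simpc; apply/eqP; rewrite eq_complex /=; apply/andP; split; apply/eqP; ring.
  exists (2 * (expR (mu i * sigma) * cabs (mu i)%:C^-1)) => T.
  rewrite subr0; apply: (le_trans (cabsB _ _)); rewrite !cabsM !cabs_cexp /= !mul0r !subr0.
  lra.
have Pbd (K : nat) : (n <= K)%N -> bounded_fun (fun T =>
    P K (bd sigma T) - P K (bd sigma (- T)) - a n * (2 * 'i * T%:C)).
  move=> nK; rewrite (_ : (fun T => _) = fun T => \sum_(1 <= i < K.+1)
    a i * (q i (bd sigma T) - q i (bd sigma (- T))
      - (if i == n then 2 * 'i * T%:C else 0))).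
    by apply: bounded_fun_sum => i; exact: bounded_funZ.
  apply/funext => T; under eq_bigr do rewrite !mulrBr.
  rewrite !sumrB; congr (_ - _).
  rewrite (bigD1_seq n)/= ?mem_index_iota ?iota_uniq ?n0 ?ltnS// eqxx.
  by rewrite big1 ?addr0// => i /negPf->; rewrite mulr0.
have bdRe (x y : R) : complex.Re (bd x y) = x by [].
have seg_bd (x T t : R) : complex.Re (segment_point (bd x (- T)) (bd x T) t) = x.
  by rewrite /segment_point/=; ring.
(* The left edge at [eps] stays inside the open half-plane, [e] pays for the tail of the series on
   the right edge, and the two horizontal edges contribute an amount independent of [T]. *)
have main (eps e : R) : 0 < eps -> eps <= sigma -> 0 < e ->
    cabs (a n) <= B * expR (L * eps) + e.
  move=> eps0 epss e0.
  have [K [K0 nK hK]] : exists K : nat,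
      [/\ (0 < K)%N, (n <= K)%N & A / K%:R * expR (L * sigma) <= e].
    pose k := (Num.truncn (A * expR (L * sigma) / e)).+1.
    exists (maxn n k); split; rewrite ?leq_maxl ?leq_max ?n0//.
    have kp : 0 < (maxn n k)%:R :> R by rewrite ltr0n leq_max n0.
    rewrite mulrAC ler_pdivrMr// [e * _]mulrC -ler_pdivrMr//.
    have : A * expR (L * sigma) / e < k%:R by exact: truncnS_gt.
    by move/ltW/le_trans; apply; rewrite ler_nat leq_maxr.
  have [c hc] := Pbd K nK.
  apply: (@linear_bound _ _ _ (c + 2 * (B * expR (L * sigma) * (sigma - eps)))) => T T0.
  have s1 : cabs (G (bd eps T) - G (bd eps (- T))) <= B * expR (L * eps) * (2 * T).
    apply: (le_trans (@primitive_increment _ G g (bd eps (- T)) (bd eps T)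
      (B * expR (L * eps)) eps0 eps0 hG _)).
      by move=> t _; apply: gB; rewrite seg_bd.
    rewrite (_ : bd eps T - _ = (2 * T)%:C * 'i); last first.
      by apply/eqP; rewrite eq_complex /=; apply/andP; split; apply/eqP; ring.
    rewrite cabsM cabs_real [cabs 'i]/cabs normCi mulr1 ger0_norm ?mulr_ge0// ?ltW//.
  have s2 T' : cabs (G (bd sigma T') - G (bd eps T')) <=
      B * expR (L * sigma) * (sigma - eps).
    apply: (le_trans (@primitive_increment _ G g (bd eps T') (bd sigma T')
      (B * expR (L * sigma)) eps0 sigma0' hG _)).
      by move=> t /andP[t0 t1]; apply: gB; rewrite /segment_point /=; nra.
    rewrite (_ : bd sigma T' - _ = (sigma - eps)%:C); last first.
      by apply/eqP; rewrite eq_complex /=; apply/andP; split; apply/eqP; ring.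
    by rewrite cabs_real ger0_norm ?subr_ge0.
  have s3 : cabs (G (bd sigma T) - P K (bd sigma T) - (G (bd sigma (- T)) - P K (bd sigma (- T))))
      <= e * (2 * T).
    have h3 := @primitive_increment _ (fun z => G z - P K z) (fun z => g z - P' K z)
      (bd sigma (- T)) (bd sigma T) e sigma0' sigma0'
      (fun z (hz : 0 < complex.Re z) => cdiffB (hG z hz) (hP K z)).
    apply: (le_trans (h3 _)).
    - move=> t _; move: (seg_bd sigma T t); move: (segment_point _ _ _) => z zs.
      have z0 : 0 < complex.Re z by rewrite zs.
      pose s : H := exist (fun s : C => 0 < complex.Re s) z z0.
      have hs : sigma <= complex.Re (val s) by rewrite /= zs.
      have [h1 _] := htail s K hs K0.
      have -> : g z - P' K z = cexp (L%:C * z) *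
          (f s - \sum_(1 <= i < K.+1) a i / natpow i (val s)).
        rewrite mulrBr /g mulrC -(extend_val f s); congr (_ - _).
        rewrite mulr_sumr /P' big_nat_cond [RHS]big_nat_cond.
        by apply: eq_bigr => i /andP[/andP[i0 _] _]; rewrite q'E//= mulrCA.
      rewrite cabsM cabs_cexp mulrC Re_realM zs.
      by apply: le_trans hK; rewrite ler_wpM2r// expR_ge0.
    rewrite (_ : bd sigma T - _ = (2 * T)%:C * 'i); last first.
      by apply/eqP; rewrite eq_complex /=; apply/andP; split; apply/eqP; ring.
    by rewrite cabsM cabs_real [cabs 'i]/cabs normCi mulr1 ger0_norm ?mulr_ge0// ?ltW.
  have : cabs (a n * (2 * 'i * T%:C)) = 2 * (T * cabs (a n)).
    rewrite !cabsM cabs_real [cabs 'i]/cabs normCi mulr1 cabs_nat ger0_norm ?ltW//.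
    by ring.
  move: (hc T) s1 (s2 T) (s2 (- T)) s3.
  set u := P K (bd sigma T) - _ - _; set v1 := G (bd eps T) - _.
  set v2 := G (bd sigma T) - _; set v3 := G (bd sigma (- T)) - G (bd eps (- T)).
  set v4 := _ - (G (bd sigma (- T)) - _).
  have -> : a n * (2 * 'i * T%:C) = v1 + v2 - v3 - v4 - u.
    by rewrite /u /v1 /v2 /v3 /v4; ring.
  have := cabsB (v1 + v2 - v3 - v4) u; have := cabsB (v1 + v2 - v3) v4.
  have := cabsB (v1 + v2) v3; have := cabsD v1 v2.
  have := cabs_ge0 u; have := cabs_ge0 v2.
  move=> *; lra.
have lim (eps : R) : 0 < eps -> eps <= sigma -> cabs (a n) <= B * expR (L * eps).
  by move=> eps0 epss; apply/ler_addgt0Pr => e; exact: main.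
apply/ler_addgt0Pr => e e0.
(* The factor [n^eps] remains to be removed: since [expR (L eps) - 1 <= L eps expR (L sigma)], this
   choice makes the excess over [B] at most [e]. *)
pose eps := Num.min sigma (e / (B * L * expR (L * sigma) + 1)).
have BL : 0 <= B * L * expR (L * sigma) by rewrite !mulr_ge0 ?expR_ge0.
have BL1 : 0 < B * L * expR (L * sigma) + 1 by rewrite ltr_wpDl.
have eps0 : 0 < eps by rewrite lt_min sigma0' divr_gt0.
have epss : eps <= sigma by rewrite ge_min lexx.
have epse : eps * (B * L * expR (L * sigma) + 1) <= e.
  by rewrite -ler_pdivlMr// ge_min lexx orbT.
apply: (le_trans (lim _ eps0 epss)).
have h1 : expR (L * eps) - 1 <= L * eps * expR (L * sigma).
  have := expR_ge1Dx (- (L * eps)); rewrite expRN => h.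
  have E0 : 0 < expR (L * eps) by exact: expR_gt0.
  have h2 : 1 - L * eps <= (expR (L * eps))^-1 by [].
  have h3 : expR (L * eps) <= expR (L * sigma) by rewrite ler_expR ler_wpM2l.
  have h4 : (1 - L * eps) * expR (L * eps) <= 1 by rewrite -ler_pdivlMr// mul1r.
  have : 0 <= L * eps by rewrite mulr_ge0// ltW.
  nra.
have h2 := ler_wpM2l B0 h1; move: (expR (L * eps)) h2 => E h2.
nra.
Qed.

End CoefficientBound.

(** * Evaluation at characters *)

Section Summation.
Variable R : realType.
Local Notation C := R[i].
Implicit Types (u v a b : nat -> C) (l m : C) (x y e B D : R).

(** The bound is an explicit argument because for formal series it becomes a function of the
    character, which is multiplied and summed along with the series. *)
Definition summable u B : Prop := forall N, \sum_(1 <= n < N) cabs (u n) <= B.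

Definition has_sum u l : Prop := (fun N => \sum_(1 <= n < N) u n) @ \oo --> l.

Lemma summable_ge0 u B : summable u B -> 0 <= B.
Proof. by move=> /(_ 0%N); rewrite big_geq. Qed.

Lemma eq_has_sum u v l : (forall n, (0 < n)%N -> u n = v n) -> has_sum u l -> has_sum v l.
Proof.
move=> uv; rewrite /has_sum (_ : (fun N => _) = fun N => \sum_(1 <= n < N) v n)//.
apply/funext => N; rewrite big_nat_cond [RHS]big_nat_cond.
by apply: eq_bigr => i /andP[/andP[i0 _] _]; exact: uv.
Qed.

Lemma eq_summable u v B : (forall n, (0 < n)%N -> u n = v n) -> summable u B -> summable v B.
Proof.
move=> uv hu N; apply: le_trans (hu N); rewrite big_nat_cond [leRHS]big_nat_cond.
by rewrite ler_sum// => i /andP[/andP[i0 _] _]; rewrite uv.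
Qed.

Lemma ler_summable u v B : (forall n, (0 < n)%N -> cabs (u n) <= cabs (v n)) ->
  summable v B -> summable u B.
Proof.
move=> uv hu N; apply: le_trans (hu N); rewrite big_nat_cond [leRHS]big_nat_cond.
by rewrite ler_sum// => i /andP[/andP[i0 _] _]; exact: uv.
Qed.

Lemma has_sum_unique u l m : has_sum u l -> has_sum u m -> l = m.
Proof. by move=> hl hm; apply: (cvg_unique _ hl hm); exact: norm_hausdorff. Qed.

Lemma summable_tail u B : summable u B -> forall e, 0 < e ->
  exists N0, forall M N, (N0 <= M)%N -> \sum_(M <= n < N) cabs (u n) <= e.
Proof.
move=> hu e e0; pose S N := \sum_(1 <= n < N) cabs (u n).
have Smono M N : (M <= N)%N -> S M <= S N.
  move=> MN; rewrite /S; have [M1|M1] := leqP M 1.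
    by rewrite big_geq// sumr_ge0// => *; exact: cabs_ge0.
  rewrite (@big_cat_nat _ _ _ M 1 N)//=; last exact: ltnW.
  by rewrite lerDl sumr_ge0// => *; exact: cabs_ge0.
have hs : has_sup (range S).
  by split; [exists (S 0%N); exists 0%N|exists B => _ [N _ <-]; exact: hu].
have [_ [N0 _ <-] hN0] := sup_adherent e0 hs.
exists (maxn 1 N0) => M N; rewrite geq_max => /andP[M1 NM].
have [NM'|MN] := leqP N M; first by rewrite big_geq// ltW.
have h1 : S N <= sup (range S).
  by apply: ub_le_sup; [exact: (proj2 hs)|exists N].
have h2 := Smono _ _ NM.
have : S N = S M + \sum_(M <= n < N) cabs (u n).
  by rewrite /S (@big_cat_nat _ _ _ M 1 N)//= ltnW.
lra.
Qed.

Lemma partial_sumB u M N : (0 < M <= N)%N ->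
  \sum_(1 <= n < N) u n - \sum_(1 <= n < M) u n = \sum_(M <= n < N) u n.
Proof.
move=> /andP[M0 MN]; rewrite (@big_cat_nat _ _ _ M 1 N)//=.
by rewrite addrAC subrr add0r.
Qed.

Lemma real_cauchy_cvg (x : nat -> R) :
  (forall e, 0 < e -> exists N0, forall M N, (N0 <= M <= N)%N -> `|x N - x M| <= e) ->
  exists y, forall e, 0 < e -> exists N0, forall N, (N0 <= N)%N -> `|y - x N| <= e.
Proof.
move=> hx; have : cvg (x @ \oo).
  apply/cauchy_cvgP/cauchy_exP => e e0.
  have e20 : 0 < e / 2 by rewrite divr_gt0.
  have [N0 hN] := hx _ e20; exists (x N0); exists N0 => // N /= NN.
  rewrite /ball/= distrC; apply: (@le_lt_trans _ _ (e / 2)).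
    by apply: hN; rewrite leqnn.
  by rewrite ltr_pdivrMr// ltr_pMr// ltr1n.
move=> /cvg_ex[y /cvgrPdist_le hy]; exists y => e /hy[N0 _ hN].
by exists N0.
Qed.

Lemma summable_has_sum u B : summable u B -> exists l, has_sum u l.
Proof.
move=> hu; pose S N := \sum_(1 <= n < N) u n.
have hS e : 0 < e -> exists N0, forall M N, (N0 <= M <= N)%N -> cabs (S N - S M) <= e.
  move=> /(summable_tail hu)[N0 hN]; exists (maxn 1 N0) => M N.
  rewrite geq_max => /andP[/andP[M1 M0] MN]; rewrite partial_sumB ?M1//.
  by rewrite (le_trans (cabs_sum _ _ _))// hN.
have [y hy] : exists y, forall e, 0 < e ->
    exists N0, forall N, (N0 <= N)%N -> `|y - complex.Re (S N)| <= e.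
  apply: real_cauchy_cvg => e /hS[N0 hN]; exists N0 => M N /hN; apply: le_trans.
  by rewrite -raddfB ler_normRe.
have [z hz] : exists y, forall e, 0 < e ->
    exists N0, forall N, (N0 <= N)%N -> `|y - complex.Im (S N)| <= e.
  apply: real_cauchy_cvg => e /hS[N0 hN]; exists N0 => M N /hN; apply: le_trans.
  by rewrite -raddfB ler_normIm.
exists (y +i* z); apply/cvgn_cabsP => e e0; have e3 : 0 < e / 3 by rewrite divr_gt0.
have [N1 h1] := hy _ e3; have [N2 h2] := hz _ e3; exists (maxn N1 N2) => N.
rewrite geq_max => /andP[/h1 k1 /h2 k2].
apply: (le_lt_trans (cabs_le_ReIm _)); rewrite !raddfB/=.
rewrite /S in k1 k2; lra.
Qed.

Lemma has_sum_tail u l (e : R) N0 : has_sum u l -> (0 < N0)%N ->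
  (forall N, \sum_(N0 <= n < N) cabs (u n) <= e) ->
  cabs (l - \sum_(1 <= n < N0) u n) <= e.
Proof.
move=> hl N00 he; apply: (cvgn_cabs_le (N0 := N0) hl) => N NN.
by rewrite partial_sumB ?N00// (le_trans (cabs_sum _ _ _)).
Qed.

Lemma has_sum_le u l B : has_sum u l -> summable u B -> cabs l <= B.
Proof.
move=> hl hB; have := @has_sum_tail u l B 1 hl isT hB.
by rewrite big_geq// subr0.
Qed.

Lemma has_sumD u v l m : has_sum u l -> has_sum v m -> has_sum (fun n => u n + v n) (l + m).
Proof.
move=> hu hv; have E : (fun N => \sum_(1 <= n < N) (u n + v n)) =
    (fun N => \sum_(1 <= n < N) u n + \sum_(1 <= n < N) v n).
  by apply/funext => N; rewrite big_split.
by rewrite /has_sum E; exact: (cvgD hu hv).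
Qed.

Lemma has_sumB u v l m : has_sum u l -> has_sum v m -> has_sum (fun n => u n - v n) (l - m).
Proof.
move=> hu hv; have E : (fun N => \sum_(1 <= n < N) (u n - v n)) =
    (fun N => \sum_(1 <= n < N) u n - \sum_(1 <= n < N) v n).
  by apply/funext => N; rewrite sumrB.
by rewrite /has_sum E; exact: (cvgB hu hv).
Qed.

Lemma has_sumZ c u l : has_sum u l -> has_sum (fun n => c * u n) (c * l).
Proof.
move=> hu; have E : (fun N => \sum_(1 <= n < N) c * u n) =
    (fun N => c * \sum_(1 <= n < N) u n).
  by apply/funext => N; rewrite mulr_sumr.
by rewrite /has_sum E; exact: (cvgM (cvg_cst c) hu).
Qed.

Lemma summableD u v B D : summable u B -> summable v D -> summable (fun n => u n + v n) (B + D).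
Proof.
move=> hu hv N; apply: (@le_trans _ _ (\sum_(1 <= n < N) (cabs (u n) + cabs (v n)))).
  by apply: ler_sum => *; exact: cabsD.
by rewrite big_split lerD.
Qed.

Lemma summableZ c u B : summable u B -> summable (fun n => c * u n) (cabs c * B).
Proof.
move=> hu N; under eq_bigr do rewrite cabsM.
by rewrite -mulr_sumr ler_wpM2l ?cabs_ge0.
Qed.

Definition cnorm (z : C) : C := (cabs z)%:C.

Lemma norm_convolution u v n :
  cabs (convolution u v n) <= complex.Re (convolution (cnorm \o u) (cnorm \o v) n).
Proof.
rewrite /convolution raddf_sum/= (le_trans (cabs_sum _ _ _))//.
apply: ler_sum => i _; rewrite raddf_sum/= (le_trans (cabs_sum _ _ _))//.
by apply: ler_sum => j _; rewrite cabsM /cnorm /= mul0r subr0.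
Qed.

Lemma summable_convolution u v B D : summable u B -> summable v D ->
  summable (convolution u v) (B * D).
Proof.
move=> hu hv N.
apply: (@le_trans _ _ (\sum_(1 <= n < N) complex.Re (convolution (cnorm \o u) (cnorm \o v) n))).
  by apply: ler_sum => n _; exact: norm_convolution.
rewrite -raddf_sum sum_convolution raddf_sum/=.
apply: (@le_trans _ _ (\sum_(1 <= i < N) cabs (u i) * D)); last first.
  by rewrite -mulr_suml ler_wpM2r// (summable_ge0 hv).
apply: ler_sum => i _; rewrite raddf_sum/=.
apply: (@le_trans _ _ (cabs (u i) * \sum_(1 <= j < N) cabs (v j))); last first.
  by rewrite ler_wpM2l ?cabs_ge0.
rewrite mulr_sumr big_mkcond/=; apply: ler_sum => j _.
by case: ifP => _; rewrite ?mul0r ?subr0// mulr_ge0 ?cabs_ge0.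
Qed.

(** The product of partial sums exceeds the partial sum of the convolution by the terms with
    [i, j < N <= i * j]. Once [N >= M * M], each of them has [i >= M] or [j >= M] and so lies in a
    tail of one of the two series. *)
Lemma has_sum_convolution u v l m B D : summable u B -> summable v D ->
  has_sum u l -> has_sum v m -> has_sum (convolution u v) (l * m).
Proof.
move=> hu hv hl hm.
pose r N : C := \sum_(1 <= i < N) \sum_(1 <= j < N | ~~ (i * j < N)%N) u i * v j.
rewrite /has_sum (_ : (fun N => _) = (fun N => \sum_(1 <= n < N) u n) *
  (fun N => \sum_(1 <= n < N) v n) - r); last first.
  apply/funext => N; rewrite sum_convolution.
  rewrite [RHS](_ : _ = (\sum_(1 <= n < N) u n) * (\sum_(1 <= n < N) v n) - r N)//.
  apply/eqP; rewrite -subr_eq opprK -big_split/= big_distrl/=; apply/eqP.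
  apply: eq_bigr => i _; rewrite big_distrr/=.
  by rewrite [RHS](bigID (fun j => (i * j < N)%N)).
rewrite -[l * m]subr0; apply: cvgB; first exact: (cvgM hl hm).
apply/cvgn_cabsP => e e0.
have B0 := summable_ge0 hu; have D0 := summable_ge0 hv.
have BD1 : 0 < B + D + 1 by lra.
have [M1 hM1] := summable_tail hu (divr_gt0 e0 BD1).
have [M2 hM2] := summable_tail hv (divr_gt0 e0 BD1).
pose M := maxn 1 (maxn M1 M2); set d := e / (B + D + 1) in hM1 hM2.
have d0 : 0 < d by rewrite divr_gt0.
exists (M * M)%N => N MN; rewrite sub0r cabsN.
apply: (@le_lt_trans _ _ (d * D + B * d)); last first.
  have : d * (B + D + 1) = e by rewrite /d divfK// gt_eqF.
  by lra.
have M0 : (0 < M)%N by rewrite leq_max.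
have MleN : (M <= N)%N by rewrite (leq_trans _ MN)// leq_pmulr.
have tailE (w : nat -> C) : \sum_(M <= i < N) cabs (w i) =
    \sum_(1 <= i < N) (if (M <= i)%N then cabs (w i) else 0).
  rewrite (@big_cat_nat _ _ _ M 1 N)//= [X in _ = X + _]big_nat_cond.
  rewrite [X in _ = X + _]big1 ?add0r; last first.
    by move=> i /andP[/andP[_ iM] _]; rewrite leqNgt iM.
  by rewrite big_nat_cond [RHS]big_nat_cond; apply: eq_bigr => i /andP[/andP[-> _] _].
have tu : \sum_(M <= i < N) cabs (u i) <= d by apply: hM1; rewrite /M !leq_max leqnn orbT.
have tv : \sum_(M <= i < N) cabs (v i) <= d by apply: hM2; rewrite /M !leq_max leqnn !orbT.
apply: (@le_trans _ _ ((\sum_(M <= i < N) cabs (u i)) * (\sum_(1 <= j < N) cabs (v j)) +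
    (\sum_(1 <= i < N) cabs (u i)) * (\sum_(M <= j < N) cabs (v j)))); last first.
  apply: lerD; apply: ler_pM => //; rewrite ?sumr_ge0// => *; exact: cabs_ge0.
rewrite /r (le_trans (cabs_sum _ _ _))// !tailE !mulr_suml -big_split/=.
rewrite big_nat_cond [leRHS]big_nat_cond; apply: ler_sum => i /andP[/andP[i0 iN] _].
rewrite (le_trans (cabs_sum _ _ _))// !mulr_sumr -big_split/= big_mkcond/=.
rewrite big_nat_cond [leRHS]big_nat_cond; apply: ler_sum => j /andP[/andP[j0 jN] _].
have ui := cabs_ge0 (u i); have vj := cabs_ge0 (v j); have uv := mulr_ge0 ui vj.
case: ifPn => [|_]; last by case: ifP => _; case: ifP => _; rewrite ?mul0r ?mulr0; lra.
rewrite -leqNgt cabsM => Nij.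
have [iM|iM] := leqP M i; first by case: ifP => _; rewrite ?mulr0; lra.
have [jM|jM] := leqP M j; first by rewrite mul0r add0r.
by move: (leq_trans MN Nij); rewrite leqNgt ltn_mul.
Qed.

Definition completely_multiplicative (chi : nat -> C) : Prop :=
  forall i j, (0 < i)%N -> (0 < j)%N -> chi (i * j)%N = chi i * chi j.

Lemma convolution_twist chi a b n : completely_multiplicative chi ->
  convolution (fun n => a n * chi n) (fun n => b n * chi n) n =
  convolution a b n * chi n.
Proof.
move=> hchi; rewrite /convolution mulr_suml.
rewrite big_nat_cond [RHS]big_nat_cond; apply: eq_bigr => i /andP[/andP[i0 _] _].
rewrite mulr_suml big_nat_cond [RHS]big_nat_cond.
apply: eq_bigr => j /andP[/andP[j0 _] /eqP <-].
by rewrite hchi//; ring.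
Qed.

Definition series_value u : C := xget 0 [set l | has_sum u l].

Lemma series_valueE u l : has_sum u l -> series_value u = l.
Proof.
by move=> hl; exact: (has_sum_unique (xgetPex 0 (ex_intro _ l hl)) hl).
Qed.

Lemma series_valueP u B : summable u B -> has_sum u (series_value u).
Proof. by move=> /summable_has_sum[l hl]; rewrite (series_valueE hl). Qed.

End Summation.

(** * Coefficients of bounded Dirichlet series *)

Section Coefficients.
Variable R : realType.
Local Notation C := R[i].
Local Notation H := (half_plane R).
Implicit Types (a b chi : nat -> C) (s : H) (f g : Hinf R).

Lemma HinfB f g s : (f - g) s = f s - g s.
Proof. reflexivity. Qed.

Lemma HinfM f g s : (f * g) s = f s * g s.
Proof. reflexivity. Qed.

Lemma Hinf1 s : (1 : Hinf R) s = 1.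
Proof. reflexivity. Qed.

Definition bounded_by f (B : R) : Prop := forall s, cabs (f s) <= B.

Lemma HinfP f : [/\ holomorphic f, bounded_on_half_plane f & dirichlet_representable f].
Proof. by apply/Hinf_predP; case: f. Qed.

Lemma exists_bound f : exists B, bounded_by f B.
Proof.
have [_ [B hB] _] := HinfP f; exists B => s.
by have := hB s; rewrite normcE lecR.
Qed.

(** Index [0] occurs in no partial sum, so [coef f 0] is undetermined; this explains the condition
    [0 < n] in what follows. *)
Definition coef f : nat -> C := xget (fun=> 0) [set a | exists sigma0, represents a sigma0 f].

Lemma coefP f : exists sigma0, represents (coef f) sigma0 f.
Proof.
have [_ _ [a [sigma0 ha]]] := HinfP f.
have ex : exists a, [set a | exists sigma0, represents a sigma0 f] a by exists a, sigma0.
exact: (xgetPex (fun=> 0) ex).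
Qed.

Lemma representsB a b sa sb (h k : H -> C) : represents a sa h -> represents b sb k ->
  represents (fun n => a n - b n) (Num.max sa sb) (fun s => h s - k s).
Proof.
move=> ha hb s; rewrite gt_max => /andP[hsa hsb].
have E : (fun N => \sum_(1 <= n < N) (a n - b n) / natpow n (val s)) =
    (fun N => \sum_(1 <= n < N) a n / natpow n (val s)
            - \sum_(1 <= n < N) b n / natpow n (val s)).
  by apply/funext => N; rewrite -sumrB; apply: eq_bigr => i _; rewrite mulrBl.
by rewrite E; exact: (cvgB (ha _ hsa) (hb _ hsb)).
Qed.

(** Two representations differ by a series representing the zero function, and [coefficient_bound]
    with the bound [0] annihilates its coefficients. *)
Lemma coefE f a sigma0 n : represents a sigma0 f -> (0 < n)%N -> coef f n = a n.
Proof.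
move=> ha n0; have [sigma hc] := coefP f; apply/eqP; rewrite -subr_eq0 -cabs_eq0.
rewrite eq_le cabs_ge0 andbT.
have hd := representsB hc ha.
have h0 : (fun s => f s - f s) = (fun=> 0) by apply/funext => s; rewrite subrr.
rewrite h0 in hd.
have hol : holomorphic (fun=> 0 : C) by move=> s; exact: derivable_cst.
by apply: (coefficient_bound hol _ hd n0) => s; rewrite cabs0.
Qed.

Lemma coef_le f B n : bounded_by f B -> (0 < n)%N -> cabs (coef f n) <= B.
Proof.
move=> hB n0; have [sigma hc] := coefP f; have [hol _ _] := HinfP f.
exact: coefficient_bound hol hB hc n0.
Qed.

Lemma coefB f g n : (0 < n)%N -> coef (f - g) n = coef f n - coef g n.
Proof.
have [sf hf] := coefP f; have [sg hg] := coefP g => n0.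
apply: (coefE (a := fun n => coef f n - coef g n) (sigma0 := Num.max sf sg) _ n0) => s hs.
by rewrite HinfB; exact: representsB hf hg s hs.
Qed.

Definition nat_inv_pow s : nat -> C := fun n => (natpow n (val s))^-1.

Lemma nat_inv_powM s : completely_multiplicative (nat_inv_pow s).
Proof. by move=> i j i0 j0; rewrite /nat_inv_pow natpowM// invfM. Qed.

Lemma represents_summable a sigma0 (h : H -> C) : represents a sigma0 h ->
  exists sigma B, forall s, sigma <= complex.Re (val s) ->
    summable (fun n => a n * nat_inv_pow s n) B.
Proof.
move=> /represents_tail[sigma [A [s0 A0 hA]]]; exists sigma, (A * 2) => s hs N.
have h3 n : (0 < n)%N -> cabs (a n * nat_inv_pow s n) <= A / n%:R ^+ 3.
  by move=> n0; have [_ ] := hA s 1%N hs isT; apply.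
have [N1|N1] := leqP N 1; first by rewrite big_geq// mulr_ge0.
rewrite big_ltn//; apply: (@le_trans _ _ (A + A * 1)); last by lra.
apply: lerD; first by apply: le_trans (h3 1%N isT) _; rewrite expr1n divr1.
apply: (@le_trans _ _ (\sum_(2 <= i < N) A * (i%:R ^+ 3)^-1)); last first.
  by rewrite -mulr_sumr ler_wpM2l//; have := @sum_inv_cube R 1 N isT; rewrite invr1.
rewrite big_nat_cond [leRHS]big_nat_cond; apply: ler_sum => i /andP[/andP[i0 _] _].
by apply: h3; exact: leq_trans i0.
Qed.

(** Far to the right both series converge absolutely and may be multiplied by convolution;
    uniqueness of the coefficients does the rest. *)
Lemma coefM f g n : (0 < n)%N -> coef (f * g) n = convolution (coef f) (coef g) n.
Proof.
have [sf hf] := coefP f; have [sg hg] := coefP g => n0.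
have [sf' [B hB]] := represents_summable hf.
have [sg' [D hD]] := represents_summable hg.
apply: (coefE (sigma0 := Num.max (Num.max sf sg) (Num.max sf' sg'))) => // s.
rewrite !gt_max => /andP[/andP[h1 h2] /andP[h3 h4]].
rewrite HinfM.
have := has_sum_convolution (hB s (ltW h3)) (hD s (ltW h4)) (hf s h1) (hg s h2).
by apply: eq_has_sum => i i0; rewrite convolution_twist//; exact: nat_inv_powM.
Qed.

Lemma coef1 n : (0 < n)%N -> coef 1 n = (n == 1%N)%:R.
Proof.
apply: (coefE (a := fun n => (n == 1%N)%:R) (sigma0 := 0)) => s _.
rewrite Hinf1; apply: (@cvg_near_cst _ _ (1 : C)); exists 2%N => // N /= N2.
rewrite big_ltn// natpow1 divr1 /= big_nat_cond big1 ?addr0// => i.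
by rewrite andbT => /andP[i2 _]; rewrite gtn_eqF// mul0r.
Qed.

End Coefficients.

(** * Characters as multiplicative functionals *)

Section Characters.
Variable R : realType.
Local Notation C := R[i].
Implicit Types (chi : nat -> C) (f g : Hinf R).

Definition character chi (S : R) : Prop :=
  [/\ completely_multiplicative chi, chi 1%N = 1 & summable chi S].

(** Under Bohr's correspondence, which treats the [p^-s] as independent variables, this is the value
    of the lifted function at the point with coordinates [chi p]. *)
Definition ev chi f : C := series_value (fun n => coef f n * chi n).

Variables (chi : nat -> C) (S : R).
Hypothesis hchi : character chi S.

Lemma ev_summable f B : bounded_by f B -> summable (fun n => coef f n * chi n) (B * S).
Proof.
have [_ _ hS] := hchi; move=> hB N; have B0 := le_trans (cabs_ge0 _) (hB point).
apply: (@le_trans _ _ (\sum_(1 <= n < N) B * cabs (chi n))); last first.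
  by rewrite -mulr_sumr ler_wpM2l.
rewrite big_nat_cond [leRHS]big_nat_cond; apply: ler_sum => i /andP[/andP[i0 _] _].
by rewrite cabsM ler_wpM2r ?cabs_ge0// coef_le.
Qed.

Lemma ev_has_sum f : has_sum (fun n => coef f n * chi n) (ev chi f).
Proof. by have [B hB] := exists_bound f; exact: series_valueP (ev_summable hB). Qed.
Arguments ev_has_sum : clear implicits.

Lemma ev_le_crude f B : bounded_by f B -> cabs (ev chi f) <= B * S.
Proof. by move=> hB; exact: has_sum_le (ev_has_sum f) (ev_summable hB). Qed.

Lemma evB f g : ev chi (f - g) = ev chi f - ev chi g.
Proof.
apply: series_valueE; apply: eq_has_sum (has_sumB (ev_has_sum f) (ev_has_sum g)).
by move=> n n0; rewrite coefB// mulrBl.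
Qed.

Lemma evM f g : ev chi (f * g) = ev chi f * ev chi g.
Proof.
have [hm _ _] := hchi.
have [B hB] := exists_bound f; have [D hD] := exists_bound g.
apply: series_valueE.
have := has_sum_convolution (ev_summable hB) (ev_summable hD) (ev_has_sum f) (ev_has_sum g).
by apply: eq_has_sum => n n0; rewrite convolution_twist// coefM.
Qed.

Lemma ev1 : ev chi 1 = 1.
Proof.
have [_ h1 _] := hchi; apply: series_valueE.
apply: (@cvg_near_cst _ _ (1 : C)); exists 2%N => // N /= N2.
rewrite big_ltn// coef1// h1 mulr1 eqxx big_nat_cond big1 ?addr0// => i.
by rewrite andbT => /andP[i2 _]; rewrite coef1 ?gtn_eqF ?mul0r//; exact: leq_trans i2.
Qed.

Lemma ev0 : ev chi 0 = 0.
Proof. by rewrite -[X in ev chi X](subrr 0) evB subrr. Qed.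

Lemma evN f : ev chi (- f) = - ev chi f.
Proof. by rewrite -[X in ev chi X]sub0r evB ev0 sub0r. Qed.

Lemma evD f g : ev chi (f + g) = ev chi f + ev chi g.
Proof. by rewrite -[X in f + X]opprK evB evN opprK. Qed.

Lemma ev_sum (I : Type) (r : seq I) (P : pred I) (F : I -> Hinf R) :
  ev chi (\sum_(i <- r | P i) F i) = \sum_(i <- r | P i) ev chi (F i).
Proof. exact: (big_morph (ev chi) evD ev0). Qed.

Lemma evX f k : ev chi (f ^+ k) = ev chi f ^+ k.
Proof. by elim: k => [|k ih]; rewrite ?expr0 ?ev1// !exprS evM ih. Qed.

Lemma bounded_byM f g B D : bounded_by f B -> bounded_by g D -> bounded_by (f * g) (B * D).
Proof.
move=> hf hg s; rewrite HinfM cabsM.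
by rewrite ler_pM ?cabs_ge0.
Qed.

Lemma bounded_byX f B k : bounded_by f B -> bounded_by (f ^+ k) (B ^+ k).
Proof.
move=> hf; elim: k => [|k ih]; first by move=> s; rewrite !expr0 Hinf1 cabs1.
by rewrite !exprS; exact: bounded_byM.
Qed.

Lemma bernoulli (x : R) n : 0 <= x -> 1 + n%:R * x <= (1 + x) ^+ n.
Proof.
move=> x0; elim: n => [|n ih]; first by rewrite mul0r addr0 expr0.
rewrite exprS -natr1; have : 0 <= n%:R * x by rewrite mulr_ge0.
nra.
Qed.

(** If [x > B > 0], then [(x / B)^k] grows at least linearly in [k] by Bernoulli's inequality and so
    exceeds any [D]. *)
Lemma power_trick (x B D : R) : 0 <= B -> (forall k : nat, x ^+ k <= B ^+ k * D) -> x <= B.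
Proof.
move=> B0 hk; rewrite leNgt; apply/negP => Bx.
have x0 : 0 < x by exact: le_lt_trans Bx.
have [B1|B1] := eqVneq B 0.
  by have := hk 1%N; rewrite !expr1 B1 mul0r leNgt x0.
have Bp : 0 < B by rewrite lt_def B1.
pose d := x / B - 1; have d0 : 0 < d by rewrite subr_gt0 ltr_pdivlMr// mul1r.
have hD k : (1 + d) ^+ k <= D.
  rewrite /d addrC subrK expr_div_n ler_pdivrMr ?exprn_gt0// mulrC; exact: hk.
have D0 : 0 <= D by apply: le_trans (hD 0%N); rewrite expr0.
have := truncnS_gt (D / d); set k := _.+1; rewrite ltr_pdivrMr// => h.
by have := le_trans (bernoulli k (ltW d0)) (hD k); lra.
Qed.

(* The crude bound [S * sup |f|], applied to the powers of [f], loses its constant. *)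
Theorem ev_le f B : bounded_by f B -> cabs (ev chi f) <= B.
Proof.
move=> hB; apply: (@power_trick _ _ S); first exact: le_trans (cabs_ge0 _) (hB point).
move=> k; rewrite -cabsX -evX; apply: ev_le_crude; exact: bounded_byX.
Qed.

End Characters.

(** * The lacunary relations *)

Section AbsolutelyConvergent.
Variable R : realType.
Local Notation C := R[i].
Local Notation H := (half_plane R).
Implicit Types (a b chi : nat -> C) (s : H).

Lemma nat_inv_powE s n : nat_inv_pow s n = cexp (- (ln n%:R)%:C * val s).
Proof. by rewrite /nat_inv_pow natpowE -cexpN mulNr. Qed.

Lemma cabs_nat_inv_pow s n :
  cabs (nat_inv_pow s n) = expR (- ln n%:R * complex.Re (val s)).
Proof. by rewrite nat_inv_powE cabs_cexp -rmorphN Re_realM. Qed.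

(** With [x = ln n]: the first derivative and the second-order remainder of [n^-s] cost [ln n] and
    its square, and any power [n^d] with [d > 0] absorbs both. *)
Lemma exp_sqr_bound (x d : R) : 0 <= x -> 0 < d ->
  x <= 2 / d * expR (d * x) /\ x ^+ 2 <= 4 / d ^+ 2 * expR (d * x).
Proof.
move=> x0 d0; have h : d * x / 2 <= expR (d * x / 2).
  by apply: le_trans (expR_ge1Dx _); rewrite lerDr.
have -> : expR (d * x) = expR (d * x / 2) ^+ 2.
  by rewrite expr2 -expRD; congr expR; field.
have h1 : 1 <= expR (d * x / 2).
  by rewrite -[leLHS]expR0 ler_expR divr_ge0// mulr_ge0// ltW.
have hx : x <= 2 / d * expR (d * x / 2).
  rewrite [leLHS](_ : x = 2 / d * (d * x / 2)); last by field; rewrite gt_eqF.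
  by apply: ler_wpM2l h; rewrite divr_ge0// ltW.
split.
  apply: (le_trans hx); apply: ler_wpM2l; first by rewrite divr_ge0// ltW.
  by rewrite expr2; nra.
rewrite (_ : 4 / _ * _ = (2 / d * expR (d * x / 2)) ^+ 2); last first.
  by field; rewrite gt_eqF.
by rewrite lerXn2r ?nnegrE// mulr_ge0 ?divr_ge0 ?expR_ge0 ?ltW.
Qed.

Definition half_point (s : H) (x : R) (x0 : 0 < x) : H :=
  exist (fun s : C => 0 < complex.Re s) x%:C x0.

Lemma series_holomorphic a (f : H -> C) :
  (forall s, exists B, summable (fun n => a n * nat_inv_pow s n) B) ->
  (forall s, has_sum (fun n => a n * nat_inv_pow s n) (f s)) ->
  holomorphic f.
Proof.
move=> hB hf; apply/holomorphic_extend => z z0.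
pose s : H := exist (fun s : C => 0 < complex.Re s) z z0.
(* From [n^(-Re z) = n^(-4 d)] one factor [n^d] is spent on the logarithms and one on the growth
   [n^|h|]; the remaining [n^(-2 d)] is absolutely summable against [a] at the point [s2]. *)
pose d := complex.Re z / 4; have d0 : 0 < d by rewrite divr_gt0.
have d0' : 0 <= d by exact: ltW.
have c2 : 0 <= 2 / d by exact: divr_ge0.
have c4 : 0 <= 4 / d ^+ 2 by apply: divr_ge0 => //; exact: sqr_ge0.
have s20 : 0 < 2 * d by rewrite mulr_gt0.
pose s2 : H := half_point s s20.
have [B hB2] := hB s2.
pose L n : R := ln n%:R.
have L0 n : (0 < n)%N -> 0 <= L n by move=> n0; rewrite ln_ge0// ler1n.
have pos n : (0 < n)%N -> - L n * complex.Re z + d * L n + d * L n = - L n * (2 * d).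
  by move=> _; rewrite /d; field.
pose v n := a n * (- (L n)%:C * nat_inv_pow s n).
have hv : summable v (2 / d * B).
  have := summableZ (2 / d)%:C hB2; rewrite cabs_real ger0_norm//.
  apply: ler_summable => n n0; rewrite /v !cabsM cabsN !cabs_real.
  rewrite [`|L n|]ger0_norm ?L0// [`|2 / d|]ger0_norm//.
  rewrite [leRHS]mulrCA ler_wpM2l ?cabs_ge0// !cabs_nat_inv_pow/=.
  have [h1 _] := exp_sqr_bound (L0 n n0) d0.
  apply: (le_trans (ler_wpM2r (expR_ge0 _) h1)); move: (2 / d) c2 => c c2.
  rewrite -mulrA -expRD; apply: ler_wpM2l => //; rewrite ler_expR.
  rewrite -(pos n n0) -/(L n); have := mulr_ge0 d0' (L0 n n0); lra.
have [l hl] := summable_has_sum hv.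
exists l => e e0.
pose K := 4 / d ^+ 2 * B.
have K0 : 0 <= K by rewrite mulr_ge0 ?(summable_ge0 hB2)// divr_ge0 ?exprn_ge0.
have K1 : 0 < K + 1 by rewrite ltr_wpDl.
exists (Num.min d (e / (K + 1))); first by rewrite lt_min d0 divr_gt0.
move=> h; rewrite lt_min => /andP[hd]; rewrite ltr_pdivlMr// => he.
have hz : 0 < complex.Re (z + h).
  by apply: rhp_near => //; apply: lt_trans hd _; rewrite /d; lra.
pose sh : H := exist (fun s : C => 0 < complex.Re s) (z + h) hz.
have -> : extend f (z + h) = f sh by rewrite -(extend_val f sh).
have -> : extend f z = f s by rewrite -(extend_val f s).
have hsum := has_sumB (has_sumB (hf sh) (hf s)) (has_sumZ (c := h) hl).
suff hK : cabs (f sh - f s - h * l) <= K * cabs h ^+ 2.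
  rewrite [l * h]mulrC; apply: (le_trans hK); rewrite expr2 mulrA.
  rewrite ler_wpM2r ?cabs_ge0//; have := cabs_ge0 h; nra.
have hK : summable (fun n => a n * nat_inv_pow sh n - a n * nat_inv_pow s n - h * v n)
    (K * cabs h ^+ 2).
  have := summableZ ((4 / d ^+ 2 * cabs h ^+ 2)%:C) hB2.
  rewrite cabs_real ger0_norm; last first.
    by rewrite mulr_ge0 ?sqr_ge0// divr_ge0 ?exprn_ge0.
  rewrite [X in summable _ X](_ : _ = K * cabs h ^+ 2); last by rewrite /K; ring.
  apply: ler_summable => n n0; rewrite !cabsM cabs_real ger0_norm; last first.
    by rewrite mulr_ge0 ?sqr_ge0// divr_ge0 ?exprn_ge0.
  rewrite (_ : _ - _ = a n * (nat_inv_pow s n * (cexp (- (L n)%:C * h) - 1 - - (L n)%:C * h)));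
    last first.
    by rewrite /v !nat_inv_powE /= mulrDr cexpD -/(L n); ring.
  rewrite !cabsM [leRHS]mulrCA ler_wpM2l ?cabs_ge0// !cabs_nat_inv_pow/= -/(L n).
  apply: (le_trans (ler_wpM2l (expR_ge0 _) (cexp_taylor _))).
  rewrite cabsM cabsN cabs_real ger0_norm ?L0// exprMn.
  have [_ h2] := exp_sqr_bound (L0 n n0) d0.
  have h3 : expR (L n * cabs h) <= expR (d * L n).
    by rewrite ler_expR mulrC ler_wpM2r ?L0// ltW.
  rewrite -(pos n n0) !expRD.
  set E := expR (- L n * complex.Re z); set E2 := expR (d * L n).
  have E0 : 0 <= E by exact: expR_ge0.
  rewrite [leRHS](_ : _ = (4 / d ^+ 2 * E2) * E2 * (E * cabs h ^+ 2)); last by ring.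
  rewrite [leLHS](_ : _ = L n ^+ 2 * expR (L n * cabs h) * (E * cabs h ^+ 2)); last by ring.
  apply: ler_wpM2r; first by rewrite mulr_ge0 ?sqr_ge0.
  by apply: ler_pM; rewrite ?expR_ge0 ?sqr_ge0.
exact: has_sum_le hsum hK.
Qed.

Lemma series_element a (f : H -> C) D :
  (forall s, exists B, summable (fun n => a n * nat_inv_pow s n) B) ->
  (forall s, has_sum (fun n => a n * nat_inv_pow s n) (f s)) ->
  (forall s, cabs (f s) <= D) ->
  exists F : Hinf R, (forall s, F s = f s) /\ (forall n, (0 < n)%N -> coef F n = a n).
Proof.
move=> hB hf hD.
have hF : f \in @Hinf_pred R.
  apply/Hinf_predP; split; first exact: series_holomorphic hB hf.
    by exists D => s; rewrite normcE lecR.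
  by exists a, 0 => s _; exact: hf.
exists (MkHinf hF); split=> // n n0.
by apply: (coefE (a := a) (sigma0 := 0) _ n0) => s _; exact: hf.
Qed.

End AbsolutelyConvergent.

(** * Formal Dirichlet series and their values *)

Section FormalSeries.
Variable R : realType.
Local Notation C := R[i].
Implicit Types (a b chi : nat -> C) (phi psi : (nat -> C) -> C) (beta gamma : (nat -> C) -> R).

(** The class contains [nat_inv_pow s] for all [s] in the half-plane, even where it is not summable,
    as well as the characters used for evaluation. One formal series thus governs a function and its
    evaluations at once. *)
Record small (chi : nat -> C) : Prop := Small {
  small_mul : completely_multiplicative chi;
  small_one : chi 1%N = 1;
  small2 : cabs (chi 2) < 1;
  small3 : cabs (chi 3) < 1;
  small5 : cabs (chi 5) < 1 }.

(* [phi chi] is the value at every small [chi] of one formal Dirichlet series,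
   starting at index [m] and with absolute sum at most [beta chi]. *)
Definition formal_series (m : nat) phi beta : Prop := exists a,
  (forall n, (0 < n < m)%N -> a n = 0) /\
  forall chi, small chi -> summable (fun n => a n * chi n) (beta chi) /\
    has_sum (fun n => a n * chi n) (phi chi).

Lemma small_exp chi k i : small chi -> (0 < k)%N -> chi (k ^ i)%N = chi k ^+ i.
Proof.
move=> sc k0; elim: i => [|i ih]; first by rewrite expn0 expr0 small_one.
by rewrite expnS exprS -ih (small_mul sc)// expn_gt0 k0.
Qed.

Lemma formal_mono c k : (0 < k)%N ->
  formal_series k (fun chi => c * chi k) (fun chi => cabs c * cabs (chi k)).
Proof.
move=> k0; exists (fun n => if n == k then c else 0); split.
  by move=> n /andP[_ nk]; rewrite ltn_eqF.
move=> chi _; have E N : (k < N)%N ->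
    \sum_(1 <= n < N) (if n == k then c else 0) * chi n = c * chi k.
  move=> kN; rewrite (bigD1_seq k)/= ?mem_index_iota ?iota_uniq ?k0// eqxx.
  by rewrite big1 ?addr0// => i /negPf->; rewrite mul0r.
split; last first.
  apply: (@cvg_near_cst _ _ (c * chi k)); by exists k.+1.
move=> N; have [kN|Nk] := ltnP k N; last first.
  rewrite big_nat_cond big1 ?mulr_ge0 ?cabs_ge0// => i /andP[/andP[i0 iN] _].
  by rewrite ltn_eqF ?mul0r ?cabs0// (leq_trans iN).
rewrite (bigD1_seq k)/= ?mem_index_iota ?iota_uniq ?k0// eqxx.
by rewrite big1 ?addr0 ?cabsM// => i /negPf->; rewrite mul0r cabs0.
Qed.

Lemma formal0 : formal_series 1 (fun=> 0) (fun=> 0).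
Proof.
exists (fun=> 0); split=> // chi _; split.
  by move=> N; rewrite big1// => i _; rewrite mul0r cabs0.
by apply: cvg_near_cst; exists 0%N => // N _; rewrite big1// => i _; rewrite mul0r.
Qed.

Lemma formal_weaken m phi beta : formal_series m phi beta -> formal_series 1 phi beta.
Proof.
case=> a [_ ha]; exists a; split=> // n /andP[n0]; by rewrite ltnNge n0.
Qed.

Lemma formalD phi psi beta gamma : formal_series 1 phi beta -> formal_series 1 psi gamma ->
  formal_series 1 (fun chi => phi chi + psi chi) (fun chi => beta chi + gamma chi).
Proof.
case=> a [_ ha] [b [_ hb]]; exists (fun n => a n + b n); split.
  by move=> n /andP[n0]; rewrite ltnNge n0.
move=> chi sc; have [a1 a2] := ha chi sc; have [b1 b2] := hb chi sc; split.
  by apply: eq_summable (summableD a1 b1) => n n0; rewrite mulrDl.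
by apply: eq_has_sum (has_sumD a2 b2) => n n0; rewrite mulrDl.
Qed.

Lemma formalM m phi psi beta gamma : formal_series m phi beta -> formal_series 1 psi gamma ->
  formal_series m (fun chi => phi chi * psi chi) (fun chi => beta chi * gamma chi).
Proof.
case=> a [a0 ha] [b [_ hb]]; exists (convolution a b); split.
  move=> n /andP[n0 nm]; rewrite /convolution big_nat_cond big1// => i /andP[/andP[i0 iN] _].
  rewrite big1// => j _; rewrite a0 ?mul0r// i0/=.
  by apply: leq_trans nm.
move=> chi sc; have [a1 a2] := ha chi sc; have [b1 b2] := hb chi sc; split.
  apply: eq_summable (summable_convolution a1 b1) => n n0.
  by rewrite convolution_twist//; exact: small_mul.
apply: eq_has_sum (has_sum_convolution a1 b1 a2 b2) => n n0.
by rewrite convolution_twist//; exact: small_mul.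
Qed.

Lemma formal_sum (N : nat) (phi : nat -> (nat -> C) -> C) (beta : nat -> (nat -> C) -> R) :
  (forall i, formal_series 1 (phi i) (beta i)) ->
  formal_series 1 (fun chi => \sum_(i < N) phi i chi) (fun chi => \sum_(i < N) beta i chi).
Proof.
move=> h; elim: N => [|N ih].
  rewrite (_ : (fun chi => _) = fun=> 0); last by apply/funext => chi; rewrite big_ord0.
  rewrite [X in formal_series _ _ X](_ : _ = fun=> 0); first exact: formal0.
  by apply/funext => chi; rewrite big_ord0.
rewrite (_ : (fun chi => _) = fun chi => \sum_(i < N) phi i chi + phi N chi); last first.
  by apply/funext => chi; rewrite big_ord_recr.
rewrite [X in formal_series _ _ X](_ : _ = fun chi => \sum_(i < N) beta i chi + beta N chi);
  last by apply/funext => chi; rewrite big_ord_recr.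
exact: (formalD ih (h N)).
Qed.

Lemma formal1 : formal_series 1 (fun=> 1) (fun=> 1).
Proof.
have [a ha] := @formal_mono (1 : C) 1%N isT.
exists a; split; first by move=> n /andP[n0]; rewrite ltnNge n0.
move=> chi sc; have h := proj2 ha chi sc; split.
  by have := proj1 h; rewrite (small_one sc) cabs1 mulr1.
by have := proj2 h; rewrite (small_one sc) mulr1.
Qed.

Lemma formal_exp (N : nat) phi beta : formal_series 1 phi beta ->
  formal_series 1 (fun chi => phi chi ^+ N) (fun chi => beta chi ^+ N).
Proof.
move=> h; elim: N => [|N ih].
  have -> : (fun chi => phi chi ^+ 0) = (fun=> 1) by apply/funext => chi; rewrite expr0.
  have -> : (fun chi => beta chi ^+ 0) = (fun=> 1) by apply/funext => chi; rewrite expr0.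
  exact: formal1.
have -> : (fun chi => phi chi ^+ N.+1) = (fun chi => phi chi * phi chi ^+ N).
  by apply/funext => chi; rewrite exprS.
have -> : (fun chi => beta chi ^+ N.+1) = (fun chi => beta chi * beta chi ^+ N).
  by apply/funext => chi; rewrite exprS.
exact: (formalM h ih).
Qed.

Lemma bounded_partial_tail (x : nat -> R) B : (forall j, 0 <= x j) ->
  (forall J, \sum_(0 <= j < J) x j <= B) -> forall e, 0 < e ->
  exists J0, forall J N, (J0 <= J)%N -> \sum_(J <= j < N) x j <= e.
Proof.
move=> x0 hB e e0; pose u n : C := (x n.-1)%:C.
have ux M N : \sum_(M.+1 <= n < N.+1) cabs (u n) = \sum_(M <= j < N) x j.
  by rewrite big_add1/=; apply: eq_bigr => i _; rewrite /u/= cabs_real ger0_norm.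
have hu : summable u B.
  by case=> [|N]; [rewrite big_geq//; apply: le_trans (hB 0%N); rewrite big_geq|rewrite ux].
have [J0 hJ] := summable_tail hu e0; exists J0 => J N JJ.
by rewrite -ux hJ// leqW.
Qed.

(** The [j]-th series starts beyond index [j], so each coefficient of the limit is a finite sum; the
    bounds [beta j] justify exchanging the two summations. *)
Lemma formal_limit (m : nat -> nat) (phi : nat -> (nat -> C) -> C)
    (beta : nat -> (nat -> C) -> R) :
  (forall j, j < m j)%N ->
  (forall j, formal_series (m j) (phi j) (beta j)) ->
  (forall chi, small chi -> exists B, forall J, \sum_(0 <= j < J) beta j chi <= B) ->
  exists Phi gamma, formal_series 1 Phi gamma /\ forall chi, small chi ->
    (fun J => \sum_(0 <= j < J) phi j chi) @ \oo --> Phi chi.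
Proof.
move=> hm hF hB; have [a ha] := choice hF.
have a0 j n : (0 < n <= j)%N -> a j n = 0.
  move=> /andP[n0 nj]; have [h _] := ha j; apply: h.
  by rewrite n0 (leq_ltn_trans nj).
have ha1 j chi : small chi -> summable (fun n => a j n * chi n) (beta j chi).
  by move=> sc; have [_ h] := ha j; have [] := h chi sc.
have ha2 j chi : small chi -> has_sum (fun n => a j n * chi n) (phi j chi).
  by move=> sc; have [_ h] := ha j; have [] := h chi sc.
have b0 j chi : small chi -> 0 <= beta j chi.
  by move=> sc; exact: summable_ge0 (ha1 j chi sc).
pose A n := \sum_(0 <= j < n) a j n.
pose gamma chi := xget 0 [set B | forall J, \sum_(0 <= j < J) beta j chi <= B].
have hg chi : small chi -> forall J, \sum_(0 <= j < J) beta j chi <= gamma chi.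
  move=> sc; have [B hBc] := hB chi sc.
  have ex : exists B, [set B | forall J, \sum_(0 <= j < J) beta j chi <= B] B by exists B.
  exact: (xgetPex 0 ex).
have tailA chi J N (e : R) : small chi ->
    (forall N, \sum_(J <= j < N) beta j chi <= e) ->
    \sum_(1 <= n < N) cabs ((A n - \sum_(0 <= j < J) a j n) * chi n) <= e.
  move=> sc he; apply: le_trans (he (maxn J N)).
  apply: (@le_trans _ _ (\sum_(1 <= n < N) \sum_(J <= j < maxn J N) cabs (a j n * chi n))).
    rewrite big_nat_cond [leRHS]big_nat_cond; apply: ler_sum => n /andP[/andP[n0 nN] _].
    have AE : A n = \sum_(0 <= j < maxn J N) a j n.
      rewrite (@big_cat_nat _ _ _ n 0 (maxn J N))//=; last by rewrite leq_max (ltnW nN) orbT.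
      rewrite [X in _ = _ + X]big_nat_cond [X in _ = _ + X]big1 ?addr0// => j /andP[/andP[nj _] _].
      by rewrite a0// n0.
    rewrite AE (@big_cat_nat _ _ _ J 0 (maxn J N))//= ?leq_maxl//.
    rewrite addrAC subrr add0r mulr_suml.
    exact: cabs_sum.
  rewrite exchange_big/=; apply: ler_sum => j _.
  exact: ha1.
exists (fun chi => series_value (fun n => A n * chi n)), gamma.
have sumA chi : small chi -> summable (fun n => A n * chi n) (gamma chi).
  move=> sc N; have := @tailA chi 0%N N (gamma chi) sc (hg chi sc).
  by apply: le_trans; apply: ler_sum => n _; rewrite big_geq// subr0.
split.
  exists A; split; first by move=> n /andP[n0]; rewrite ltnNge n0.
  by move=> chi sc; split; [exact: sumA|exact: (series_valueP (sumA chi sc))].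
move=> chi sc; apply/cvgn_cabsP => e e0.
have e20 : 0 < e / 2 by rewrite divr_gt0.
have [J0 hJ] := bounded_partial_tail (fun j => b0 j chi sc) (hg chi sc) e20.
exists J0 => J JJ; apply: (@le_lt_trans _ _ (e / 2)); last by lra.
have hs : has_sum (fun n => \sum_(0 <= j < J) a j n * chi n) (\sum_(0 <= j < J) phi j chi).
  elim: (J) => [|k ih].
    rewrite big_geq//; apply: cvg_near_cst; exists 0%N => // N _.
    by rewrite big1// => i _; rewrite big_geq.
  have h := has_sumD ih (ha2 k chi sc).
  have -> : \sum_(0 <= j < k.+1) phi j chi = \sum_(0 <= j < k) phi j chi + phi k chi.
    exact: big_nat_recr.
  by apply: eq_has_sum h => n n0; rewrite [RHS]big_nat_recr.
have hd := has_sumB (series_valueP (sumA chi sc)) hs.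
apply: (has_sum_le hd) => N.
rewrite (eq_bigr (fun n => cabs ((A n - \sum_(0 <= j < J) a j n) * chi n))).
  by apply: tailA => // N'; exact: hJ.
by move=> n _; congr cabs; rewrite mulrBl; congr (_ - _); rewrite mulr_suml.
Qed.

Lemma small_nat_inv_pow (s : half_plane R) : small (nat_inv_pow s).
Proof.
have h n : (1 < n)%N -> cabs (nat_inv_pow s n) < 1.
  move=> n1; rewrite cabs_nat_inv_pow -[ltRHS]expR0 ltr_expR mulNr oppr_lt0.
  by rewrite mulr_gt0 ?ln_gt0 ?ltr1n//; exact: (valP s).
split; rewrite ?h//; first exact: nat_inv_powM.
by rewrite nat_inv_powE ln1 oppr0 mul0r cexp0.
Qed.

(** Only the values need a uniform bound on the half-plane; the absolute sums [beta] may blow up at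
    its boundary. This lets in elements that are bounded through cancellation. *)
Lemma formal_element m phi beta D : formal_series m phi beta ->
  (forall s : half_plane R, cabs (phi (nat_inv_pow s)) <= D) ->
  exists F : Hinf R, (forall s, F s = phi (nat_inv_pow s)) /\
    forall chi S, character chi S -> small chi -> ev chi F = phi chi.
Proof.
case=> a [_ ha] hD.
have [|s|F [hF1 hF2]] := @series_element R a (fun s => phi (nat_inv_pow s)) D _ _ hD.
- by move=> s; exists (beta (nat_inv_pow s)); have [] := ha _ (small_nat_inv_pow s).
- by have [] := ha _ (small_nat_inv_pow s).
exists F; split=> // chi S hchi sc; apply: series_valueE.
by have [_] := ha _ sc; apply: eq_has_sum => n n0; rewrite hF2.
Qed.

End FormalSeries.

(** * Lacunary blocks and the relations built from them *)

Section LacunaryElements.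
Variable R : realType.
Local Notation C := R[i].
Implicit Types (a b chi : nat -> C) (phi psi : (nat -> C) -> C) (beta gamma : (nat -> C) -> R).

Definition geo (N : nat) (x : C) : C := \sum_(i < N) x ^+ i.

Definition geo2 (N : nat) (z w : C) : C := \sum_(i < N) z ^+ (N.-1 - i) * w ^+ i.

Lemma geo_id N (x : C) : (1 - x) * geo N x = 1 - x ^+ N.
Proof. by rewrite -opprB mulNr -subrX1 opprB. Qed.

Lemma geo2_id N (z w : C) : (z - w) * geo2 N z w = z ^+ N - w ^+ N.
Proof. by rewrite subrXX. Qed.

Lemma cabs_expr_le1 (x : C) i : cabs x <= 1 -> cabs (x ^+ i) <= 1.
Proof. by move=> x1; rewrite cabsX exprn_ile1// cabs_ge0. Qed.

Lemma cabs_geo N (x : C) : cabs x <= 1 -> cabs (geo N x) <= N%:R.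
Proof.
move=> x1; apply: (le_trans (cabs_sum _ _ _)).
rewrite -[N in N%:R]card_ord -sumr_const; apply: ler_sum => i _.
exact: cabs_expr_le1.
Qed.

Lemma cabs_geo2 N (z w : C) : cabs z <= 1 -> cabs w <= 1 -> cabs (geo2 N z w) <= N%:R.
Proof.
move=> z1 w1; apply: (le_trans (cabs_sum _ _ _)).
rewrite -[N in N%:R]card_ord -sumr_const; apply: ler_sum => i _.
by rewrite cabsM mulr_ile1 ?cabs_ge0// cabs_expr_le1.
Qed.

(* Of size [N], but multiplied by [1 - x] or [z - w] it decays like [1 / N] once [N] exceeds
   the inverse of that factor. *)
Definition block (N : nat) (x z w : C) : C :=
  (N%:R ^+ 3)^-1 * z ^+ N * (geo N x ^+ 2 * geo2 N z w ^+ 2).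

Lemma formal_ext m phi psi beta gamma : (forall chi, small chi -> phi chi = psi chi) ->
  (forall chi, small chi -> beta chi <= gamma chi) ->
  formal_series m phi beta -> formal_series m psi gamma.
Proof.
move=> hp hb [a ha]; exists a; split; first exact: (proj1 ha).
move=> chi sc; have h := proj2 ha chi sc; split.
  by move=> N; apply: le_trans (proj1 h N) (hb _ sc).
by rewrite -hp//; exact: proj2 h.
Qed.

Lemma small_le1 chi : small chi -> [/\ cabs (chi 2) <= 1, cabs (chi 3) <= 1 & cabs (chi 5) <= 1].
Proof. by case=> _ _ h2 h3 h5; rewrite !ltW. Qed.

Lemma formal_geo N : formal_series 1 (fun chi => geo N (chi 2)) (fun=> N%:R).
Proof.
have h i := formal_weaken (@formal_mono R 1 (2 ^ i) ltac:(by rewrite expn_gt0)).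
apply: formal_ext (formal_sum N h) => chi sc.
  by apply: eq_bigr => i _; rewrite mul1r small_exp.
have [h2 _ _] := small_le1 sc.
rewrite -[N in N%:R]card_ord -sumr_const; apply: ler_sum => i _.
by rewrite cabs1 mul1r small_exp// cabs_expr_le1.
Qed.

Lemma formal_geo2 N : formal_series 1 (fun chi => geo2 N (chi 3) (chi 5)) (fun=> N%:R).
Proof.
have h i := formalM (formal_weaken (@formal_mono R 1 (3 ^ (N.-1 - i)) ltac:(by rewrite expn_gt0)))
  (formal_weaken (@formal_mono R 1 (5 ^ i) ltac:(by rewrite expn_gt0))).
apply: formal_ext (formal_sum N h) => chi sc.
  by apply: eq_bigr => i _; rewrite !mul1r !small_exp.
have [_ h3 h5] := small_le1 sc.
rewrite -[N in N%:R]card_ord -sumr_const; apply: ler_sum => i _.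
by rewrite cabs1 !mul1r !small_exp// mulr_ile1 ?cabs_ge0// cabs_expr_le1.
Qed.

Lemma formal_block N psi : formal_series 1 psi (fun=> 2) -> (0 < N)%N ->
  formal_series (3 ^ N) (fun chi => psi chi * block N (chi 2) (chi 3) (chi 5))
    (fun chi => 2 * (N%:R * cabs (chi 3) ^+ N)).
Proof.
move=> hpsi N0; have Nn : N%:R != 0 :> R by rewrite pnatr_eq0 -lt0n.
have h3N : (0 < 3 ^ N)%N by rewrite expn_gt0.
have h := formalM (formalM (@formal_mono R (N%:R ^+ 3)^-1 _ h3N)
  (formalM (formal_exp 2 (formal_geo N)) (formal_exp 2 (formal_geo2 N)))) hpsi.
apply: formal_ext h => chi sc; first by rewrite /block small_exp// mulrC.
rewrite small_exp// cabsX cabsV cabsX cabs_nat le_eqVlt; apply/orP; left; apply/eqP.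
by field.
Qed.

Lemma formal_f2 : formal_series 1 (fun chi => 1 - chi 2) (fun=> 2 : R).
Proof.
have h := formalD (formal1 R) (formal_weaken (@formal_mono R (-1) 2 isT)).
apply: formal_ext h => chi sc; first by rewrite mulN1r.
have [h2 _ _] := small_le1 sc; rewrite cabsN cabs1 mul1r; lra.
Qed.

Lemma formal_f1 : formal_series 1 (fun chi => chi 3 - chi 5) (fun=> 2 : R).
Proof.
have h := formalD (formal_weaken (@formal_mono R 1 3 isT))
  (formal_weaken (@formal_mono R (-1) 5 isT)).
apply: formal_ext h => chi sc; first by rewrite mulN1r mul1r.
have [_ h3 h5] := small_le1 sc; rewrite cabsN cabs1 !mul1r; lra.
Qed.

(** The left side is at most [min (y, 4 / y)], comparable to the increment of [y / (1 + y)] from [y]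
    to [K y]; along a progression of ratio [K] these increments telescope. The estimate for [y >= 1]
    asks for [8 (1 + K) <= 12 (K - 1)], which is [K >= 5]. *)
Lemma telescoping_bound (K y b : R) : 5 <= K -> 0 <= y -> 0 <= b <= 1 -> y * b <= 2 ->
  y * b ^+ 2 <= 12 * (K * y / (1 + K * y) - y / (1 + y)).
Proof.
move=> K5 y0 /andP[b0 b1] yb.
have Ky : 0 <= K * y by rewrite mulr_ge0//; lra.
have y1 : 0 < 1 + y by lra.
have y2 : 0 < 1 + K * y by lra.
rewrite (_ : K * y / (1 + K * y) - y / (1 + y) = (K - 1) * y / ((1 + y) * (1 + K * y)));
  last by field; rewrite !gt_eqF.
rewrite mulrA ler_pdivlMr ?mulr_gt0//.
have yb0 : 0 <= y * b ^+ 2 by rewrite mulr_ge0 ?sqr_ge0.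
have [ylt|yge] := leP y 1.
  have h1 : y * b ^+ 2 <= y by rewrite ler_piMr// exprn_ile1.
  have h2 : (1 + y) * (1 + K * y) <= 2 * (1 + K) by apply: ler_pM; nra.
  have h3 : y * b ^+ 2 * ((1 + y) * (1 + K * y)) <= y * (2 * (1 + K)).
    by apply: ler_pM h1 h2 => //; rewrite mulr_ge0// ltW.
  by apply: (le_trans h3); nra.
have h1 : y * (y * b ^+ 2) <= 4.
  rewrite (_ : y * _ = (y * b) * (y * b)); last by ring.
  have : 0 <= y * b by rewrite mulr_ge0.
  nra.
have h2 : (1 + y) * (1 + K * y) <= 2 * y * ((1 + K) * y) by apply: ler_pM; nra.
have h3 : y * b ^+ 2 * ((1 + y) * (1 + K * y)) <= y * b ^+ 2 * (2 * y * ((1 + K) * y)).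
  by apply: ler_wpM2l.
apply: (le_trans h3).
rewrite (_ : _ * (2 * y * _) = 2 * (1 + K) * y * (y * (y * b ^+ 2))); last by ring.
have h4 : 0 <= 2 * (1 + K) * y by rewrite !mulr_ge0//; lra.
by apply: (le_trans (ler_wpM2l h4 h1)); nra.
Qed.

Lemma block_bound N (K t g g' e : R) : 5 <= K -> (0 < N)%N -> 0 <= t -> 0 <= g <= N%:R ->
  0 <= g' <= N%:R -> 0 <= e <= 1 -> t * g <= 2 ->
  t * ((N%:R ^+ 3)^-1 * e * (g ^+ 2 * g' ^+ 2)) <=
  12 * (K * (N%:R * t) / (1 + K * (N%:R * t)) - N%:R * t / (1 + N%:R * t)).
Proof.
move=> K5 N0 t0 /andP[g0 gN] /andP[g'0 g'N] /andP[e0 e1] tg.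
have Np : 0 < N%:R :> R by rewrite ltr0n.
have Nn : N%:R != 0 :> R by rewrite gt_eqF.
(* Here [y = N t] and [b = g / N]; the second factor [g'] is estimated trivially by [N]. *)
apply: (@le_trans _ _ (N%:R * t * (g / N%:R) ^+ 2)); last first.
  apply: telescoping_bound => //; first by rewrite mulr_ge0// ltW.
    by rewrite divr_ge0 ?(ltW Np)//= ler_pdivrMr// mul1r.
  by rewrite (_ : _ * (g / _) = t * g)//; field.
apply: (@le_trans _ _ (t * ((N%:R ^+ 3)^-1 * 1 * (g ^+ 2 * N%:R ^+ 2)))); last first.
  by rewrite le_eqVlt; apply/orP; left; apply/eqP; field.
have c0 : 0 <= (N%:R ^+ 3)^-1 :> R by rewrite invr_ge0 exprn_ge0// ltW.
apply: ler_wpM2l => //; apply: ler_pM.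
- exact: mulr_ge0.
- by rewrite mulr_ge0// sqr_ge0.
- exact: ler_wpM2l.
- by apply: ler_wpM2l; [exact: sqr_ge0|rewrite lerXn2r// nnegrE ltW].
Qed.

(** The ratio [64] exceeds the [5] of [telescoping_bound] and is large enough for the other blocks
    to be negligible at the radius attached to one of them. *)
Definition lac (j : nat) : nat := (64 ^ j.+1)%N.

Lemma lac_gt0 j : (0 < lac j)%N.
Proof. by rewrite expn_gt0. Qed.

Lemma lacS j : (lac j.+1)%:R = 64 * (lac j)%:R :> R.
Proof. by rewrite /lac expnS natrM. Qed.

Lemma block_sum_bound (p : pred nat) (t : R) (u : nat -> C) : 0 <= t ->
  (forall j, cabs (u j) <=
     12 * (64 * ((lac j)%:R * t) / (1 + 64 * ((lac j)%:R * t))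
            - (lac j)%:R * t / (1 + (lac j)%:R * t))) ->
  forall J, cabs (\sum_(0 <= j < J) (if p j then u j else 0)) <= 12.
Proof.
move=> t0 hu J; pose psi j := (lac j)%:R * t / (1 + (lac j)%:R * t).
have psi01 j : 0 <= psi j <= 1.
  have h : 0 <= (lac j)%:R * t by rewrite mulr_ge0.
  rewrite /psi; apply/andP; split; first by rewrite divr_ge0// addr_ge0.
  by rewrite ler_pdivrMr ?mul1r ?lerDr// ltr_pwDl.
apply: (@le_trans _ _ (12 * (psi J - psi 0%N))); last first.
  by have /andP[a1 a2] := psi01 J; have /andP[b1 b2] := psi01 0%N; lra.
elim: J => [|J ih]; first by rewrite big_geq// cabs0 subrr mulr0.
rewrite big_nat_recr//= (le_trans (cabsD _ _))//.
have h : cabs (if p J then u J else 0) <= 12 * (psi J.+1 - psi J).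
  have h := hu J; rewrite mulrA -lacS -/(psi J) in h.
  by case: (p J) => //; rewrite cabs0; exact: le_trans (cabs_ge0 _) h.
by lra.
Qed.

Lemma lac_series_bounded (r : R) : 0 <= r < 1 -> exists B, forall J,
  \sum_(0 <= j < J) 2 * ((lac j)%:R * r ^+ lac j) <= B.
Proof.
(* Since [1 + d = 2 / (1 + r)], one has [r (1 + d) <= 1], and Bernoulli gives [r^m <= 1 / (m d)].
   Applied twice with [lac j = 2 m], this absorbs the factor [lac j] and leaves [1 / m]. *)
move=> /andP[r0 r1]; pose d := 2 / (1 + r) - 1.
have r1' : 0 < 1 + r by lra.
have d0 : 0 < d by rewrite subr_gt0 ltr_pdivlMr// mul1r; lra.
have rd : r * (1 + d) <= 1 by rewrite /d addrC subrK mulrA ler_pdivrMr//; lra.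
have bern k : k%:R * d <= (1 + d) ^+ k.
  by apply: le_trans (bernoulli k (ltW d0)); rewrite lerDr.
have key j : (lac j)%:R * r ^+ lac j <= 4 / d ^+ 2 * ((2 : R)^-1) ^+ j.+1.
  pose m := (32 * 64 ^ j)%N.
  have Nm : lac j = (m + m)%N by rewrite addnn -mul2n /m /lac expnS mulnA.
  have m0 : 0 < m%:R :> R by rewrite ltr0n muln_gt0 expn_gt0.
  have h1 : r ^+ m * (m%:R * d) <= 1.
    apply: (@le_trans _ _ (r ^+ m * (1 + d) ^+ m)); first by rewrite ler_wpM2l ?exprn_ge0.
    by rewrite -exprMn exprn_ile1// mulr_ge0//; lra.
  have md0 : 0 < m%:R * d by rewrite mulr_gt0.
  have h2 : r ^+ m <= (m%:R * d)^-1 by rewrite -[leRHS]mul1r ler_pdivlMr.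
  have h3 : r ^+ lac j <= (m%:R * d)^-1 * (m%:R * d)^-1.
    by rewrite Nm exprD ler_pM ?exprn_ge0.
  have h4 : (lac j)%:R * r ^+ lac j <= (lac j)%:R * ((m%:R * d)^-1 * (m%:R * d)^-1).
    by rewrite ler_wpM2l.
  apply: (le_trans h4); rewrite Nm natrD.
  rewrite (_ : _ * _ = 2 / d ^+ 2 * m%:R^-1); last first.
    by field; rewrite !gt_eqF.
  have h5 : m%:R^-1 <= ((2 : R)^-1) ^+ j.+1.
    rewrite exprVn lef_pV2 ?posrE ?exprn_gt0// -natrX ler_nat /m.
    rewrite expnS leq_mul//; elim: (j) => // k ih; rewrite !expnS leq_mul//.
  apply: ler_pM h5; first by rewrite divr_ge0// sqr_ge0.
    by rewrite invr_ge0 ltW.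
  by apply: ler_wpM2r; [rewrite invr_ge0 sqr_ge0|lra].
exists (8 / d ^+ 2) => J.
have c0 : 0 <= 4 / d ^+ 2 by rewrite divr_ge0// sqr_ge0.
apply: (@le_trans _ _ (2 * (4 / d ^+ 2) * (1 - (2 : R)^-1 ^+ J))).
  elim: J => [|J ih]; first by rewrite big_geq// expr0 subrr mulr0.
  have := key J; rewrite big_nat_recr//= ![2^-1 ^+ J.+1]exprS.
  move: (4 / d ^+ 2) (2^-1 ^+ J) ih => c q ih h; nra.
rewrite (_ : 8 / _ = 2 * (4 / d ^+ 2)); last by rewrite mulrA -natrM.
apply: ler_piMr; first exact: mulr_ge0.
by rewrite gerBl exprn_ge0// invr_ge0.
Qed.

Definition lac_term (chi : nat -> C) j : C := block (lac j) (chi 2) (chi 3) (chi 5).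

Lemma lacunary_formal (p : pred nat) psi : formal_series 1 psi (fun=> 2) ->
  exists Phi gamma, formal_series 1 Phi gamma /\ forall chi, small chi ->
    (fun J => \sum_(0 <= j < J) (if p j then psi chi * lac_term chi j else 0))
      @ \oo --> Phi chi.
Proof.
move=> hpsi; apply: (@formal_limit R (fun j => (3 ^ lac j)%N)
   (fun j chi => if p j then psi chi * lac_term chi j else 0)
   (fun j chi => 2 * ((lac j)%:R * cabs (chi 3) ^+ lac j))).
- move=> j; apply: (@leq_trans j.+1) => //.
  apply: (leq_trans (ltnW (ltn_expl j.+1 (isT : 1 < 3)%N))).
  rewrite leq_exp2l// /lac; apply: ltnW; exact: ltn_expl.
- move=> j; case: (p j); first exact: formal_block (lac_gt0 j).
  exists (fun=> 0); split=> // chi sc; split.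
    move=> N; rewrite big1 => [|i _]; last by rewrite mul0r cabs0.
    by rewrite !mulr_ge0// exprn_ge0// cabs_ge0.
  by apply: cvg_near_cst; exists 0%N => // N _; rewrite big1// => i _; rewrite mul0r.
- by move=> chi sc; apply: lac_series_bounded; rewrite cabs_ge0 (small3 sc).
Qed.

Lemma cvg_sum_bound (u : nat -> C) l (D : R) : u @ \oo --> l ->
  (forall J, cabs (u J) <= D) -> cabs l <= D.
Proof.
move=> hu hD; rewrite -[l]subr0; apply: (cvgn_cabs_le (N0 := 0%N) hu) => N _.
by rewrite subr0.
Qed.

(** The same blocks are multiplied by [1 - x] for [h] and by [z - w] for [h'], so the crossed
    products agree term by term. Selecting indices by [p] does not hurt the bound [12], as it is the
    moduli of the terms that are telescoped. *)
Lemma lacunary_elements (p : pred nat) : exists h h' : Hinf R,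
  (forall s, h s * (nat_inv_pow s 3 - nat_inv_pow s 5) = h' s * (1 - nat_inv_pow s 2)) /\
  (forall chi S, character chi S -> small chi ->
    (fun J => \sum_(0 <= j < J) (if p j then (1 - chi 2) * lac_term chi j else 0))
      @ \oo --> ev chi h).
Proof.
have [Phi [gamma [hP limP]]] := lacunary_formal p formal_f2.
have [Phi' [gamma' [hP' limP']]] := lacunary_formal p formal_f1.
have tg (t g : C) (e : nat) : cabs t <= 1 -> cabs g <= 1 -> cabs (t ^+ e - g ^+ e) <= 2.
  move=> t1 g1; apply: (le_trans (cabsB _ _)).
  have := cabs_expr_le1 e t1; have := cabs_expr_le1 e g1; lra.
have abs_block N (x z w : C) : (0 < N)%N -> cabs (block N x z w) =
    (N%:R ^+ 3)^-1 * cabs z ^+ N * (cabs (geo N x) ^+ 2 * cabs (geo2 N z w) ^+ 2).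
  by move=> N0; rewrite /block !cabsM cabsV !cabsX cabs_nat.
have [|F [F1 F2]] := @formal_element R _ _ _ 12 hP.
  move=> s; have sc := small_nat_inv_pow s; have [h2 h3 h5] := small_le1 sc.
  apply: (cvg_sum_bound (limP _ sc)).
  apply: (@block_sum_bound p (cabs (1 - nat_inv_pow s 2))); first exact: cabs_ge0.
  move=> j; rewrite cabsM abs_block ?lac_gt0//.
  apply: block_bound; [lra|exact: lac_gt0|exact: cabs_ge0| | | |].
  - by rewrite cabs_ge0 cabs_geo.
  - by rewrite cabs_ge0 cabs_geo2.
  - by rewrite -cabsX cabs_ge0 cabs_expr_le1.
  by rewrite -cabsM geo_id; have := tg 1 _ (lac j) _ h2; rewrite expr1n; apply; rewrite cabs1.
have [|F' [F1' F2']] := @formal_element R _ _ _ 12 hP'.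
  move=> s; have sc := small_nat_inv_pow s; have [h2 h3 h5] := small_le1 sc.
  apply: (cvg_sum_bound (limP' _ sc)).
  apply: (@block_sum_bound p (cabs (nat_inv_pow s 3 - nat_inv_pow s 5))); first exact: cabs_ge0.
  move=> j; rewrite cabsM abs_block ?lac_gt0//.
  (* The roles are exchanged: [z - w] now tames [geo2], and [geo] is the factor bounded by [N]. *)
  rewrite [cabs (geo _ _) ^+ 2 * _]mulrC.
  apply: block_bound; [lra|exact: lac_gt0|exact: cabs_ge0| | | |].
  - by rewrite cabs_ge0 cabs_geo2.
  - by rewrite cabs_ge0 cabs_geo.
  - by rewrite -cabsX cabs_ge0 cabs_expr_le1.
  by rewrite -cabsM geo2_id; exact: tg.
exists F, F'; split; last by move=> chi S hchi sc; rewrite (F2 _ _ hchi sc); exact: limP.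
move=> s; have sc := small_nat_inv_pow s; rewrite F1 F1'.
set chi := nat_inv_pow s.
have l1 : (fun J => (\sum_(0 <= j < J) (if p j then (1 - chi 2) * lac_term chi j else 0))
    * (chi 3 - chi 5)) @ \oo --> Phi chi * (chi 3 - chi 5).
  exact: (cvgM (limP _ sc) (cvg_cst _)).
have l2 : (fun J => (\sum_(0 <= j < J) (if p j then (chi 3 - chi 5) * lac_term chi j else 0))
    * (1 - chi 2)) @ \oo --> Phi' chi * (1 - chi 2).
  exact: (cvgM (limP' _ sc) (cvg_cst _)).
have E : (fun J => (\sum_(0 <= j < J) (if p j then (1 - chi 2) * lac_term chi j else 0))
    * (chi 3 - chi 5)) =
  (fun J => (\sum_(0 <= j < J) (if p j then (chi 3 - chi 5) * lac_term chi j else 0))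
    * (1 - chi 2)).
  apply/funext => J; rewrite !mulr_suml; apply: eq_bigr => j _.
  by case: (p j); rewrite ?mul0r//; ring.
by rewrite E in l1; apply: (cvg_unique _ l1 l2); exact: norm_hausdorff.
Qed.

Lemma mono_element n : (0 < n)%N -> exists F : Hinf R,
  (forall s, F s = nat_inv_pow s n) /\
  forall chi S, character chi S -> small chi -> ev chi F = chi n.
Proof.
move=> n0; have h := @formal_mono R 1 n n0.
have [|F [F1 F2]] := @formal_element R _ _ _ 1 h.
  move=> s; rewrite mul1r cabs_nat_inv_pow -[leRHS]expR0 ler_expR mulNr oppr_le0.
  by rewrite mulr_ge0 ?ln_ge0 ?ler1n// ltW//; exact: (valP s).
exists F; split; first by move=> s; rewrite F1 mul1r.
by move=> chi S hchi sc; rewrite (F2 _ _ hchi sc) mul1r.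
Qed.

End LacunaryElements.

(** * Near constancy of bounded Dirichlet series *)

Section SmoothCharacters.
Variable R : realType.
Local Notation C := R[i].
Implicit Types (X z w : C) (n : nat).

Definition pi235 : nat_pred := [pred p | p \in [:: 2; 3; 5]].

Definition chr X z w n : C :=
  if pi235.-nat n then X ^+ logn 2 n * z ^+ logn 3 n * w ^+ logn 5 n else 0.

Lemma chrM X z w : completely_multiplicative (chr X z w).
Proof.
move=> i j i0 j0; rewrite /chr pnatM; case: ifP => [/andP[-> ->]|].
  by rewrite !lognM// !exprD; ring.
by case: ifP => _; case: ifP => _; rewrite ?mulr0 ?mul0r.
Qed.

Lemma chr1 X z w : chr X z w 1 = 1.
Proof. by rewrite /chr !logn1 !expr0 !mulr1. Qed.

Lemma chr2 X z w : chr X z w 2 = X.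
Proof. by rewrite /chr pnatE// !logn_prime// expr0 expr1 !mulr1. Qed.

Lemma chr3 X z w : chr X z w 3 = z.
Proof. by rewrite /chr pnatE// !logn_prime// !expr0 expr1 mulr1 mul1r. Qed.

Lemma chr5 X z w : chr X z w 5 = w.
Proof. by rewrite /chr pnatE// !logn_prime// !expr0 expr1 !mul1r. Qed.

Lemma pi235_nat_decomp n : (0 < n)%N -> pi235.-nat n ->
  n = (2 ^ logn 2 n * 3 ^ logn 3 n * 5 ^ logn 5 n)%N.
Proof.
move=> n0 pn; apply: eqn_from_log => //; first by rewrite !muln_gt0 !expn_gt0.
move=> p; rewrite !lognM ?muln_gt0 ?expn_gt0// !lognX.
have [pp|np] := boolP (prime p); last by rewrite /logn (negPf np) !muln0.
have l2 : logn p 2 = (p == 2%N) by rewrite logn_prime.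
have l3 : logn p 3 = (p == 3%N) by rewrite logn_prime.
have l5 : logn p 5 = (p == 5%N) by rewrite logn_prime.
rewrite l2 l3 l5.
have [->|p2] := eqVneq p 2%N; first by rewrite muln1 !muln0 !addn0.
have [->|p3] := eqVneq p 3%N; first by rewrite muln1 !muln0 !addn0.
have [->|p5] := eqVneq p 5%N; first by rewrite muln1 !muln0.
rewrite !muln0 lognE pp n0/=; case: ifP => // pdn.
have := elimT (pnatP pi235 n0) pn p pp pdn.
by rewrite !inE (negPf p2) (negPf p3) (negPf p5).
Qed.

Lemma geometric_le (x : R) N : 0 <= x < 1 -> \sum_(0 <= i < N) x ^+ i <= (1 - x)^-1.
Proof.
move=> /andP[x0 x1]; have x1' : 0 < 1 - x by lra.
rewrite -[leRHS]mul1r ler_pdivlMr// mulrC big_mkord.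
by rewrite -opprB mulNr -subrX1 opprB gerBl exprn_ge0.
Qed.

Lemma logn_lt p n N : (0 < n < N)%N -> (logn p n < N)%N.
Proof. by move=> /andP[n0 nN]; exact: ltn_trans (ltn_logl p n0) nN. Qed.

(** Unique factorization sends the [n < N] in the support injectively to exponent triples below [N];
    the sum over all triples is a product of three geometric sums. *)
Lemma chr_summable X z w : cabs X < 1 -> cabs z < 1 -> cabs w < 1 ->
  exists S, summable (chr X z w) S.
Proof.
move=> X1 z1 w1; pose t (l a b : nat) := cabs X ^+ l * cabs z ^+ a * cabs w ^+ b.
have t0 l a b : 0 <= t l a b by rewrite !mulr_ge0// exprn_ge0// cabs_ge0.
exists ((1 - cabs X)^-1 * (1 - cabs z)^-1 * (1 - cabs w)^-1) => N.
apply: (@le_trans _ _ (\sum_(1 <= n < N) \sum_(0 <= l < N) \sum_(0 <= a < N)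
    \sum_(0 <= b < N) (if (2 ^ l * 3 ^ a * 5 ^ b)%N == n then t l a b else 0))).
  rewrite big_nat_cond [leRHS]big_nat_cond; apply: ler_sum => n /andP[nN _].
  have sum0 (F : nat -> R) : (forall i, 0 <= F i) -> 0 <= \sum_(0 <= i < N) F i.
    by move=> h; exact: sumr_ge0.
  have if0 l a b : 0 <= (if (2 ^ l * 3 ^ a * 5 ^ b)%N == n then t l a b else 0).
    by case: ifP.
  have one (F : nat -> R) i : (i < N)%N -> (forall i, 0 <= F i) -> F i <= \sum_(0 <= i < N) F i.
    move=> iN h; rewrite (bigD1_seq i)/= ?mem_index_iota ?iota_uniq//.
    by rewrite lerDl sumr_ge0.
  rewrite /chr; case: ifP => pn; last first.
    by rewrite cabs0; do 3 (apply: (sum0) => ?).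
  apply: le_trans (one _ (logn 2 n) (logn_lt 2 nN) _); last first.
    by move=> l; do 2 (apply: (sum0) => ?).
  apply: le_trans (one _ (logn 3 n) (logn_lt 3 nN) _); last first.
    by move=> a; apply: (sum0) => ?.
  apply: le_trans (one _ (logn 5 n) (logn_lt 5 nN) _) => //.
  move/andP: nN => [n0 _].
  by rewrite -pi235_nat_decomp// eqxx /t !cabsM !cabsX.
rewrite exchange_big/=.
apply: (@le_trans _ _ (\sum_(0 <= l < N) \sum_(0 <= a < N) \sum_(0 <= b < N) t l a b)).
  apply: ler_sum => l _; rewrite exchange_big/=; apply: ler_sum => a _.
  rewrite exchange_big/=; apply: ler_sum => b _.
  set k := (_ * _)%N; have [kN|kN] := boolP (k \in index_iota 1 N).
    rewrite (bigD1_seq k)/= ?iota_uniq// eqxx big1 ?addr0// => i /negPf.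
    by rewrite eq_sym => ->.
  rewrite big_seq big1// => i iN; case: eqP => // ki.
  by rewrite ki iN in kN.
have -> : \sum_(0 <= l < N) \sum_(0 <= a < N) \sum_(0 <= b < N) t l a b =
    (\sum_(0 <= l < N) cabs X ^+ l) * (\sum_(0 <= a < N) cabs z ^+ a)
     * (\sum_(0 <= b < N) cabs w ^+ b).
  rewrite 2!mulr_suml; apply: eq_bigr => l _.
  rewrite [cabs X ^+ l * _]mulr_sumr [RHS]mulr_suml.
  by apply: eq_bigr => a _; rewrite mulr_sumr.
have s0 (x : R) : 0 <= x -> 0 <= \sum_(0 <= l < N) x ^+ l.
  by move=> x0; apply: sumr_ge0 => i _; exact: exprn_ge0.
apply: ler_pM; rewrite ?mulr_ge0 ?s0 ?cabs_ge0//; last by rewrite geometric_le ?cabs_ge0.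
by apply: ler_pM; rewrite ?s0 ?cabs_ge0 ?geometric_le ?cabs_ge0.
Qed.

Lemma chr_character X z w : cabs X < 1 -> cabs z < 1 -> cabs w < 1 ->
  exists S, character (chr X z w) S.
Proof.
move=> X1 z1 w1; have [S hS] := chr_summable X1 z1 w1.
by exists S; split; [exact: chrM|exact: chr1|].
Qed.

Lemma chr_small X z w : cabs X < 1 -> cabs z < 1 -> cabs w < 1 -> small (chr X z w).
Proof.
by move=> X1 z1 w1; split; rewrite ?chr2 ?chr3 ?chr5//; [exact: chrM|exact: chr1].
Qed.

Lemma cabs_chr_le X X' z z' w w' n : cabs X <= cabs X' -> cabs z <= cabs z' ->
  cabs w <= cabs w' -> cabs (chr X z w n) <= cabs (chr X' z' w' n).
Proof.
move=> hX hz hw; rewrite /chr; case: ifP => // _; rewrite !cabsM !cabsX.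
have h (x y : R) k : 0 <= x -> x <= y -> 0 <= x ^+ k /\ x ^+ k <= y ^+ k.
  by move=> x0 xy; rewrite exprn_ge0// lerXn2r// nnegrE (le_trans x0).
have [a1 a2] := h _ _ (logn 2 n) (cabs_ge0 X) hX.
have [b1 b2] := h _ _ (logn 3 n) (cabs_ge0 z) hz.
have [c1 c2] := h _ _ (logn 5 n) (cabs_ge0 w) hw.
by apply: ler_pM => //; [exact: mulr_ge0|exact: ler_pM].
Qed.

Lemma conj_exp (z : C) m : Num.conj (z ^+ m) = Num.conj z ^+ m.
Proof. exact: rmorphXn. Qed.

(** Discrete orthogonality stands in for integration over the circle; it is exact for polynomials of
    degree below [L], which suffices after truncation. *)
Lemma roots_of_unity (L : nat) : (0 < L)%N -> exists2 omega : C, cabs omega = 1 &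
  forall m m', (m < L)%N -> (m' < L)%N ->
    \sum_(k < L) (omega ^+ k) ^+ m * Num.conj ((omega ^+ k) ^+ m') = if m == m' then L%:R else 0.
Proof.
move=> L0; pose th : R := pi *+ 2 / L%:R; pose omega : C := cexp (th *i).
have Lp : 0 < L%:R :> R by rewrite ltr0n.
have om k : omega ^+ k = cexp ((k%:R * th) *i).
  elim: k => [|k ih]; first by rewrite expr0 mul0r -cexp0; congr cexp.
  rewrite exprS ih -cexpD; congr cexp; rewrite -natr1; apply/eqP.
  by rewrite eq_complex/= addr0 eqxx/=; apply/eqP; ring.
have cabs1o : cabs omega = 1 by rewrite cabs_cexp /= expR0.
have oL : omega ^+ L = 1.
  rewrite om /th mulrCA divff ?gt_eqF// mulr1 /cexp /= expR0 !mul1r.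
  by rewrite cos2pi sin2pi.
have o0 : omega != 0 by rewrite -cabs_gt0 cabs1o.
have oV : Num.conj omega = omega^-1.
  apply: (mulfI o0); rewrite divff// -cabs_sqrC cabs1o expr1n//.
(* If [omega^d = 1], then [cos (2 a) = 1] and hence [sin a = 0] for [a = d pi / L], which lies
   strictly between [0] and [pi]. *)
have oprim d : (0 < d < L)%N -> omega ^+ d != 1.
  move=> /andP[d0 dL]; rewrite om; apply/eqP => /(congr1 (fun z : C => complex.Re z)).
  rewrite /cexp/= expR0 mul1r (_ : d%:R * th = (d%:R * pi / L%:R) *+ 2); last first.
    by rewrite /th mulrA mulrnAr mulrnAl.
  rewrite mulr2n cosD -!expr2 => h.
  have := cos2Dsin2 (d%:R * pi / L%:R : R).
  have : 0 < sin (d%:R * pi / L%:R : R).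
    apply: sin_gt0_pi; apply/andP; split.
      by rewrite !mulr_gt0 ?invr_gt0 ?ltr0n ?pi_gt0.
    by rewrite ltr_pdivrMr// mulrC ltr_pM2l ?pi_gt0// ltr_nat.
  nra.
exists omega => // m m' mL m'L.
have step k : (omega ^+ k) ^+ m * Num.conj ((omega ^+ k) ^+ m') = (omega ^+ m / omega ^+ m') ^+ k.
  by rewrite !conj_exp oV -!exprM expr_div_n -!exprM exprVn mulnC [(k * m')%N]mulnC.
rewrite (eq_bigr (fun k : 'I_L => (omega ^+ m / omega ^+ m') ^+ k)) => [|k _]; last exact: step.
have [->|mm'] := eqVneq m m'.
  rewrite divff ?expf_neq0// (eq_bigr (fun=> 1)) => [|k _]; last by rewrite expr1n.
  by rewrite sumr_const card_ord.
set q := _ / _; have q1 : q != 1.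
  apply/eqP => hq; have e : omega ^+ m = omega ^+ m'.
    by move: hq; rewrite /q => /(canRL (divfK (expf_neq0 m' o0))); rewrite mul1r.
  have key i j : (i < j)%N -> (j < L)%N -> omega ^+ i = omega ^+ j -> False.
    move=> ij jL eij; have := oprim (j - i)%N; rewrite subn_gt0 ij/= => /(_ (leq_ltn_trans (leq_subr _ _) jL))/eqP; apply.
    apply: (mulfI (expf_neq0 i o0)); rewrite -exprD subnKC 1?ltnW// mulr1.
    by rewrite eij.
  by case: (ltngtP m m') mm' => // h _; [exact: key h m'L e|exact: key h mL (esym e)].
have qL : q ^+ L = 1 by rewrite /q expr_div_n -!exprM ![(_ * L)%N]mulnC !exprM oL !expr1n divr1.
apply: (mulfI (_ : q - 1 != 0)); first by rewrite subr_eq0.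
by rewrite mulr0 -subrX1 qL subrr.
Qed.

End SmoothCharacters.

(** * Mean values and energy over circles *)

Section Averages.
Variable R : realType.
Local Notation C := R[i].
Implicit Types (X z w zeta omega : C) (n m k L : nat) (g : Hinf R).

Definition orthogonal_root L omega : Prop :=
  forall m m', (m < L)%N -> (m' < L)%N ->
    \sum_(k < L) (omega ^+ k) ^+ m * Num.conj ((omega ^+ k) ^+ m') =
      if m == m' then L%:R else 0.

(** [N] is chosen at the largest moduli; as [|chr|] is monotone in the moduli, it serves all smaller
    [z] and [w] uniformly. *)
Lemma ev_truncation g X z0 w0 (e : R) : cabs X < 1 -> cabs z0 < 1 -> cabs w0 < 1 ->
  0 < e -> exists2 N, (0 < N)%N & forall z w, cabs z <= cabs z0 -> cabs w <= cabs w0 ->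
    cabs (ev (chr X z w) g - \sum_(1 <= n < N) coef g n * chr X z w n) <= e.
Proof.
move=> X1 z01 w01 e0; have [S hS] := chr_character X1 z01 w01.
have [B hB] := exists_bound g.
have [N0 hN] := summable_tail (ev_summable hS hB) e0.
exists (maxn 1 N0); first by rewrite leq_max.
move=> z w hz hw.
have [S' hS'] := chr_character X1 (le_lt_trans hz z01) (le_lt_trans hw w01).
apply: (has_sum_tail (@ev_has_sum R _ _ hS' g)); first by rewrite leq_max.
move=> N; apply: le_trans (hN (maxn 1 N0) N (leq_maxr _ _)).
apply: ler_sum => n _; rewrite !cabsM ler_wpM2l ?cabs_ge0//.
exact: cabs_chr_le.
Qed.

Lemma sum_root_powers L omega i : orthogonal_root L omega -> (i < L)%N ->
  \sum_(k < L) (omega ^+ k) ^+ i = if i == 0%N then L%:R else 0.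
Proof.
move=> ho iL; rewrite -(ho i 0%N iL (leq_ltn_trans (leq0n _) iL)).
by apply: eq_bigr => k _; rewrite expr0 conjC1 mulr1.
Qed.

Lemma mean_binomial L omega z (d : C) b : orthogonal_root L omega -> (b < L)%N ->
  \sum_(k < L) (z + d * omega ^+ k) ^+ b = L%:R * z ^+ b.
Proof.
move=> ho bL.
rewrite (eq_bigr (fun k : 'I_L => \sum_(i < b.+1)
    (z ^+ (b - i) * d ^+ i *+ 'C(b, i)) * (omega ^+ k) ^+ i)); last first.
  move=> k _; rewrite exprDn; apply: eq_bigr => i _.
  by rewrite exprMn mulrA mulrnAl.
rewrite exchange_big/= big_ord_recl/= subn0 expr0 mulr1 bin0 mulr1n.
rewrite -mulr_sumr (sum_root_powers ho (leq_ltn_trans (leq0n _) bL)) eqxx.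
rewrite big1 ?addr0 1?mulrC// => i _; rewrite -mulr_sumr (sum_root_powers ho).
  by rewrite mulr0.
by rewrite /bump/= add1n; apply: leq_ltn_trans bL; exact: ltn_ord.
Qed.

Lemma cabs_root L omega k : cabs omega = 1 -> cabs (omega ^+ k) = 1.
Proof. by move=> h; rewrite cabsX h expr1n. Qed.

(** Mean value property in the last variable. The truncated series is a polynomial in [w] of degree
    below [N], and its average over [N] equally spaced points of the circle around [z] is its value
    at [z]. *)
Lemma circle_mean g X z (d M : R) : cabs X < 1 -> 0 <= d -> cabs z + d < 1 ->
  (forall zeta, cabs zeta = 1 -> cabs (ev (chr X z (z + d%:C * zeta)) g) <= M) ->
  cabs (ev (chr X z z) g) <= M.
Proof.
move=> X1 d0 zd hM; apply/ler_addgt0Pr => e e0.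
have e20 : 0 < e / 2 by rewrite divr_gt0.
pose r : C := (cabs z + d)%:C.
have rE : cabs r = cabs z + d by rewrite cabs_real ger0_norm// addr_ge0// cabs_ge0.
have r1 : cabs r < 1 by rewrite rE.
have z1 : cabs z < 1 by apply: le_lt_trans zd; rewrite lerDl.
have [N N0 hN] := ev_truncation g X1 z1 r1 e20.
have [omega om1 ho] := @roots_of_unity R N N0.
pose W k := z + d%:C * omega ^+ k.
pose T w := \sum_(1 <= n < N) coef g n * chr X z w n.
have hW k : cabs (W k) <= cabs r.
  rewrite rE (le_trans (cabsD _ _))// lerD2l cabsM (cabs_root N _ om1) mulr1.
  by rewrite cabs_real ger0_norm.
have hT w : cabs w <= cabs r -> cabs (ev (chr X z w) g - T w) <= e / 2.
  by move=> hw; exact: hN.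
have sumT : \sum_(k < N) T (W k) = N%:R * T z.
  rewrite exchange_big/= /T mulr_sumr big_nat_cond [RHS]big_nat_cond.
  apply: eq_bigr => n /andP[nN _]; rewrite -mulr_sumr mulrCA; congr (_ * _).
  rewrite /chr; case: ifP => _; last by rewrite big1// mulr0.
  by rewrite -mulr_sumr (mean_binomial z _ ho (logn_lt 5 nN)) mulrCA.
have Np : 0 < N%:R :> R by rewrite ltr0n.
have hz : cabs z <= cabs r by rewrite rE lerDl.
rewrite -(ler_pM2l Np).
have -> : N%:R * cabs (ev (chr X z z) g) = cabs (N%:R * ev (chr X z z) g).
  by rewrite cabsM cabs_nat.
have -> : N%:R * ev (chr X z z) g = N%:R * (ev (chr X z z) g - T z) -
    \sum_(k < N) (ev (chr X z (W k)) g - T (W k)) + \sum_(k < N) ev (chr X z (W k)) g.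
  by rewrite sumrB sumT; ring.
have b1 : cabs (N%:R * (ev (chr X z z) g - T z)) <= N%:R * (e / 2).
  by rewrite cabsM cabs_nat ler_wpM2l// hT.
have cst (x : R) : \sum_(k < N) x = N%:R * x by rewrite sumr_const card_ord mulr_natl.
have b2 : cabs (\sum_(k < N) (ev (chr X z (W k)) g - T (W k))) <= N%:R * (e / 2).
  by rewrite -cst (le_trans (cabs_sum _ _ _))// ler_sum// => k _; exact: hT.
have b3 : cabs (\sum_(k < N) ev (chr X z (W k)) g) <= N%:R * M.
  rewrite -cst (le_trans (cabs_sum _ _ _))// ler_sum// => k _; apply: hM.
  exact: (cabs_root N).
apply: (le_trans (cabsD _ _)); apply: (le_trans (lerD (cabsB _ _) (lexx _))).
lra.
Qed.

Lemma parseval L omega (y : nat -> C) : orthogonal_root L omega ->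
  \sum_(k < L) cabs (\sum_(m < L) y m * (omega ^+ k) ^+ m) ^+ 2 =
  L%:R * \sum_(m < L) cabs (y m) ^+ 2.
Proof.
move=> ho; apply: (@complexI R).
rewrite rmorph_sum rmorphM rmorph_sum/= (rmorph_nat (real_complex R)).
rewrite (eq_bigr (fun k : 'I_L => \sum_(m < L) \sum_(m' < L) (y m * Num.conj (y m')) *
    ((omega ^+ k) ^+ m * Num.conj ((omega ^+ k) ^+ m')))); last first.
  move=> k _; rewrite cabs_sqrC rmorph_sum big_distrlr/=.
  apply: eq_bigr => m _; apply: eq_bigr => m' _.
  by rewrite [Num.conj (y m' * _)]rmorphM/=; ring.
rewrite exchange_big/= mulr_sumr; apply: eq_bigr => m _.
rewrite exchange_big/= (bigD1 m)//= -mulr_sumr ho// eqxx cabs_sqrC.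
rewrite big1 ?addr0 1?mulrC// => m' mm'; rewrite -mulr_sumr ho//.
by rewrite [_ == _](_ : _ = false) ?mulr0//; apply/negbTE; rewrite eq_sym.
Qed.

Lemma regroup_by_degree (N L : nat) (x : nat -> C) (d : nat -> nat) zeta :
  (forall n, (n < N)%N -> (d n < L)%N) ->
  \sum_(1 <= n < N) x n * zeta ^+ d n =
  \sum_(m < L) (\sum_(1 <= n < N | d n == m) x n) * zeta ^+ m.
Proof.
move=> hd; rewrite (eq_bigr (fun m : 'I_L =>
    \sum_(1 <= n < N) (if d n == m then x n * zeta ^+ m else 0))); last first.
  by move=> m _; rewrite mulr_suml big_mkcond.
rewrite exchange_big/= big_nat_cond [RHS]big_nat_cond; apply: eq_bigr => n /andP[/andP[_ nN] _].
rewrite (bigD1 (Ordinal (hd n nN)))//= eqxx big1 ?addr0// => m.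
by rewrite -val_eqE/= eq_sym => /negPf ->.
Qed.

Lemma sum_sqr_increments (I : nat) (x : nat -> R) : (forall i, (i < I)%N -> 0 <= x i <= x i.+1) ->
  0 <= x I -> \sum_(i < I) (x i.+1 - x i) ^+ 2 <= x I ^+ 2.
Proof.
elim: I => [|I ih] hx xI; first by rewrite big_ord0 sqr_ge0.
have /andP[x0 x1] := hx I (ltnSn I).
rewrite big_ord_recr/=; have := ih (fun i iI => hx i (ltnW iI)) x0; nra.
Qed.

Lemma sqr_increment_approx (u v a b : C) (eta : R) : cabs (u - a) <= eta ->
  cabs (v - b) <= eta -> cabs (u - v) ^+ 2 <= 2 * cabs (a - b) ^+ 2 + 8 * eta ^+ 2.
Proof.
move=> h1 h2; have h : cabs (u - v) <= cabs (a - b) + 2 * eta.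
  rewrite (_ : u - v = (a - b) + ((u - a) - (v - b))); last by ring.
  by apply: (le_trans (cabsD _ _)); have := cabsB (u - a) (v - b); lra.
have eta0 := le_trans (cabs_ge0 _) h1.
have := cabs_ge0 (u - v); have := cabs_ge0 (a - b).
move: (cabs (u - v)) (cabs (a - b)) h => p q h q0 p0.
have q2 : 0 <= q + 2 * eta by lra.
have : p ^+ 2 <= (q + 2 * eta) ^+ 2 by rewrite lerXn2r ?nnegrE.
have := sqr_ge0 (q - 2 * eta); nra.
Qed.

Definition radial X (rho : R) zeta := chr X (rho%:C * zeta) (rho%:C * zeta).

(* By Parseval the double sum is, up to a truncation error, [L] times the sum of
   [|b m|^2 (rho i.+1 ^+ m - rho i ^+ m)^2], and the squared increments of a nondecreasing
   sequence add up to at most the square of its last term. *)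
Lemma near_constancy g (B : R) X (I : nat) (rho : nat -> R) : bounded_by g B ->
  cabs X < 1 -> (forall i, (i < I)%N -> 0 <= rho i <= rho i.+1) -> 0 <= rho I < 1 ->
  exists N0, forall L omega, (N0 <= L)%N -> cabs omega = 1 -> orthogonal_root L omega ->
    \sum_(k < L) \sum_(i < I) cabs (ev (radial X (rho i.+1) (omega ^+ k)) g
      - ev (radial X (rho i) (omega ^+ k)) g) ^+ 2 <= L%:R * (4 * (B + 1) ^+ 2).
Proof.
move=> hB X1 hrho /andP[rI0 rI1].
have B0 : 0 <= B := le_trans (cabs_ge0 _) (hB point).
have rho_le i : (i <= I)%N -> 0 <= rho i <= rho I.
  have h : forall k, (k <= I)%N -> 0 <= rho (I - k)%N <= rho I.
    elim=> [|k ih] kI; first by rewrite subn0 rI0 lexx.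
    have := hrho (I - k.+1)%N; rewrite subnSK// => /(_ (leq_subr _ _))/andP[a b].
    by have /andP[c f] := ih (ltnW kI); rewrite a (le_trans b).
  by move=> iI; have := h (I - i)%N (leq_subr _ _); rewrite subKn.
(* With precision [1 / (I + 1)] the truncation errors [I * 8 eta^2] of all increments stay below
   [2 (B + 1)^2], because [4 I <= (I + 1)^2]; the main part supplies the other half of the constant
   [4]. *)
have eta0 : 0 < (I.+1%:R : R)^-1 by rewrite invr_gt0 ltr0n.
set eta := (_ : R)^-1 in eta0.
have rc : cabs ((rho I)%:C : C) = rho I by rewrite cabs_real ger0_norm.
have rc1 : cabs ((rho I)%:C : C) < 1 by rewrite rc.
have [N N0 hN] := ev_truncation g X1 rc1 rc1 eta0.
pose d n := (logn 3 n + logn 5 n)%N.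
pose x n := coef g n * (if pi235.-nat n then X ^+ logn 2 n else 0).
(* Parseval needs [L] above every degree [d n] of the truncation in [zeta]; the sum of these degrees
   is a convenient bound. *)
exists (\sum_(n < N) d n).+1 => L omega LN om1 ho.
have dL n : (n < N)%N -> (d n < L)%N.
  move=> nN; apply: leq_trans LN; rewrite ltnS.
  by rewrite (bigD1 (Ordinal nN))//= leq_addr.
pose b m := \sum_(1 <= n < N | d n == m) x n.
pose T i k := \sum_(m < L) (b m * ((rho i)%:C ^+ m)) * (omega ^+ k) ^+ m.
have TE i k : \sum_(1 <= n < N) coef g n * radial X (rho i) (omega ^+ k) n = T i k.
  rewrite /T (eq_bigr (fun m : 'I_L => b m * ((rho i)%:C * omega ^+ k) ^+ m)); last first.
    by move=> m _; rewrite exprMn mulrA.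
  rewrite -regroup_by_degree//; apply: eq_bigr => n _.
  rewrite /radial /chr /x; case: ifP => _; last by rewrite mulr0 mul0r.
  by rewrite -mulrA -exprD mulrA.
have hT i k : (i <= I)%N -> cabs (ev (radial X (rho i) (omega ^+ k)) g - T i k) <= eta.
  move=> iI; rewrite -TE; have h : cabs ((rho i)%:C * omega ^+ k) <= cabs ((rho I)%:C : C).
    rewrite cabsM (cabs_root N _ om1) mulr1 cabs_real rc.
    by have /andP[h1 h2] := rho_le i iI; rewrite ger0_norm.
  exact: hN.
have eta1 : eta <= 1 by rewrite invf_le1 ?ltr0n// ler1n.
have L0 : (0 < L)%N by exact: leq_trans LN.
(* Parseval on the outermost circle, where the truncation is within [eta <= 1] of values bounded by
   [B]. The result does not depend on the number [I] of radii. *)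
have energy : \sum_(m < L) cabs (b m) ^+ 2 * (rho I ^+ m) ^+ 2 <= (B + 1) ^+ 2.
  have Lp : 0 < L%:R :> R by rewrite ltr0n.
  rewrite -(ler_pM2l Lp).
  have -> : L%:R * \sum_(m < L) cabs (b m) ^+ 2 * (rho I ^+ m) ^+ 2 =
      \sum_(k < L) cabs (T I k) ^+ 2.
    rewrite (parseval (fun m => b m * (rho I)%:C ^+ m) ho); congr (_ * _).
    by apply: eq_bigr => m _; rewrite cabsM cabsX rc exprMn.
  have -> : L%:R * (B + 1) ^+ 2 = \sum_(k < L) (B + 1) ^+ 2.
    by rewrite sumr_const card_ord mulr_natl.
  apply: ler_sum => k _; rewrite lerXn2r ?nnegrE ?cabs_ge0 ?addr_ge0//.
  have hr : cabs ((rho I)%:C * omega ^+ k) < 1.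
    by rewrite cabsM (cabs_root N _ om1) mulr1 rc.
  have [S hS] := chr_character X1 hr hr.
  have h1 := ev_le hS hB; have h2 := hT I k (leqnn I).
  rewrite (_ : T I k = ev (radial X (rho I) (omega ^+ k)) g
     - (ev (radial X (rho I) (omega ^+ k)) g - T I k)); last by ring.
  by apply: (le_trans (cabsB _ _)); apply: lerD => //; exact: le_trans eta1.
have diff i k : (i < I)%N -> cabs (ev (radial X (rho i.+1) (omega ^+ k)) g
      - ev (radial X (rho i) (omega ^+ k)) g) ^+ 2 <=
    2 * cabs (T i.+1 k - T i k) ^+ 2 + 8 * eta ^+ 2.
  by move=> iI; apply: sqr_increment_approx; apply: hT => //; exact: ltnW.
have main : \sum_(k < L) \sum_(i < I) cabs (T i.+1 k - T i k) ^+ 2 <= L%:R * (B + 1) ^+ 2.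
  rewrite exchange_big/=.
  have step (i : 'I_I) : \sum_(k < L) cabs (T i.+1 k - T i k) ^+ 2 =
      L%:R * \sum_(m < L) cabs (b m) ^+ 2 * (rho i.+1 ^+ m - rho i ^+ m) ^+ 2.
    rewrite (eq_bigr (fun k : 'I_L => cabs (\sum_(m < L)
        (b m * (rho i.+1 ^+ m - rho i ^+ m)%:C) * (omega ^+ k) ^+ m) ^+ 2)); last first.
      move=> k _; congr (cabs _ ^+ 2); rewrite /T -sumrB; apply: eq_bigr => m _.
      by rewrite rmorphB !rmorphXn/=; ring.
    rewrite (parseval (fun m => b m * (rho i.+1 ^+ m - rho i ^+ m)%:C) ho); congr (_ * _).
    by apply: eq_bigr => m _; rewrite cabsM cabs_real exprMn real_normK ?num_real.
  rewrite (eq_bigr _ (fun i _ => step i)) -mulr_sumr ler_wpM2l//.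
  apply: le_trans energy; rewrite exchange_big/=; apply: ler_sum => m _.
  rewrite -mulr_sumr ler_wpM2l ?sqr_ge0//.
  apply: (@sum_sqr_increments I (fun i => rho i ^+ m)); last exact: exprn_ge0.
  move=> i iI; have /andP[h1 h2] := hrho i iI.
  by rewrite exprn_ge0// lerXn2r// nnegrE// (le_trans h1).
apply: (@le_trans _ _ (\sum_(k < L) \sum_(i < I)
    (2 * cabs (T i.+1 k - T i k) ^+ 2 + 8 * eta ^+ 2))).
  by apply: ler_sum => k _; apply: ler_sum => i _; exact: diff.
rewrite (eq_bigr (fun k : 'I_L => 2 * (\sum_(i < I) cabs (T i.+1 k - T i k) ^+ 2)
   + I%:R * (8 * eta ^+ 2))); last first.
  move=> k _; rewrite big_split/= -mulr_sumr; congr (_ + _).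
  by rewrite sumr_const card_ord [RHS]mulr_natl.
rewrite big_split/= -mulr_sumr sumr_const card_ord -[X in _ + X]mulr_natl.
have h3 : I%:R * (8 * eta ^+ 2) <= 2 * (B + 1) ^+ 2.
  have h : I.+1%:R * eta = 1 by rewrite mulfV// pnatr_eq0.
  have h4 : 4 * I%:R * eta ^+ 2 <= 1.
    have : 4 * I%:R <= I.+1%:R ^+ 2 :> R.
      by rewrite -natr1; have := sqr_ge0 (I%:R - 1 : R); nra.
    move/(ler_wpM2r (sqr_ge0 eta)); rewrite -exprMn h expr1n.
    by [].
  have : 1 <= (B + 1) ^+ 2 by rewrite exprn_ege1// lerDr.
  nra.
have Lp : 0 <= L%:R :> R by [].
have := ler_wpM2l Lp h3; lra.
Qed.

End Averages.

(** * The contradiction *)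

Section LacunaryLowerBound.
Variable R : realType.
Local Notation C := R[i].
Implicit Types (X z w zeta : C) (i j : nat).

Definition rho j : R := 1 - (4 * (lac j)%:R)^-1.

Lemma lac_pos j : 0 < (lac j)%:R :> R.
Proof. by rewrite ltr0n lac_gt0. Qed.

Lemma lac_le i j : (i <= j)%N -> (lac i)%:R <= (lac j)%:R :> R.
Proof. by move=> ij; rewrite ler_nat /lac leq_exp2l. Qed.

Lemma rho_bounds j : 0 <= rho j < 1.
Proof.
have h := lac_pos j; have h1 : 1 <= (lac j)%:R :> R by rewrite ler1n lac_gt0.
have h4 : 0 < 4 * (lac j)%:R :> R by lra.
rewrite /rho subr_ge0 invf_le1// gtrBl invr_gt0 h4 andbT; lra.
Qed.

Lemma rho_nondecreasing i : rho i <= rho i.+1.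
Proof.
rewrite /rho lerD2l lerN2 lef_pV2 ?posrE ?mulr_gt0 ?lac_pos//.
by rewrite ler_pM2l// lac_le.
Qed.

Lemma bernoulliB (x : R) n : 0 <= x <= 1 -> 1 - n%:R * x <= (1 - x) ^+ n.
Proof.
move=> /andP[x0 x1]; elim: n => [|n ih]; first by rewrite mul0r subr0 expr0.
rewrite exprS -natr1.
have : 0 <= n%:R * x by rewrite mulr_ge0.
have : (1 - x) * (1 - n%:R * x) <= (1 - x) * (1 - x) ^+ n by rewrite ler_wpM2l// subr_ge0.
nra.
Qed.

Lemma lacD i m : (lac (i + m))%:R = (lac i)%:R * 64 ^+ m :> R.
Proof. by rewrite /lac -addSn expnD natrM [X in _ * X]natrX. Qed.

(** Bernoulli alone gives only [rho^M <= 1 / (1 + v)], with [v = M t] a power of [64]. Splitting the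
    exponent into [16] equal parts [M] gives [(1 + v)^-16], and [(64 v)^2 <= 2^14 v^2 <= (1 + v)^16]
    is what is required. *)
Lemma rho_lac_decay i m : (0 < m)%N ->
  (lac (i + m))%:R * rho i ^+ lac (i + m) <= (lac i)%:R * (64^-1) ^+ m.
Proof.
case: m => // m _; set t : R := (4 * (lac i)%:R)^-1.
have Li := lac_pos i; have t0 : 0 <= t by rewrite invr_ge0 mulr_ge0// ltW.
have /andP[r0 r1] := rho_bounds i.
pose M := (4 * 64 ^ (i + m.+1))%N.
have lacM : lac (i + m.+1) = (16 * M)%N by rewrite /M mulnA /lac expnS.
pose v : R := 64 ^+ m.
have v1 : 1 <= v by rewrite exprn_ege1// ler1n.
have Mt : M%:R * t = v.
  have e : M%:R = 4 * (lac i)%:R * v.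
    rewrite /M natrM addnS -addSn expnD natrM -mulrA; congr (_ * (_ * _)).
    by rewrite natrX.
  by rewrite e /t mulrAC divff ?mul1r// mulf_neq0// gt_eqF.
have b1 : rho i ^+ M <= (1 + v)^-1.
  rewrite -[leRHS]mul1r ler_pdivlMr ?ltr_pwDl//; last by rewrite (le_trans _ v1).
  apply: (@le_trans _ _ (rho i ^+ M * (1 + t) ^+ M)).
    by rewrite ler_wpM2l ?exprn_ge0// -Mt; exact: bernoulli.
  rewrite -exprMn exprn_ile1 ?mulr_ge0// /rho -/t; nra.
have b2 : rho i ^+ lac (i + m.+1) <= ((1 + v)^-1) ^+ 16.
  by rewrite lacM mulnC exprM lerXn2r// nnegrE ?exprn_ge0// invr_ge0; lra.
rewrite lacD -mulrA ler_pM2l//.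
have v0 : 0 < v by lra.
have -> : 64^-1 ^+ m.+1 = (64 * v)^-1 by rewrite exprVn exprS.
have -> : 64 ^+ m.+1 = 64 * v :> R by rewrite exprS.
have v64 : 0 <= 64 * v by lra.
apply: (le_trans (ler_wpM2l v64 b2)).
rewrite exprVn ler_pdivrMr; last by rewrite exprn_gt0 ?ltr_wpDl.
rewrite [leRHS]mulrC ler_pdivlMr; last by lra.
have c2 : 2 <= 1 + v by lra.
have c14 : 2 ^+ 14 <= (1 + v) ^+ 14 by rewrite lerXn2r// nnegrE; lra.
have cv : v * v <= (1 + v) ^+ 2 by rewrite expr2; nra.
rewrite (_ : (1 + v) ^+ 16 = (1 + v) ^+ 14 * (1 + v) ^+ 2); last by rewrite -exprD.
apply: (@le_trans _ _ (2 ^+ 14 * (v * v))); last first.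
  by apply: ler_pM => //; rewrite ?exprn_ge0// mulr_ge0// ltW.
have : 4096 <= 2 ^+ 14 :> R by rewrite -natrX ler_nat.
nra.
Qed.

(** Two geometric tails of ratio [1/64], one on each side of [i], each at most [2/64]. *)
Lemma sum_distance_le (i J : nat) :
  \sum_(0 <= j < J | j != i) (64^-1 : R) ^+ (if (j < i)%N then i - j else j - i)%N <= 16^-1.
Proof.
pose q : R := 64^-1; have q01 : 0 <= q < 1 by rewrite /q; lra.
have /andP[q0 q1] := q01.
have F0 j : 0 <= q ^+ (if (j < i)%N then i - j else j - i)%N by rewrite exprn_ge0.
have hq : (1 - q)^-1 <= 2 by rewrite invf_ple ?posrE//; rewrite /q; lra.
apply: (@le_trans _ _ (\sum_(0 <= j < (i + J).+1 | j != i)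
    q ^+ (if (j < i)%N then i - j else j - i)%N)).
  rewrite [leRHS](@big_cat_nat _ _ _ J)//=; last by rewrite leqW// leq_addl.
  by rewrite lerDl sumr_ge0.
rewrite (@big_cat_nat _ _ _ i)//=; last by rewrite leqW// leq_addr.
rewrite [X in _ + X]big_ltn_cond ?ltnS ?leq_addr// eqxx/=.
have -> : \sum_(0 <= j < i | j != i) q ^+ (if (j < i)%N then i - j else j - i)%N
    = \sum_(0 <= j < i) q * q ^+ j.
  rewrite big_nat_rev/= add0n big_nat_cond [RHS]big_nat_cond.
  apply: eq_big => [j|j /andP[/andP[_ ji] _]].
    case: (ltnP j i) => //= ji; apply/eqP => h.
    have : (i - j.+1 < i)%N by rewrite ltn_subrL (leq_ltn_trans (leq0n j) ji).
    by rewrite h ltnn.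
  have -> : (i - j.+1 < i)%N by rewrite ltn_subrL (leq_ltn_trans (leq0n j) ji).
  by rewrite subKn// exprS.
have -> : \sum_(i.+1 <= j < (i + J).+1 | j != i) q ^+ (if (j < i)%N then i - j else j - i)%N
    = \sum_(0 <= j < J) q * q ^+ j.
  rewrite -{1}(add0n i.+1) big_addn subSS addKn.
  apply: eq_big => [j|j _]; first by rewrite gtn_eqF// addnS ltnS leq_addl.
  rewrite ltnNge (_ : (i <= j + i.+1)%N); last by rewrite addnS leqW// leq_addl.
  by rewrite addnS -addSn addnK exprS.
rewrite -!mulr_sumr.
have g1 := geometric_le i q01; have g2 := geometric_le J q01.
have h1 : q * (\sum_(0 <= j < i) q ^+ j) <= q * 2 by rewrite ler_wpM2l// (le_trans g1).
have h2 : q * (\sum_(0 <= j < J) q ^+ j) <= q * 2 by rewrite ler_wpM2l// (le_trans g2).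
by apply: (le_trans (lerD h1 h2)); rewrite /q; lra.
Qed.

Lemma cabs_block N X z w : cabs (block N X z w) =
  (N%:R ^+ 3)^-1 * cabs z ^+ N * (cabs (geo N X) ^+ 2 * cabs (geo2 N z w) ^+ 2).
Proof.
rewrite /block 3!cabsM -(cabs_nat _ N) -!cabsX; congr (_ * _ * _).
by rewrite cabsV.
Qed.

Lemma cabs_block_le (N : nat) X z : (0 < N)%N -> cabs X <= 1 -> cabs z <= 1 ->
  cabs (block N X z z) <= N%:R * cabs z ^+ N.
Proof.
move=> N0 X1 z1; have Np : 0 < N%:R :> R by rewrite ltr0n.
rewrite cabs_block.
have c0 : 0 <= (N%:R ^+ 3)^-1 * cabs z ^+ N.
  by rewrite mulr_ge0 ?invr_ge0 ?exprn_ge0 ?cabs_ge0.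
apply: (@le_trans _ _ ((N%:R ^+ 3)^-1 * cabs z ^+ N * (N%:R ^+ 2 * N%:R ^+ 2))).
  apply: ler_wpM2l => //; apply: ler_pM; rewrite ?exprn_ge0 ?cabs_ge0//.
    by rewrite lerXn2r ?nnegrE ?cabs_ge0 ?cabs_geo.
  by rewrite lerXn2r ?nnegrE ?cabs_ge0 ?cabs_geo2.
by rewrite le_eqVlt; apply/orP; left; apply/eqP; field; rewrite gt_eqF.
Qed.

Lemma geo2_diag N z : geo2 N z z = N%:R * z ^+ N.-1.
Proof.
rewrite /geo2 (eq_bigr (fun=> z ^+ N.-1)) => [|i _].
  by rewrite sumr_const card_ord mulr_natl.
by rewrite -exprD subnK// -ltnS (leq_trans (ltn_ord i))// leqSpred.
Qed.

Lemma cabs_geo_ge (N : nat) (x : R) : 0 <= x <= 1 -> N%:R * x ^+ N <= cabs (geo N x%:C).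
Proof.
move=> /andP[x0 x1].
have -> : geo N x%:C = (\sum_(i < N) x ^+ i)%:C.
  by rewrite /geo rmorph_sum; apply: eq_bigr => i _; rewrite rmorphXn.
rewrite cabs_real ger0_norm; last by rewrite sumr_ge0// => i _; rewrite exprn_ge0.
have -> : N%:R * x ^+ N = \sum_(i < N) x ^+ N by rewrite sumr_const card_ord mulr_natl.
apply: ler_sum => i _.
by rewrite ler_wiXn2l// ltnW.
Qed.

(** Bernoulli gives [geo >= N (1 - N e) >= 7 N / 8]; on the diagonal [z = w] the powers of [r] have
    total exponent at most [3 N]. Finally [(7/8)^2 / 4 = 49/256] exceeds [3/16]. *)
Lemma cabs_block_ge (N : nat) (e r : R) zeta : (0 < N)%N -> 0 <= e <= 1 ->
  N%:R * e <= 8^-1 -> 0 <= r <= 1 -> 4^-1 <= r ^+ (3 * N) -> cabs zeta = 1 ->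
  N%:R * (3 / 16) <= cabs (block N (1 - e)%:C (r%:C * zeta) (r%:C * zeta)).
Proof.
move=> N0 e01 Ne /andP[r0 r1] hr hz; have Np : 0 < N%:R :> R by rewrite ltr0n.
have /andP[e0 e1] := e01.
have zr : cabs (r%:C * zeta) = r by rewrite cabsM hz mulr1 cabs_real ger0_norm.
have h01 : 0 <= 1 - e <= 1 by lra.
have hg := cabs_geo_ge N h01.
have hb := bernoulliB N e01.
have hge : N%:R * (7 / 8) <= cabs (geo N (1 - e)%:C).
  apply: le_trans hg; rewrite ler_pM2l//; apply: le_trans hb; lra.
rewrite cabs_block geo2_diag zr cabsM cabsX cabs_nat zr.
set G := cabs (geo _ _) in hge *.
have hG : (N%:R * (7 / 8)) ^+ 2 <= G ^+ 2.
  by rewrite lerXn2r// nnegrE ?cabs_ge0// mulr_ge0.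
have hrr : 4^-1 <= r ^+ N * (r ^+ N.-1) ^+ 2.
  apply: (le_trans hr); rewrite -exprM -exprD ler_wiXn2l//.
  by rewrite mulSn leq_add2l mulnC leq_mul2l/= leq_pred.
rewrite (_ : _ * _ * (G ^+ 2 * _) = (N%:R ^- 1 * G ^+ 2) * (r ^+ N * (r ^+ N.-1) ^+ 2));
  last by field; rewrite gt_eqF.
have c1 : N%:R * (49 / 64) <= N%:R^-1 * G ^+ 2.
  rewrite ler_pdivlMl//; apply: le_trans hG; rewrite le_eqVlt; apply/orP; left.
  by apply/eqP; field.
apply: (@le_trans _ _ (N%:R * (49 / 64) * 4^-1)); first by lra.
by apply: ler_pM => //; rewrite mulr_ge0.
Qed.

(** Bernoulli with [3 N * 1 / (4 N) = 3/4]; this is the reason for the factor [4] in [rho]. *)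
Lemma rho_diag i : 4^-1 <= rho i ^+ (3 * lac i).
Proof.
have Li := lac_pos i; set t : R := (4 * (lac i)%:R)^-1.
have /andP[r0 r1] := rho_bounds i.
have t01 : 0 <= t <= 1 by move: r0 r1; rewrite /rho -/t; lra.
apply: le_trans (bernoulliB (3 * lac i) t01); rewrite natrM /t.
rewrite (_ : 3 * _ * _ = 3 / 4); last by field; rewrite gt_eqF.
lra.
Qed.

(* At radius [rho i] the [i]-th block dominates the sum of all the others. *)
Lemma lacunary_lower_bound (e : R) zeta i (mu : nat -> C) (l : C) :
  0 <= e <= 1 -> (lac i)%:R * e <= 8^-1 -> cabs zeta = 1 ->
  (forall j, cabs (mu j) <= cabs (mu i)) ->
  (fun J => \sum_(0 <= j < J)
     mu j * (e%:C * lac_term (radial (1 - e)%:C (rho i) zeta) j)) @ \oo --> l ->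
  cabs (mu i) * (e * (lac i)%:R / 8) <= cabs l.
Proof.
move=> e01 he hz hmu hl; have /andP[e0 e1] := e01.
have /andP[r0 r1] := rho_bounds i; have Li := lac_pos i.
set chi := radial _ _ _ in hl *.
have tE j : lac_term chi j = block (lac j) (1 - e)%:C ((rho i)%:C * zeta) ((rho i)%:C * zeta).
  by rewrite /lac_term /chi /radial chr2 chr3 chr5.
have zr : cabs ((rho i)%:C * zeta) = rho i by rewrite cabsM hz mulr1 cabs_real ger0_norm.
have X1 : cabs (1 - e)%:C <= 1 :> R by rewrite cabs_real ger0_norm; lra.
have ub j : j != i -> cabs (lac_term chi j) <=
    (lac i)%:R * (64^-1) ^+ (if (j < i)%N then i - j else j - i)%N.
  move=> ji; rewrite tE.
  have h := @cabs_block_le (lac j) (1 - e)%:C ((rho i)%:C * zeta) (lac_gt0 j) X1.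
  rewrite zr in h; apply: (le_trans (h (ltW r1))).
  case: ltnP => [lt|ge].
    have d : (lac i)%:R = (lac j)%:R * 64 ^+ (i - j) :> R by rewrite -lacD subnKC// ltnW.
    rewrite d -mulrA -exprMn divff ?expr1n ?mulr1//.
    by rewrite ler_piMr// exprn_ile1// ltW.
  have lt : (i < j)%N by rewrite ltn_neqAle eq_sym ji.
  have := @rho_lac_decay i (j - i); rewrite subn_gt0 subnKC//; exact.
have lb : (lac i)%:R * (3 / 16) <= cabs (lac_term chi i).
  rewrite tE; apply: cabs_block_ge => //; first exact: lac_gt0; last exact: rho_diag.
  by rewrite r0 ltW.
(* All other blocks together weigh at most [1/16], against [3/16] for the [i]-th one; the difference
   is the [1/8] of the conclusion. *)
have close J : (i < J)%N -> cabs (\sum_(0 <= j < J) mu j * (e%:C * lac_term chi j)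
    - mu i * (e%:C * lac_term chi i)) <= cabs (mu i) * (e * (lac i)%:R / 16).
  move=> iJ; rewrite (bigD1_seq i)/= ?mem_index_iota ?iota_uniq//.
  rewrite [X in X - _]addrC addrK (le_trans (cabs_sum _ _ _))//.
  apply: (@le_trans _ _ (\sum_(0 <= j < J | j != i) cabs (mu i) * (e * (lac i)%:R) *
      (64^-1) ^+ (if (j < i)%N then i - j else j - i)%N)).
    apply: ler_sum => j ji; rewrite cabsM.
    rewrite [cabs (_ * lac_term _ _)]cabsM cabs_real ger0_norm// -[leRHS]mulrA.
    apply: ler_pM; rewrite ?cabs_ge0 ?mulr_ge0 ?cabs_ge0//.
    by rewrite -[leRHS]mulrA ler_wpM2l// ub.
  rewrite -mulr_sumr [leRHS]mulrA; apply: ler_wpM2l; last exact: sum_distance_le.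
  by rewrite !mulr_ge0 ?cabs_ge0// ltW.
have := @cvgn_cabs_le R _ l (mu i * (e%:C * lac_term chi i)) _ i.+1 hl close.
have h1 : cabs (mu i * (e%:C * lac_term chi i)) = cabs (mu i) * (e * cabs (lac_term chi i)).
  by rewrite cabsM [cabs (_ * lac_term _ _)]cabsM cabs_real ger0_norm.
have h2 := cabs_ge_sub (mu i * (e%:C * lac_term chi i)) (mu i * (e%:C * lac_term chi i) - l).
move: h2; rewrite subKr h1 [cabs (_ - l)]cabsBC => h2 h3.
have h4 : cabs (mu i) * (e * ((lac i)%:R * (3 / 16))) <= cabs (mu i) * (e * cabs (lac_term chi i)).
  by rewrite ler_wpM2l ?cabs_ge0// ler_wpM2l.
lra.
Qed.

End LacunaryLowerBound.

(** * Pigeonhole and rank *)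

Section FiniteGeneration.
Variable R : realType.
Local Notation C := R[i].
Implicit Types (X z w zeta omega : C) (g : Hinf R).

Lemma sum_le_exists (L : nat) (x : nat -> R) (M : R) : (0 < L)%N ->
  \sum_(k < L) x k <= L%:R * M -> exists2 k, (k < L)%N & x k <= M.
Proof.
move=> L0 hx; apply: contrapT => hN; move: hx; apply/negP; rewrite -ltNge.
have -> : L%:R * M = \sum_(k < L) M by rewrite sumr_const card_ord mulr_natl.
have lt (k : 'I_L) : M < x k.
  by rewrite ltNge; apply/negP => le; apply: hN; exists k.
case: L L0 {hN} lt => // L _ lt; rewrite !big_ord_recl ltr_leD//.
by apply: ler_sum => k _; exact: ltW.
Qed.

Lemma sum_blocks (n Q : nat) (x : nat -> R) :
  \sum_(i < n * Q) x i = \sum_(q < Q) \sum_(a < n) x (n * q + a)%N.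
Proof.
elim: Q => [|Q ih]; first by rewrite muln0 !big_ord0.
by rewrite big_ord_recr/= -ih mulnSr big_split_ord.
Qed.

Lemma ler_double_sum (T : finType) (n : nat) (y : T -> nat -> R) t a :
  (forall t a, 0 <= y t a) -> (a < n)%N -> y t a <= \sum_t \sum_(a < n) y t a.
Proof.
move=> y0 an; rewrite (bigD1 t)//= (bigD1 (Ordinal an))//= -addrA lerDl.
by rewrite addr_ge0// sumr_ge0// => t' _; rewrite sumr_ge0.
Qed.

Lemma common_threshold (T : finType) (P : T -> nat -> Prop) :
  (forall t, exists N0, forall L, (N0 <= L)%N -> P t L) ->
  exists N0, forall t L, (N0 <= L)%N -> P t L.
Proof.
move=> /choice[f hf]; exists (\max_t f t) => t L hL.
by apply: (hf t); exact: leq_trans (leq_bigmax t) hL.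
Qed.

(** [Q] is fixed before [X], which lets [e] depend on [Q] later. The total energy [E] is at most
    [Q * delta^2]: a first pigeonhole over the roots of unity finds [zeta], a second over the [Q]
    blocks finds [q], and at most [n] increments of size [delta] are chained within the block. *)
Lemma near_constant_block (T : finType) (c : T -> Hinf R) (n : nat) (delta : R) :
  (0 < n)%N -> 0 < delta -> exists Q, forall X, cabs X < 1 ->
  exists zeta q, [/\ cabs zeta = 1, (q < Q)%N & forall t a, (a < n)%N ->
    cabs (ev (radial X (rho R (n * q + a)) zeta) (c t) -
          ev (radial X (rho R (n * q)) zeta) (c t)) <= n%:R * delta].
Proof.
move=> n0 d0; have /choice[B hB] : forall t, exists B, bounded_by (c t) B.
  by move=> t; exact: exists_bound.
pose E := \sum_t 4 * (B t + 1) ^+ 2.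
have E0 : 0 <= E by rewrite sumr_ge0// => t _; rewrite mulr_ge0// sqr_ge0.
pose Q := (Num.truncn (E / delta ^+ 2)).+1.
have d2 : 0 < delta ^+ 2 by rewrite exprn_gt0.
have hQ : E <= Q%:R * delta ^+ 2.
  by rewrite -ler_pdivrMr// ltW//; exact: truncnS_gt.
exists Q => X X1; pose I := (n * Q)%N.
have hrho i : (i < I)%N -> 0 <= rho R i <= rho R i.+1.
  by move=> _; rewrite rho_nondecreasing andbT; have /andP[] := rho_bounds R i.
pose D omega k t i := cabs (ev (radial X (rho R i.+1) (omega ^+ k)) (c t) -
  ev (radial X (rho R i) (omega ^+ k)) (c t)) ^+ 2.
have [N0 hN] : exists N0, forall t L, (N0 <= L)%N -> forall omega, cabs omega = 1 ->
    orthogonal_root L omega ->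
    \sum_(k < L) \sum_(i < I) D omega k t i <= L%:R * (4 * (B t + 1) ^+ 2).
  apply: common_threshold => t.
  have [N0 hN] := near_constancy (hB t) X1 hrho (rho_bounds R I).
  by exists N0 => L NL omega om1 ho; exact: hN.
pose L := maxn 1 N0; have L0 : (0 < L)%N by rewrite leq_max.
have [omega om1 ho] := @roots_of_unity R L L0.
have [k kL hk] : exists2 k, (k < L)%N & \sum_t \sum_(i < I) D omega k t i <= E.
  apply: sum_le_exists => //; rewrite exchange_big mulr_sumr; apply: ler_sum => t _.
  by apply: hN => //; exact: leq_maxr.
have [q qQ hq] : exists2 q, (q < Q)%N & \sum_t \sum_(a < n) D omega k t (n * q + a)%N <= delta ^+ 2.
  apply: sum_le_exists => //; apply: le_trans hQ; apply: le_trans hk.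
  rewrite exchange_big le_eqVlt; apply/orP; left; apply/eqP; apply: eq_bigr => t _.
  exact/esym/sum_blocks.
exists (omega ^+ k), q; split=> //; first by rewrite cabsX om1 expr1n.
have D0 t i : 0 <= D omega k t i by rewrite sqr_ge0.
have step t a : (a < n)%N ->
    cabs (ev (radial X (rho R (n * q + a).+1) (omega ^+ k)) (c t) -
          ev (radial X (rho R (n * q + a)) (omega ^+ k)) (c t)) <= delta.
  move=> an; have dd := ltW d0.
  rewrite -(ler_pXn2r (n := 2))// ?nnegrE ?cabs_ge0//.
  exact: le_trans (ler_double_sum t (fun t a => D0 t (n * q + a)%N) an) hq.
move=> t a an; apply: (@le_trans _ _ (a%:R * delta)); last first.
  by apply: ler_wpM2r; [exact: ltW|rewrite ler_nat ltnW].
elim: a an => [|a ih] an; first by rewrite addn0 subrr cabs0 mul0r.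
have := ih (ltnW an); have := step t a (ltnW an); rewrite addnS -natr1.
set u := ev _ _; set v := ev _ _; set w := ev _ _ => h1 h2.
rewrite (_ : u - w = (u - v) + (v - w)); last by ring.
by apply: (le_trans (cabsD _ _)); rewrite mulrDl mul1r addrC lerD.
Qed.

Lemma kernel_sum_bound (n : nat) (lam x y : 'I_n -> C) (m d : R) :
  \sum_k lam k * y k = 0 -> (forall k, cabs (lam k) <= m) ->
  (forall k, cabs (x k - y k) <= d) -> cabs (\sum_k lam k * x k) <= m * (n%:R * d).
Proof.
move=> hy hm hd; have -> : \sum_k lam k * x k = \sum_k lam k * (x k - y k).
  by under [RHS]eq_bigr do rewrite mulrBr; rewrite sumrB hy subr0.
have -> : m * (n%:R * d) = \sum_(k < n) m * d.
  by rewrite sumr_const card_ord -[RHS]mulr_natl mulrCA.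
apply: (le_trans (cabs_sum _ _ _)); apply: ler_sum => k _; rewrite cabsM.
by apply: ler_pM; rewrite ?cabs_ge0.
Qed.

(** More rows than columns force a nonzero left kernel. The entry of largest modulus is singled out
    so that all errors can be measured against it. *)
Lemma left_kernel_max (r : nat) (M : 'M[C]_(r.+1, r)) : exists lam : 'I_r.+1 -> C,
  (forall i, \sum_k lam k * M k i = 0) /\
  exists k0, 0 < cabs (lam k0) /\ forall k, cabs (lam k) <= cabs (lam k0).
Proof.
pose u := nz_row (kermx M).
have u0 : u != 0.
  rewrite nz_row_eq0 -mxrank_eq0 mxrank_ker subn_eq0 -ltnNge ltnS.
  exact: rank_leq_col.
have uM : u *m M = 0 by apply/sub_kermxP; exact: nz_row_sub.
exists (u 0); split.
  by move=> i; have /matrixP/(_ 0 i) := uM; rewrite !mxE.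
have [k0 _ hk] := @arg_maxP _ _ _ ord0 xpredT (fun k => cabs (u 0 k)) isT.
exists k0; split; last by move=> k; exact: hk.
rewrite cabs_gt0; apply: contraNneq u0 => uk; apply/eqP/rowP => k.
apply/eqP; rewrite mxE -cabs_eq0 eq_le cabs_ge0 andbT.
by rewrite (le_trans (hk k isT))// uk cabs0.
Qed.

Variables F2 F3 F5 : Hinf R.
Hypotheses
  (hF2 : forall chi S, character chi S -> small chi -> ev chi F2 = chi 2)
  (hF3 : forall chi S, character chi S -> small chi -> ev chi F3 = chi 3)
  (hF5 : forall chi S, character chi S -> small chi -> ev chi F5 = chi 5).

(* Off the diagonal the relation gives [|g1| |z - w| <= e sup |g2|]; the mean value
   property on a circle around [w = z] removes the division by [z - w]. *)
Lemma relation_diagonal_bound (g1 g2 : Hinf R) (B e : R) z :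
  g1 * (F3 - F5) + g2 * (1 - F2) = 0 -> bounded_by g2 B -> 0 < e <= 1 -> cabs z < 1 ->
  cabs (ev (chr (1 - e)%:C z z) g1) <= 2 * B * e / (1 - cabs z).
Proof.
move=> rel hB /andP[e0 e1] z1.
have X1 : cabs (1 - e)%:C < 1 :> R by rewrite cabs_real ger0_norm; lra.
have z1' : 0 < 1 - cabs z by lra.
(* Half the distance to the unit circle: [w] stays in the open disc and [|z - w| = d], whence the
   factor [2] in the bound. *)
pose d := (1 - cabs z) / 2; have d0 : 0 < d by rewrite /d; lra.
have zd : cabs z + d < 1 by rewrite /d; lra.
apply: (circle_mean X1 (ltW d0) zd) => zeta hz.
set w := z + _.
have w1 : cabs w < 1.
  by apply: (le_lt_trans (cabsD _ _)); rewrite cabsM hz mulr1 cabs_real gtr0_norm.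
have [S hS] := chr_character X1 z1 w1; have sm := chr_small X1 z1 w1.
have := congr1 (ev (chr (1 - e)%:C z w)) rel.
rewrite (evD hS) !(evM hS) !(evB hS) (ev1 hS) (ev0 hS) (hF2 hS sm) (hF3 hS sm) (hF5 hS sm).
rewrite chr2 chr3 chr5; set a := ev _ g1; set b := ev _ g2 => h.
have hb : cabs b <= B := ev_le hS hB.
have : a * (d%:C * zeta) = b * e%:C.
  have -> : e%:C = 1 - (1 - e)%:C :> C by rewrite rmorphB rmorph1; ring.
  by apply/eqP; rewrite -subr_eq0 -oppr_eq0; apply/eqP; rewrite -h /w; ring.
move/(congr1 (@cabs R)); rewrite !cabsM hz mulr1 !cabs_real !gtr0_norm// => hab.
have -> : 2 * B * e / (1 - cabs z) = B * e / d by rewrite /d; field; rewrite gt_eqF.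
by rewrite ler_pdivlMr// hab ler_wpM2r// ltW.
Qed.

(** The residue classes partition the indices, so a combination of the [h k] is one full lacunary
    series whose coefficients are periodic modulo [n + 1]. *)
Lemma ev_lacunary_combination (n : nat) (h : 'I_n.+1 -> Hinf R) (lam : 'I_n.+1 -> C)
    (chi : nat -> C) :
  (forall k : 'I_n.+1,
     (fun J => \sum_(0 <= j < J) (if (j %% n.+1 == k)%N then (1 - chi 2) * lac_term chi j else 0))
       @ \oo --> ev chi (h k)) ->
  (fun J => \sum_(0 <= j < J) lam (inord (j %% n.+1)%N) * ((1 - chi 2) * lac_term chi j))
    @ \oo --> \sum_k lam k * ev chi (h k).
Proof.
move=> hl.
have E : (fun J => \sum_(0 <= j < J) lam (inord (j %% n.+1)%N) * ((1 - chi 2) * lac_term chi j)) =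
   (fun J => \sum_k lam k * \sum_(0 <= j < J)
     (if (j %% n.+1 == k)%N then (1 - chi 2) * lac_term chi j else 0)).
  apply/funext => J; under [RHS]eq_bigr do rewrite mulr_sumr.
  rewrite exchange_big/=; apply: eq_bigr => j _.
  have jn : (j %% n.+1 < n.+1)%N by rewrite ltn_mod.
  rewrite (bigD1 (inord (j %% n.+1)%N))//= inordK// eqxx big1 ?addr0// => k.
  by rewrite -val_eqE/= inordK// eq_sym => /negPf ->; rewrite mulr0.
rewrite E; apply: (@cvg_big _ _ _ _ _ _ _ _ _ _ (fun k => lam k * ev chi (h k))).
  exact: add_continuous.
by move=> k _; exact: (cvgM (cvg_cst _) (hl k)).
Qed.

Lemma combination_regroup (n r : nat) (lam x : 'I_n -> C) (y : 'I_n -> 'I_r -> C)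
    (z : 'I_r -> C) : (forall k, x k = \sum_i y k i * z i) ->
  \sum_k lam k * x k = \sum_i (\sum_k lam k * y k i) * z i.
Proof.
move=> hx; under eq_bigr do rewrite hx mulr_sumr.
rewrite exchange_big/=; apply: eq_bigr => i _; rewrite mulr_suml.
by apply: eq_bigr => k _; rewrite mulrA.
Qed.

(* A combination [lam] killing the coefficients at the first point of a block where they are
   nearly constant contradicts the lower bound at the point of the block where the
   largest [lam k0] governs the dominating lacunary term. *)
Lemma lacunary_relations_independent (r : nat) (g1 g2 : 'I_r -> Hinf R)
    (h : 'I_r.+1 -> Hinf R) (c : 'I_r.+1 * 'I_r -> Hinf R) :
  (forall i, g1 i * (F3 - F5) + g2 i * (1 - F2) = 0) ->
  (forall (k : 'I_r.+1) (chi : nat -> C) S, character chi S -> small chi ->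
     (fun J => \sum_(0 <= j < J) (if (j %% r.+1 == k)%N then (1 - chi 2) * lac_term chi j else 0))
       @ \oo --> ev chi (h k)) ->
  ~ forall k, h k = \sum_i c (k, i) * g1 i.
Proof.
move=> rel hlim hc; have /choice[b hb] : forall i, exists B, bounded_by (g2 i) B.
  by move=> i; exact: exists_bound.
have b0 i : 0 <= b i := le_trans (cabs_ge0 _) (hb i point).
pose sb := \sum_i b i; have sb0 : 0 <= sb by rewrite sumr_ge0.
pose n := r.+1; have np : 0 < n%:R :> R by rewrite ltr0n.
(* Chosen so that the upper bound becomes [|lam k0| * e * lac i0 * sb / (8 (sb + 1))], strictly
   below the lower bound [|lam k0| * e * lac i0 / 8]. *)
pose delta := (64 * n%:R ^+ 2 * (sb + 1))^-1.
have dp : 0 < 64 * n%:R ^+ 2 * (sb + 1) by rewrite !mulr_gt0 ?exprn_gt0//; lra.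
have d0 : 0 < delta by rewrite invr_gt0.
have [Q hQ] := near_constant_block c (ltn0Sn r) d0.
(* Small enough for [lac i0 * e <= 1/8] at every index [i0 <= n * Q] that the pigeonhole may
   return. *)
pose e := (8 * (lac (n * Q))%:R)^-1 : R.
have lp := lac_pos R (n * Q).
have l1 : 1 <= (lac (n * Q))%:R :> R by rewrite ler1n lac_gt0.
have l8 : 0 < 8 * (lac (n * Q))%:R :> R by lra.
have e0 : 0 < e by rewrite invr_gt0.
have e1 : e <= 1 by rewrite invf_le1//; lra.
have X1 : cabs (1 - e)%:C < 1 :> R by rewrite cabs_real ger0_norm; lra.
have [zeta [q [hz qQ hconst]]] := hQ _ X1.
pose P a := radial (1 - e)%:C (rho R (n * q + a)) zeta.
have zr i : cabs ((rho R i)%:C * zeta) = rho R i.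
  by rewrite cabsM hz mulr1 cabs_real ger0_norm//; have /andP[] := rho_bounds R i.
have zr1 i : cabs ((rho R i)%:C * zeta) < 1.
  by rewrite zr; have /andP[] := rho_bounds R i.
have [lam [ker [k0 [lam0 lam_max]]]] :=
  left_kernel_max (\matrix_(k, i) ev (P 0%N) (c (k, i))).
(* Within the block, the radius whose index is congruent to [k0] modulo [r + 1]: the dominating term
   there carries the coefficient [lam k0]. *)
set i0 := (n * q + k0)%N.
have [S hS] := chr_character X1 (zr1 i0) (zr1 i0).
have hsm := chr_small X1 (zr1 i0) (zr1 i0).
have ker_bound i : cabs (\sum_k lam k * ev (P k0) (c (k, i))) <=
    cabs (lam k0) * (n%:R ^+ 2 * delta).
  have ker_i : \sum_k lam k * ev (P 0%N) (c (k, i)) = 0.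
    by apply: etrans (ker i); apply: eq_bigr => k _; rewrite mxE.
  have close k : cabs (ev (P k0) (c (k, i)) - ev (P 0%N) (c (k, i))) <= n%:R * delta.
    by have := hconst (k, i) k0 (ltn_ord k0); rewrite /P addn0.
  by rewrite expr2 -mulrA; exact: kernel_sum_bound ker_i lam_max close.
have g1_bound i : cabs (ev (P k0) (g1 i)) <= 2 * b i * e * (4 * (lac i0)%:R).
  have e01 : 0 < e <= 1 by rewrite e0.
  have := relation_diagonal_bound (rel i) (hb i) e01 (zr1 i0).
  by rewrite zr /rho subKr invrK.
have upper : cabs (\sum_k lam k * ev (P k0) (h k)) <=
    cabs (lam k0) * (n%:R ^+ 2 * delta) * (8 * sb * e * (lac i0)%:R).
  have -> : \sum_k lam k * ev (P k0) (h k) =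
      \sum_i (\sum_k lam k * ev (P k0) (c (k, i))) * ev (P k0) (g1 i).
    apply: combination_regroup => k; rewrite hc.
    apply: etrans (ev_sum hS _ _ _) _; apply: eq_bigr => i _; exact: evM hS _ _.
  apply: (le_trans (cabs_sum _ _ _)).
  apply: (@le_trans _ _ (\sum_i cabs (lam k0) * (n%:R ^+ 2 * delta) *
      (2 * b i * e * (4 * (lac i0)%:R)))).
    by apply: ler_sum => i _; rewrite cabsM; apply: ler_pM; rewrite ?cabs_ge0.
  rewrite -mulr_sumr -!mulr_suml -mulr_sumr le_eqVlt; apply/orP; left; apply/eqP.
  by rewrite -/sb; ring.
have i0I : (i0 <= n * Q)%N.
  apply: (@leq_trans (n * q.+1)); last by rewrite leq_mul2l qQ orbT.
  by rewrite /i0 mulnS addnC leq_add2r ltnW.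
have li0 := lac_pos R i0.
have lower : cabs (lam k0) * (e * (lac i0)%:R / 8) <=
    cabs (\sum_k lam k * ev (P k0) (h k)).
  have i0k : inord (i0 %% r.+1)%N = k0.
    by rewrite /i0 /n mulnC modnMDl modn_small// inord_val.
  have := ev_lacunary_combination (lam := lam) (fun k => hlim k _ _ hS hsm).
  rewrite chr2 (_ : 1 - (1 - e)%:C = e%:C); last by rewrite rmorphB rmorph1; ring.
  rewrite -{1}i0k.
  apply: (lacunary_lower_bound (mu := fun j => lam (inord (j %% r.+1)%N)) _ _ hz).
  - by rewrite (ltW e0).
  - by rewrite /e invfM mulrCA ler_piMr// ler_pdivrMr// mul1r lac_le.
  - by move=> j; rewrite i0k; exact: lam_max.
have := le_trans lower upper; apply/negP; rewrite -ltNge -mulrA ltr_pM2l//.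
have -> : n%:R ^+ 2 * delta = (64 * (sb + 1))^-1.
  have sb1 : sb + 1 != 0 by rewrite gt_eqF// ltr_wpDl.
  by rewrite /delta; field; rewrite sb1 gt_eqF.
have el : 0 < e * (lac i0)%:R by rewrite mulr_gt0.
rewrite mulrC ltr_pdivrMr; last by lra.
nra.
Qed.

End FiniteGeneration.

Theorem theorem1p4 (R : realType) : ~ coherent (Hinf R).
Proof.
have [F2 [s2 e2]] := @mono_element R 2 isT.
have [F3 [s3 e3]] := @mono_element R 3 isT.
have [F5 [s5 e5]] := @mono_element R 5 isT.
pose f : 'rV[Hinf R]_2 := \row_j (if j == 0 then F3 - F5 else 1 - F2).
have relE (x : 'rV[Hinf R]_2) : \sum_(i < 2) x 0 i * f 0 i =
    x 0 0 * (F3 - F5) + x 0 1 * (1 - F2).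
  rewrite big_ord_recl big_ord1 (_ : lift ord0 ord0 = 1); last exact/val_inj.
  by rewrite !mxE.
move=> /(_ 2%N isT f)[r [v hv]].
have rel i : v i 0 0 * (F3 - F5) + v i 0 1 * (1 - F2) = 0.
  have : relations f (v i).
    (* A generator belongs to the module it generates, by Kronecker coefficients, hence is itself a
       relation. *)
    rewrite hv; exists (fun j => (j == i)%:R).
    by rewrite (bigD1 i)//= eqxx scale1r big1 ?addr0// => j /negPf->; rewrite scale0r.
  by rewrite /relations/= relE.
have /choice[h] : forall k : 'I_r.+1, exists h : Hinf R,
    (exists c : 'I_r -> Hinf R, h = \sum_i c i * v i 0 0) /\
    forall chi S, character chi S -> small chi ->
      (fun J => \sum_(0 <= j < J)
        (if (j %% r.+1 == k)%N then (1 - chi 2) * lac_term chi j else 0)) @ \oo --> ev chi h.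
  move=> k; have [h [h' [hs hlim]]] := @lacunary_elements R (fun j => (j %% r.+1 == k)%N).
  exists h; split=> //.
  have : relations f (\row_j (if j == 0 then h else - h')).
    rewrite /relations/= relE !mxE/=; apply/val_inj/funext => s.
    have := hs s; rewrite -s2 -s3 -s5 => hss.
    change (h s * (F3 s - F5 s) + - h' s * (1 - F2 s) = 0).
    by rewrite hss mulNr subrr.
  rewrite hv => -[c hc]; exists c.
  have /rowP/(_ 0) := hc; rewrite mxE eqxx => ->.
  by rewrite summxE; apply: eq_bigr => i _; rewrite mxE.
move=> hh; have /choice[c hc] := fun k => (hh k).1.
apply: (lacunary_relations_independent e2 e3 e5 rel (fun k => (hh k).2)
  (c := fun ki => c ki.1 ki.2)).
exact: hc.
Qed.
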